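(* Let $0<\alpha<1$ and let $H,E,P$ be the (sufficiently smooth) solutions of the Cole-Cole Maxwell system with constant coefficients $$\mu_0\frac{\partial H}{\partial t}=\frac{\partial E}{\partial x}+F_1,\qquad \epsilon_0\epsilon_\infty\frac{\partial E}{\partial t}=\frac{\partial H}{\partial x}-\frac{\partial P}{\partial t}+F_2,\qquad \tau_0^\alpha\frac{\partial^\alpha P}{\partial t^\alpha}+P=\epsilon_0(\epsilon_s-\epsilon_\infty)E+F_3$$ on the bounded interval $\Omega=[x_-,x_+]$, with the periodic boundary condition and periodic initial data $E(x,0)=E_0(x)$, $H(x,0)=H_0(x)$, $P(x,0)=P_0(x)=0$. Let $H_h,E_h,P_h$ (together with $\psi_h$) be the solutions of the semi-discrete DG scheme described in the context, with piecewise polynomials of degree $k\ge1$ on a uniform mesh of size $h$, the periodic boundary condition and the upwind numerical flux $$\widehat{E_h}=\{E_h\}+\frac12\sqrt{\frac{\mu_0}{\epsilon_0\epsilon_\infty}}\,[H_h],\qquad \widehat{H_h}=\{H_h\}+\frac12\sqrt{\frac{\epsilon_0\epsilon_\infty}{\mu_0}}\,[E_h].$$ If $\psi_h(0)=0$ and the initial data $P_h(0),E_h(0),H_h(0)$ are obtained by the projections $\mathcal{P}_P,\mathcal{P}_E,\mathcal{P}_H$ (defined in the context), respectively, of the exact initial data, then $$\|E(t)-E_h(t)\|^2+\|H(t)-H_h(t)\|^2+\|P(t)-P_h(t)\|^2\le C\,h^{2k+2},\qquad \forall\, t\ge 0,$$ where $C$ is a positive constant independent of $h$ (it may depend on $\Omega$,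 $k$, $t$, the coefficients and the exact solution).
   Context: The coefficients $\mu_0,\epsilon_0,\epsilon_\infty,\epsilon_s,\tau_0$ are positive constants with $\epsilon_s>\epsilon_\infty$. $\|\cdot\|$ is the $L^2(\Omega)$ norm. The Caputo derivative is $\frac{\partial^\alpha P(x,t)}{\partial t^\alpha}=\frac{1}{\Gamma(1-\alpha)}\int_0^t(t-\tau)^{-\alpha}\frac{\partial P(x,\tau)}{\partial\tau}d\tau$. Exact auxiliary variable: $\psi(x,t;\lambda)=\frac{\sin(\pi\alpha)}{\pi}\lambda^{\alpha-1}\int_0^te^{-(t-\tau)\lambda}\frac{\partial P(x,\tau)}{\partial\tau}d\tau$, $\lambda>0$, so that $\frac{\partial^\alpha P}{\partial t^\alpha}=\int_0^\infty\psi\,d\lambda$. The exact solution is assumed sufficiently smooth. Mesh: $\Omega$ is divided into $M$ cells $I_j=[x_{j-1/2},x_{j+1/2}]$, $j=1,\dots,M$, of equal size $h=(x_+-x_-)/M$, with $x_{1/2}=x_-$, $x_{M+1/2}=x_+$. For $k\ge1$, $V_h=\{v:v|_{I_j}\in\mathbb{P}^k(I_j),\ j=1,\dots,M\}$, with $\mathbb{P}^k(I_j)$ the polynomials of degree at most $k$ on $I_j$. For $v\in V_h$, $v^+_{j+1/2}$, $v^-_{j+1/2}$ are the limits of $v$ at $x_{j+1/2}$ from $I_{j+1}$ and $I_j$; $[v]_{j+1/2}=v^+_{j+1/2}-v^-_{j+1/2}$, $\{v\}_{j+1/2}=\tfrac12(v^+_{j+1/2}+v^-_{j+1/2})$. Periodicity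 identifies $x_{1/2}$ and $x_{M+1/2}$. DG scheme: find $H_h(\cdot,t),E_h(\cdot,t),P_h(\cdot,t)\in V_h$ and, for each $\lambda>0$, $\psi_h(\cdot,t;\lambda)\in V_h$ such that for all $v\in V_h$, all $j$, all $\lambda>0$: $$\int_{I_j}\mu_0\frac{\partial H_h}{\partial t}v\,dx+\int_{I_j}E_h\frac{\partial v}{\partial x}dx-\widehat{E_h}v^-|_{x_{j+1/2}}+\widehat{E_h}v^+|_{x_{j-1/2}}=\int_{I_j}F_1v\,dx,$$ $$\int_{I_j}\epsilon_0\epsilon_\infty\frac{\partial E_h}{\partial t}v\,dx+\int_{I_j}\frac{\partial P_h}{\partial t}v\,dx+\int_{I_j}H_h\frac{\partial v}{\partial x}dx-\widehat{H_h}v^-|_{x_{j+1/2}}+\widehat{H_h}v^+|_{x_{j-1/2}}=\int_{I_j}F_2v\,dx,$$ $$\int_{I_j}\int_0^\infty\frac{\tau_0^\alpha}{\epsilon_0(\epsilon_s-\epsilon_\infty)}\psi_hv\,d\lambda\,dx+\int_{I_j}\frac{P_h}{\epsilon_0(\epsilon_s-\epsilon_\infty)}v\,dx-\int_{I_j}E_hv\,dx=\int_{I_j}\frac{F_3}{\epsilon_0(\epsilon_s-\epsilon_\infty)}v\,dx,$$ $$\int_{I_j}\frac{\tau_0^\alpha}{\epsilon_0(\epsilon_s-\epsilon_\infty)}\frac{\partial\psi_h}{\partial t}v\,dx+\lambda\int_{I_j}\frac{\tau_0^\alpha}{\epsilon_0(\epsilon_s-\epsilon_\infty)}\psi_hv\,dx-\frac{\sin(\pi\alpha)}{\pi}\lambda^{\alpha-1}\int_{I_j}\frac{\tau_0^\alpha}{\epsilon_0(\epsilon_s-\epsilon_\infty)}\frac{\partial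 P_h}{\partial t}v\,dx=0.$$ Projections onto $V_h$: the $L^2$ projection $\mathcal{P}$ satisfies $\int_{I_j}(\mathcal{P}\varphi-\varphi)v\,dx=0$ for all $v\in\mathbb{P}^k(I_j)$ and all $j$. The Gauss-Radau projections $\mathcal{P}^\pm:\mathcal{H}^1(\Omega)\to V_h$ satisfy, for all $j$, $$\int_{I_j}(\mathcal{P}^+\varphi-\varphi)v\,dx=0\ \ \forall v\in\mathbb{P}^{k-1}(I_j),\qquad \mathcal{P}^+\varphi(x^+_{j-1/2})=\varphi(x_{j-1/2}),$$ $$\int_{I_j}(\mathcal{P}^-\varphi-\varphi)v\,dx=0\ \ \forall v\in\mathbb{P}^{k-1}(I_j),\qquad \mathcal{P}^-\varphi(x^-_{j+1/2})=\varphi(x_{j+1/2}).$$ Then $\mathcal{P}_P=\mathcal{P}$ is the $L^2$ projection (applied to $P$), and the projections of $E$ and $H$ are $$\mathcal{P}_E=\frac12\mathcal{P}^+\Big(E+\sqrt{\tfrac{\mu_0}{\epsilon_0\epsilon_\infty}}H\Big)+\frac12\mathcal{P}^-\Big(E-\sqrt{\tfrac{\mu_0}{\epsilon_0\epsilon_\infty}}H\Big),$$ $$\mathcal{P}_H=\frac12\mathcal{P}^+\Big(H+\sqrt{\tfrac{\epsilon_0\epsilon_\infty}{\mu_0}}E\Big)+\frac12\mathcal{P}^-\Big(H-\sqrt{\tfrac{\epsilon_0\epsilon_\infty}{\mu_0}}E\Big).$$ *)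

(* Defs.v *)
From HB Require Import structures.
From mathcomp Require Import all_boot all_order all_algebra.
From mathcomp Require Import all_classical all_reals all_analysis.

Set Implicit Arguments.
Unset Strict Implicit.
Unset Printing Implicit Defensive.

Import Order.TTheory GRing.Theory Num.Theory.
Import numFieldNormedType.Exports.

Local Open Scope classical_set_scope.
Local Open Scope ring_scope.

Section Calculus.
Context {R : realType}.

Local Notation mu := (@lebesgue_measure R).

Definition Gamma (s : R) : R :=
  \int[mu]_(u in `]0, +oo[) (u `^ (s - 1) * expR (- u)).

Definition caputo (alpha : R) (u : R -> R) (t : R) : R :=
  (Gamma (1 - alpha))^-1 *
  \int[mu]_(tau in `]0, t[) ((t - tau) `^ (- alpha) * derive1 u tau).

Definition dx (u : R -> R -> R) (x t : R) : R := derive1 (fun y => u y t) x.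
Definition dt (u : R -> R -> R) (x t : R) : R := derive1 (fun s => u x s) t.

(* L^2 norm on the interval [a, b], valued in the extended reals. *)
Definition L2norm (a b : R) (f : R -> R) : \bar R :=
  ('N[mu]_(2%:E)[(EFin \o f) \_ `[a, b]])%E.

(* u is C^n in x and C^m in t on [a, b] x [0, +oo[, up to the boundary:
   D i j is the partial derivative of order i in x and j in t, which exists
   in the interior and extends continuously to the closed domain. *)
Definition smooth_class (a b : R) (n m : nat) (u : R -> R -> R) : Prop :=
  exists D : nat -> nat -> R -> R -> R,
  [/\ forall x t : R, x \in `[a, b] -> 0 <= t -> D 0%N 0%N x t = u x t,
      forall i j, (i <= n)%N -> (j <= m)%N ->
        {within `[a, b] `*` `[0, +oo[,
          continuous (fun p : R * R => D i j p.1 p.2)},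
      forall i j (x t : R), (i < n)%N -> (j <= m)%N -> x \in `]a, b[ -> 0 <= t ->
        is_derive x (1 : R) (fun y => D i j y t) (D i.+1 j x t) &
      forall i j (x t : R), (i <= n)%N -> (j < m)%N -> x \in `[a, b] -> 0 < t ->
        is_derive t (1 : R) (fun s => D i j x s) (D i j.+1 x t)].

End Calculus.

Section ColeColeMaxwell.
Context {R : realType}.
Variables (mu0 eps0 epsinf epss tau0 alpha : R).
Variables (xl xr : R).
Variables (F1 F2 F3 : R -> R -> R).
Variables (E0 H0 : R -> R).

Definition periodic_bc (u : R -> R -> R) : Prop :=
  forall t : R, 0 <= t -> u xl t = u xr t.

Record exact_solution (k : nat) (H E P : R -> R -> R) : Prop := ExactSolution {
  exact_smoothH : smooth_class xl xr k.+1 1 H;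
  exact_smoothE : smooth_class xl xr k.+1 1 E;
  exact_smoothP : smooth_class xl xr k.+1 1 P;
  exact_faraday : forall x t : R, x \in `]xl, xr[ -> 0 < t ->
    mu0 * dt H x t = dx E x t + F1 x t;
  exact_ampere : forall x t : R, x \in `]xl, xr[ -> 0 < t ->
    eps0 * epsinf * dt E x t = dx H x t - dt P x t + F2 x t;
  exact_colecole : forall x t : R, x \in `]xl, xr[ -> 0 < t ->
    tau0 `^ alpha * caputo alpha (P x) t + P x t =
      eps0 * (epss - epsinf) * E x t + F3 x t;
  exact_bcH : periodic_bc H;
  exact_bcE : periodic_bc E;
  exact_bcP : periodic_bc P;
  exact_initE : forall x : R, x \in `[xl, xr] -> E x 0 = E0 x;
  exact_initH : forall x : R, x \in `[xl, xr] -> H x 0 = H0 x;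
  exact_initP : forall x : R, x \in `[xl, xr] -> P x 0 = 0
}.

Section Scheme.
Variables (k M : nat).

Local Notation mu := (@lebesgue_measure R).

Definition mesh_size : R := (xr - xl) / M%:R.

Definition node (i : nat) : R := xl + i%:R * mesh_size.

Definition cell (j : 'I_M) : set R := [set` `[node j, node j.+1]].

(* A piecewise polynomial is given by its polynomial on each cell, in the
   global variable x. *)
Definition piecewise : Type := 'I_M -> {poly R}.

Definition Vh (v : piecewise) : Prop := forall j, (size (v j) <= k.+1)%N.

(* The values at the interfaces, a null set, are irrelevant here. *)
Definition pw_eval (v : piecewise) (x : R) : R :=
  \sum_(j < M) (if x \in `[node j, node j.+1[ then (v j).[x] else 0).

(* Interfaces are indexed by the cell on their left; by periodicity the cell
   on their right is the cyclic successor ordS j. *)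
Definition trace_minus (v : piecewise) (j : 'I_M) : R := (v j).[node j.+1].
Definition trace_plus (v : piecewise) (j : 'I_M) : R :=
  (v (ordS j)).[node (ordS j)].
Definition jump (v : piecewise) (j : 'I_M) : R :=
  trace_plus v j - trace_minus v j.
Definition avg (v : piecewise) (j : 'I_M) : R :=
  2^-1 * (trace_plus v j + trace_minus v j).

Definition flux_E (Eh Hh : piecewise) (j : 'I_M) : R :=
  avg Eh j + 2^-1 * Num.sqrt (mu0 / (eps0 * epsinf)) * jump Hh j.
Definition flux_H (Eh Hh : piecewise) (j : 'I_M) : R :=
  avg Hh j + 2^-1 * Num.sqrt (eps0 * epsinf / mu0) * jump Eh j.

Definition is_L2proj (phi : R -> R) (q : piecewise) : Prop :=
  Vh q /\
  forall j (v : {poly R}), (size v <= k.+1)%N ->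
    \int[mu]_(x in cell j) (((q j).[x] - phi x) * v.[x]) = 0.

Definition is_proj_plus (phi : R -> R) (q : piecewise) : Prop :=
  [/\ Vh q,
      forall j (v : {poly R}), (size v <= k)%N ->
        \int[mu]_(x in cell j) (((q j).[x] - phi x) * v.[x]) = 0 &
      forall j, (q j).[node j] = phi (node j)].

Definition is_proj_minus (phi : R -> R) (q : piecewise) : Prop :=
  [/\ Vh q,
      forall j (v : {poly R}), (size v <= k)%N ->
        \int[mu]_(x in cell j) (((q j).[x] - phi x) * v.[x]) = 0 &
      forall j, (q j).[node j.+1] = phi (node j.+1)].

Definition is_proj_E (E H : R -> R) (q : piecewise) : Prop :=
  exists qp qm : piecewise,
  [/\ is_proj_plus
        (fun x => E x + Num.sqrt (mu0 / (eps0 * epsinf)) * H x) qp,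
      is_proj_minus
        (fun x => E x - Num.sqrt (mu0 / (eps0 * epsinf)) * H x) qm &
      forall j, q j = 2^-1 *: qp j + 2^-1 *: qm j].

Definition is_proj_H (E H : R -> R) (q : piecewise) : Prop :=
  exists qp qm : piecewise,
  [/\ is_proj_plus
        (fun x => H x + Num.sqrt (eps0 * epsinf / mu0) * E x) qp,
      is_proj_minus
        (fun x => H x - Num.sqrt (eps0 * epsinf / mu0) * E x) qm &
      forall j, q j = 2^-1 *: qp j + 2^-1 *: qm j].

(* Time regularity of semi-discrete functions: coefficients continuous on
   [0, +oo[ and C^1 on ]0, +oo[. One cannot ask for C^1 up to t = 0: since
   E_h(0) is not the L^2 projection of E_0, the Caputo derivative of P_h has
   in general a nonzero limit at 0, so that P_h - P_h(0) behaves like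
   t^alpha. *)
Definition time_regular (u : R -> piecewise) : Prop :=
  forall j i,
  [/\ {within `[0, +oo[, continuous (fun t => (u t j)`_i)},
      forall t : R, 0 < t -> derivable (fun s => (u s j)`_i) t 1 &
      forall t : R, 0 < t -> {for t, continuous (derive1 (fun s => (u s j)`_i))}].

Definition pw_dt (u : R -> piecewise) (t : R) (j : 'I_M) (x : R) : R :=
  derive1 (fun s => (u s j).[x]) t.

(* The second argument of psih is the parameter lambda. *)
Record dg_solution (Hh Eh Ph : R -> piecewise) (psih : R -> R -> piecewise) :
    Prop := DGSolution {
  dg_VhH : forall t : R, 0 <= t -> Vh (Hh t);
  dg_VhE : forall t : R, 0 <= t -> Vh (Eh t);
  dg_VhP : forall t : R, 0 <= t -> Vh (Ph t);
  dg_Vhpsi : forall t l : R, 0 <= t -> 0 < l -> Vh (psih t l);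
  dg_regH : time_regular Hh;
  dg_regE : time_regular Eh;
  dg_regP : time_regular Ph;
  dg_regpsi : forall l : R, 0 < l -> time_regular (psih ^~ l);
  dg_intpsi : forall (t : R) j (x : R), 0 < t -> cell j x ->
    mu.-integrable `]0, +oo[ (EFin \o (fun l => (psih t l j).[x]));
  dg_faraday : forall (t : R) (v : piecewise) (j : 'I_M), 0 < t -> Vh v ->
    \int[mu]_(x in cell j) (mu0 * pw_dt Hh t j x * (v j).[x])
    + \int[mu]_(x in cell j) ((Eh t j).[x] * (v j)^`().[x])
    - flux_E (Eh t) (Hh t) j * trace_minus v j
    + flux_E (Eh t) (Hh t) (ord_pred j) * trace_plus v (ord_pred j)
    = \int[mu]_(x in cell j) (F1 x t * (v j).[x]);
  dg_ampere : forall (t : R) (v : piecewise) (j : 'I_M), 0 < t -> Vh v ->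
    \int[mu]_(x in cell j) (eps0 * epsinf * pw_dt Eh t j x * (v j).[x])
    + \int[mu]_(x in cell j) (pw_dt Ph t j x * (v j).[x])
    + \int[mu]_(x in cell j) ((Hh t j).[x] * (v j)^`().[x])
    - flux_H (Eh t) (Hh t) j * trace_minus v j
    + flux_H (Eh t) (Hh t) (ord_pred j) * trace_plus v (ord_pred j)
    = \int[mu]_(x in cell j) (F2 x t * (v j).[x]);
  dg_colecole : forall (t : R) (v : piecewise) (j : 'I_M), 0 < t -> Vh v ->
    \int[mu]_(x in cell j) (\int[mu]_(l in `]0, +oo[)
      (tau0 `^ alpha / (eps0 * (epss - epsinf))
        * (psih t l j).[x] * (v j).[x]))
    + \int[mu]_(x in cell j)
        ((Ph t j).[x] / (eps0 * (epss - epsinf)) * (v j).[x])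
    - \int[mu]_(x in cell j) ((Eh t j).[x] * (v j).[x])
    = \int[mu]_(x in cell j)
        (F3 x t / (eps0 * (epss - epsinf)) * (v j).[x]);
  dg_psi : forall (t l : R) (v : piecewise) (j : 'I_M), 0 < t -> 0 < l -> Vh v ->
    \int[mu]_(x in cell j) (tau0 `^ alpha / (eps0 * (epss - epsinf))
        * pw_dt (psih ^~ l) t j x * (v j).[x])
    + l * \int[mu]_(x in cell j) (tau0 `^ alpha / (eps0 * (epss - epsinf))
        * (psih t l j).[x] * (v j).[x])
    - sin (pi * alpha) / pi * l `^ (alpha - 1)
      * \int[mu]_(x in cell j) (tau0 `^ alpha / (eps0 * (epss - epsinf))
        * pw_dt Ph t j x * (v j).[x])
    = 0;
  dg_initpsi : forall (l : R) j, 0 < l -> psih 0 l j = 0;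
  dg_initP : is_L2proj (fun=> 0) (Ph 0);
  dg_initE : is_proj_E E0 H0 (Eh 0);
  dg_initH : is_proj_H E0 H0 (Hh 0)
}.

End Scheme.
End ColeColeMaxwell.

(* Main.v *)
Require Import Defs.
From HB Require Import structures.
From mathcomp Require Import all_boot all_order all_algebra.
From mathcomp Require Import all_classical all_reals all_analysis.
From mathcomp Require Import qpoly measurable_realfun ring lra.

Set Implicit Arguments.
Unset Strict Implicit.
Unset Printing Implicit Defensive.

Import Order.TTheory GRing.Theory Num.Theory.
Import numFieldNormedType.Exports.

Local Open Scope classical_set_scope.
Local Open Scope ring_scope.

(** The error of each unknown is the sum of a projection error, E - P_E E, and of
    a piecewise polynomial, P_E E - E_h.  On a cell of length h the first one is a
    Taylor remainder, of size h^(k+1), uniformly in the cell and in the time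
    ([poly_approx], [field_bound]).  It remains to bound the second one, that is,
    its coordinates in an orthonormal polynomial basis of each cell.

    Put Z = sqrt (mu0 / (eps0 epsinf)).  The projections are designed for the
    characteristic variables E + Z H and E - Z H: the combinations P_E + Z P_H
    and P_E - Z P_H are the Gauss-Radau projections of these variables, exact at
    the left, resp. right, end of each cell.  The upwind flux at a node uses
    just these two values, so that the flux of the projections is the exact
    trace; the volume terms only see moments of degree less than k, which are
    exact too.  Hence the discrete space operators, applied to the projections,
    give the coordinates of - E_x and - H_x ([formE_exact], [formH_exact]), and
    the coordinates of the error solve the scheme with right-hand sides that come
    only from the shift of the top mode, Radau against L2 coordinates, and that
    are of size h^(k+1) ([error_equations], [sE_le], [sH_le]).

    Stability is an energy argument.  The upwind forms are dissipative
    ([upwind_dissipation]).  The memory variable has a stored energy, the integral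
    over lambda of lambda^(1-alpha) psi^2 / (2 c), whose growth is at most the
    power supplied by the polarization ([mem_energy_deri]).  There is one
    difficulty.  As E_h(0) is not the L2 projection of E_0, the residual of the
    third equation does not vanish at time 0: P_h - P_h(0) behaves like t^alpha
    there, and that equation cannot be differentiated up to t = 0.  So the
    equations are integrated once in time, and the energy is computed for the
    increments over a time s of the integrated unknowns.  The residual of the
    third equation is then tested with the increment of the integral of P, and
    an integration by parts in time moves the derivative onto the residual, which
    is Lipschitz away from 0; the first time layer, of length s, contributes
    o(s^2).  Dividing by s^2 and letting s tend to 0 gives [energy_estimate].

    The exact solution satisfies the same third equation because its Caputo
    derivative is the integral over lambda of its memory variable
    ([exact_memory_total]).  By Fubini this is the Laplace transform of
    lambda^(alpha-1) ([laplace_powR]) together with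
    Gamma(alpha) Gamma(1-alpha) = pi / sin (pi alpha) ([Gamma_reflection]), which
    reduces to the integral of u^(alpha-1) / (1 + u) over the half-line and, by
    expansion into alternating series, to the partial fractions of the cosecant
    ([csc_series_le]). *)
(** * Derivatives and integrals of real functions *)

Section Derivatives.
Context {R : realType}.
Implicit Types (f g : R -> R) (x a b c B : R).

Lemma deriD f g x a b : is_derive x 1 f a -> is_derive x 1 g b ->
  is_derive x 1 (fun y => f y + g y) (a + b).
Proof. by move=> fa gb; exact: is_deriveD. Qed.

Lemma deriB f g x a b : is_derive x 1 f a -> is_derive x 1 g b ->
  is_derive x 1 (fun y => f y - g y) (a - b).
Proof. by move=> fa gb; exact: is_deriveB. Qed.

Lemma deriN f x a : is_derive x 1 f a ->
  is_derive x 1 (fun y => - f y) (- a).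
Proof. by move=> fa; exact: is_deriveN. Qed.

Lemma deriM f g x a b : is_derive x 1 f a -> is_derive x 1 g b ->
  is_derive x 1 (fun y => f y * g y) (a * g x + f x * b).
Proof.
move=> fa gb; have := is_deriveM fa gb.
by move=> h; apply: (is_derive_eq h); rewrite /GRing.scale/= addrC mulrC.
Qed.

Lemma deriZ c f x a : is_derive x 1 f a ->
  is_derive x 1 (fun y => c * f y) (c * a).
Proof. by move=> fa; exact: is_deriveZ. Qed.

Lemma deri_cst c x : is_derive x 1 (fun _ : R => c) (0 : R).
Proof. exact: is_derive_cst. Qed.

Lemma deri_id x : is_derive x 1 (fun y : R => y) (1 : R).
Proof. exact: is_derive_id. Qed.

Lemma deri_comp f g x a b : is_derive (g x) 1 f a -> is_derive x 1 g b ->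
  is_derive x 1 (fun y => f (g y)) (a * b).
Proof. by move=> fa gb; exact: is_derive1_comp. Qed.

Lemma deri_shift f x c a : is_derive (x - c) 1 f a ->
  is_derive x 1 (fun y => f (y - c)) a.
Proof.
move=> fa; rewrite -[a]mulr1 -[X in a * X]subr0.
by apply: deri_comp => //; apply: deriB.
Qed.

Lemma deri_expRZ c x : is_derive x 1 (fun y => expR (c * y)) (c * expR (c * x)).
Proof.
rewrite mulrC; apply: deri_comp.
by rewrite -[X in is_derive _ _ _ X]mulr1; apply: deriZ.
Qed.

Lemma deri_sqr f x a : is_derive x 1 f a ->
  is_derive x 1 (fun y => f y ^+ 2) (2 * f x * a).
Proof. by move=> fa; apply: (is_derive_eq (deriM fa fa)); ring. Qed.

Lemma deri_sum (I : Type) (r : seq I) (P : pred I) (f : I -> R -> R)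
    (a : I -> R) x :
  (forall i, P i -> is_derive x 1 (f i) (a i)) ->
  is_derive x 1 (fun y => \sum_(i <- r | P i) f i y) (\sum_(i <- r | P i) a i).
Proof.
move=> fa; elim: r => [|i r IH].
  under eq_fun do rewrite big_nil.
  by rewrite big_nil; exact: deri_cst.
under eq_fun do rewrite big_cons.
by rewrite big_cons; case: ifPn => // Pi; apply: deriD => //; exact: fa.
Qed.

Lemma deri_cont f x a : is_derive x 1 f a -> {for x, continuous f}.
Proof. by move=> [df _]; apply: differentiable_continuous; exact/derivable1_diffP. Qed.

Lemma deri_near f g x a : (\forall y \near x, f y = g y) ->
  is_derive x 1 f a -> is_derive x 1 g a.
Proof. by move=> fg fa; apply: near_eq_is_derive fa; rewrite ?oner_neq0. Qed.

Lemma deri_ext f g x a : f =1 g -> is_derive x 1 f a -> is_derive x 1 g a.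
Proof. by move=> /funext ->. Qed.

Lemma deri_derive1 f x a : is_derive x 1 f a -> derive1 f x = a.
Proof. by move=> fa; rewrite derive1E; exact: derive_val. Qed.

Lemma derivable_deri f x : derivable f x 1 -> is_derive x 1 f (derive1 f x).
Proof. by move=> df; rewrite derive1E; exact: DeriveDef. Qed.

Lemma contM f g x : {for x, continuous f} -> {for x, continuous g} ->
  {for x, continuous (fun y => f y * g y)}.
Proof. by move=> cf cg; exact: continuousM. Qed.

Lemma contD f g x : {for x, continuous f} -> {for x, continuous g} ->
  {for x, continuous (fun y => f y + g y)}.
Proof. by move=> cf cg; exact: continuousD. Qed.

Lemma contB f g x : {for x, continuous f} -> {for x, continuous g} ->
  {for x, continuous (fun y => f y - g y)}.
Proof. by move=> cf cg; exact: continuousB. Qed.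

Lemma contZ c f x : {for x, continuous f} -> {for x, continuous (fun y => c * f y)}.
Proof. by move=> cf; apply: contM => //; exact: cvg_cst. Qed.

Lemma cont_sum (I : Type) (r : seq I) (P : pred I) (f : I -> R -> R) x :
  (forall i, P i -> {for x, continuous (f i)}) ->
  {for x, continuous (fun y => \sum_(i <- r | P i) f i y)}.
Proof.
move=> cf; elim: r => [|i r IH].
  by under [X in {for _, continuous X}]eq_fun do rewrite big_nil; exact: cvg_cst.
under [X in {for _, continuous X}]eq_fun do rewrite big_cons.
by case: ifPn => // Pi; apply: contD => //; exact: cf.
Qed.

Lemma cont_shift f x c : {for (x - c), continuous f} ->
  {for x, continuous (fun y => f (y - c))}.
Proof.
move=> cf; apply: continuous_comp => //.
exact: deri_cont (deriB (deri_id x) (deri_cst c x)).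
Qed.

(** Comparison of increments by comparison of derivatives.  It replaces integrals
    of derivatives, and so does not ask the derivatives to be continuous. *)
Lemma le_increment (f g df dg : R -> R) a b : a <= b ->
  {within `[a, b], continuous f} -> {within `[a, b], continuous g} ->
  (forall x, x \in `]a, b[ -> is_derive x 1 f (df x)) ->
  (forall x, x \in `]a, b[ -> is_derive x 1 g (dg x)) ->
  (forall x, x \in `]a, b[ -> df x <= dg x) ->
  f b - f a <= g b - g a.
Proof.
move=> ab cf cg hf hg le_dfg.
suff : g a - f a <= g b - f b by lra.
apply: (@ger0_derive1_le_cc _ (fun x => g x - f x) a b) => //.
- by move=> x xab; have := deriB (hg x xab) (hf x xab); case.
- move=> x xab; rewrite (deri_derive1 (deriB (hg x xab) (hf x xab))).
  by rewrite subr_ge0 le_dfg.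
- exact: within_continuousB.
- by rewrite bound_itvE.
- by rewrite bound_itvE.
Qed.

Lemma le_norm_increment (f g df dg : R -> R) a b : a <= b ->
  {within `[a, b], continuous f} -> {within `[a, b], continuous g} ->
  (forall x, x \in `]a, b[ -> is_derive x 1 f (df x)) ->
  (forall x, x \in `]a, b[ -> is_derive x 1 g (dg x)) ->
  (forall x, x \in `]a, b[ -> `|df x| <= dg x) ->
  `|f b - f a| <= g b - g a.
Proof.
move=> ab cf cg hf hg le_dfg; rewrite ler_norml; apply/andP; split.
  rewrite lerNl opprB.
  have : - f b - - f a <= g b - g a.
    apply: (le_increment (f := fun x => - f x) (df := fun x => - df x) ab _ cg _ hg).
    - by move=> x; apply: continuousN; exact: cf.
    - by move=> x xab; apply: deriN; exact: hf.
    - by move=> x xab; apply: le_trans (le_dfg x xab); rewrite -normrN ler_norm.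
  by lra.
apply: (le_increment ab cf cg hf hg) => x xab.
by apply: le_trans (le_dfg x xab); rewrite ler_norm.
Qed.

Lemma lipschitz_increment (f df : R -> R) B a b : a <= b ->
  {within `[a, b], continuous f} ->
  (forall x, x \in `]a, b[ -> is_derive x 1 f (df x)) ->
  (forall x, x \in `]a, b[ -> `|df x| <= B) ->
  `|f b - f a| <= B * (b - a).
Proof.
move=> ab cf hf le_df; rewrite mulrBr.
apply: (le_norm_increment (g := fun x => B * x) (dg := fun=> B) ab cf _ hf) => //.
  apply: continuous_subspaceT => x; exact: mulrl_continuous.
by move=> x xab; rewrite -[X in is_derive _ _ _ X]mulr1; apply: deriZ.
Qed.

Local Notation mu := (@lebesgue_measure R).

(** The base point is -1, and not 0, so that the primitive is differentiable at
    0: the functions integrated below vanish for t <= 0 and have a kink at 0. *)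
Definition prim (f : R -> R) (x : R) : R := \int[mu]_(y in `[-1, x]) f y.

Lemma cont_itv_integrable f a b : {within `[a, b], continuous f} ->
  mu.-integrable `[a, b] (EFin \o f).
Proof. by move=> cf; apply: continuous_compact_integrable => //; exact: segment_compact. Qed.

Lemma prim_deri f x : continuous f -> -1 < x -> is_derive x 1 (prim f) (f x).
Proof.
move=> cf x1; have xx : x < x + 1 by lra.
have [|df <-] := @continuous_FTC1_closed R f (-1) x (x + 1) xx _ x1 (cf x).
  by apply: cont_itv_integrable; exact: continuous_subspaceT.
exact: derivable_deri.
Qed.

Lemma prim_eq0 f x : (forall y, y <= 0 -> f y = 0) -> x <= 0 -> prim f x = 0.
Proof.
move=> f0 x0; rewrite /prim (@eq_Rintegral _ _ _ _ _ (cst 0)); last first.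
  by move=> y; rewrite inE/= in_itv/= => /andP[_ yx]; rewrite f0//; lra.
by rewrite Rintegral_cst ?mul0r.
Qed.

Section RealIntegrability.
Variable D : set (measurableTypeR R).
Hypothesis mD : measurable D.
Local Notation intg f := (mu.-integrable D (fun x => (f x)%:E)).

Lemma intgD f g : intg f -> intg g -> intg (fun x => f x + g x).
Proof. by move=> fi gi; have := integrableD mD fi gi; apply. Qed.

Lemma intgB f g : intg f -> intg g -> intg (fun x => f x - g x).
Proof. by move=> fi gi; have := integrableB mD fi gi; apply. Qed.

Lemma intgZ c f : intg f -> intg (fun x => c * f x).
Proof. by move=> fi; have := integrableZl mD c fi; apply. Qed.

Lemma intgZr c f : intg f -> intg (fun x => f x * c).
Proof. by move=> fi; have := integrableZr mD c fi; apply. Qed.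

Lemma intg_norm f : intg f -> intg (fun x => `|f x|).
Proof. by move=> fi; exact: (integrable_norm fi). Qed.

Lemma intg_eq f g : (forall x, D x -> f x = g x) -> intg f -> intg g.
Proof.
move=> fg; apply: eq_integrable => // x /set_mem Dx /=.
by rewrite fg.
Qed.

Lemma intg0 : intg (fun=> 0).
Proof. exact: integrable0. Qed.

Lemma intg_sum (I : Type) (r : seq I) (P : pred I) (f : I -> R -> R) :
  (forall i, P i -> intg (f i)) -> intg (fun x => \sum_(i <- r | P i) f i x).
Proof.
move=> fi; elim: r => [|i r IH].
  by apply: intg_eq intg0 => x _; rewrite big_nil.
have [Pi|Pi] := boolP (P i).
  by apply: intg_eq (intgD (fi i Pi) IH) => x _; rewrite big_cons Pi.
by apply: intg_eq IH => x _; rewrite big_cons (negbTE Pi).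
Qed.

Lemma intg_le f g : measurable_fun D f -> (forall x, D x -> `|f x| <= g x) ->
  intg g -> intg f.
Proof.
move=> mf fg; apply: le_integrable => //; first exact/measurable_EFinP.
by move=> x Dx; rewrite lee_fin (le_trans (fg x Dx))// ler_norm.
Qed.

Lemma intg_measurable f : intg f -> measurable_fun D f.
Proof. by move=> /integrableP[/measurable_EFinP]. Qed.

Lemma Rint_sum (I : Type) (r : seq I) (P : pred I) (f : I -> R -> R) :
  (forall i, P i -> intg (f i)) ->
  \int[mu]_(x in D) (\sum_(i <- r | P i) f i x) =
  \sum_(i <- r | P i) \int[mu]_(x in D) f i x.
Proof.
move=> fi; elim: r => [|i r IH].
  rewrite big_nil (@eq_Rintegral _ _ _ _ _ (cst 0)); last by move=> x _; rewrite big_nil.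
  by rewrite Rintegral_cst// mul0r.
under eq_Rintegral do rewrite big_cons.
rewrite big_cons; case: ifPn => // Pi.
by rewrite RintegralD//; [rewrite IH|exact: fi|exact: intg_sum].
Qed.

Lemma Rint_eq f g : (forall x, D x -> f x = g x) ->
  \int[mu]_(x in D) f x = \int[mu]_(x in D) g x.
Proof. by move=> fg; apply: eq_Rintegral => x /set_mem; exact: fg. Qed.

End RealIntegrability.

End Derivatives.

(** * Partial fractions of the cosecant *)

Section CosecantSeries.
Context {R : realType}.
Implicit Types (x y al : R).

Lemma abs_sin_le y : `|sin y| <= `|y|.
Proof.
wlog y0 : y / 0 <= y => [h|].
  have [|y0] := leP 0 y; first exact: h.
  by rewrite -normrN -sinN -[leRHS]normrN; apply: h; lra.
have := @lipschitz_increment R sin cos 1 0 y y0.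
rewrite sin0 !subr0 mul1r [`|y|]ger0_norm//; apply.
- exact/continuous_subspaceT/continuous_sin.
- by move=> x _; rewrite ler_norml cos_geN1 cos_le1.
Qed.

Lemma sin_le_id y : 0 <= y -> sin y <= y.
Proof. by move=> y0; rewrite (le_trans (ler_norm _))// (le_trans (abs_sin_le y))// ger0_norm. Qed.

Lemma cos_quad_abs y : 1 - cos y <= y ^+ 2 / 2.
Proof.
wlog y0 : y / 0 <= y => [h|].
  have [|y0] := leP 0 y; first exact: h.
  by rewrite -cosN -sqrrN; apply: h; lra.
have := @le_increment R (fun z => - cos z) (fun z => z ^+ 2 / 2) sin id 0 y y0.
rewrite cos0 expr0n/= mul0r subr0 opprK [- _ + 1]addrC; apply.
- by apply: continuous_subspaceT => z; apply: continuousN; exact: continuous_cos.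
- apply: continuous_subspaceT => z; apply: (@deri_cont _ _ _ (2 * z * 1 * 2^-1 + z ^+ 2 * 0)).
  by apply: deriM; apply: deri_sqr.
- by move=> x _; rewrite -[X in is_derive _ _ _ X]opprK; exact: deriN.
- move=> x _; have := deriM (deri_sqr (deri_id x)) (deri_cst 2^-1 x).
  by move=> h; apply: (is_derive_eq h); rewrite mulr0 addr0; field.
- by move=> x; rewrite in_itv/= => /andP[x0 _]; rewrite sin_le_id// ltW.
Qed.

Lemma sin_ge_cubic y : 0 <= y -> y - y ^+ 3 / 6 <= sin y.
Proof.
move=> y0.
have := @le_increment R (fun z => z - sin z) (fun z => z ^+ 3 / 6) (fun z => 1 - cos z)
  (fun z => z ^+ 2 / 2) 0 y y0.
rewrite sin0 expr0n/= mul0r !subr0 => h.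
suff: y - sin y <= y ^+ 3 / 6 by lra.
have d3 x : is_derive x 1 (fun z => z ^+ 3 / 6) (x ^+ 2 / 2).
  have h' := deriM (deriM (deri_id x) (deri_sqr (deri_id x))) (deri_cst 6^-1 x).
  apply: (is_derive_eq (deri_ext _ h')); first by move=> z; rewrite exprS.
  by rewrite mulr0 addr0; field.
apply: h.
- by apply: continuous_subspaceT => z; apply: continuousB => //; exact: continuous_sin.
- by apply: continuous_subspaceT => z; exact: deri_cont (d3 z).
- by move=> x; rewrite in_itv/= => /andP[x0 _]; rewrite cos_quad_abs.
Qed.

(** The derivative of [csc_prim].  Like the Dirichlet kernel, it telescopes when
    multiplied by sin (x / 2) ([csc_kernelE]). *)
Definition csc_kernel al N x : R :=
  \sum_(n < N) (cos ((n%:R + al) * x) + cos ((n%:R + 1 - al) * x)).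

Lemma csc_kernelE al N x :
  csc_kernel al N x * sin (x / 2) = cos ((al - 2^-1) * x) * sin (N%:R * x).
Proof.
rewrite /csc_kernel; elim: N => [|N IH]; first by rewrite big_ord0 !mul0r sin0 mulr0.
rewrite big_ord_recr/= mulrDl IH.
have -> : (N%:R + al) * x = (N%:R + 2^-1) * x + (al - 2^-1) * x by field.
have -> : (N%:R + 1 - al) * x = (N%:R + 2^-1) * x - (al - 2^-1) * x by field.
have -> : N%:R * x = (N%:R + 2^-1) * x - x / 2 by field.
have -> : N.+1%:R * x = (N%:R + 2^-1) * x + x / 2 by rewrite -natr1; field.
by rewrite !cosD !sinD !cosN !sinN; ring.
Qed.

Definition csc_prim al N x : R :=
  \sum_(n < N) (sin ((n%:R + al) * x) / (n%:R + al)
                + sin ((n%:R + 1 - al) * x) / (n%:R + 1 - al)).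

(** The limit of [csc_prim] as al tends to 0, where the first quotient becomes x.
    Its value at pi is exactly pi. *)
Definition csc_prim0 N x : R :=
  \sum_(n < N) ((if n == 0%N :> nat then x else sin (n%:R * x) / n%:R)
                + sin (n.+1%:R * x) / n.+1%:R).

Lemma sinZ_deri c x : c != 0 -> is_derive x 1 (fun y => sin (c * y) / c) (cos (c * x)).
Proof.
move=> c0; have h : is_derive x 1 (fun y => c * y) c.
  by rewrite -[X in is_derive _ _ _ X]mulr1; apply: deriZ.
have := deriM (deri_comp (is_derive_sin (c * x)) h) (deri_cst c^-1 x).
by move=> h'; apply: (is_derive_eq h'); rewrite mulr0 addr0 mulfK.
Qed.

Lemma csc_prim_deri al N x : 0 < al -> al < 1 ->
  is_derive x 1 (csc_prim al N) (csc_kernel al N x).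
Proof.
move=> al0 al1; apply: deri_sum => i _; apply: deriD; apply: sinZ_deri.
  by rewrite gt_eqF// ltr_wpDl.
by rewrite gt_eqF// -addrA ltr_wpDl// subr_gt0.
Qed.

Lemma csc_prim0_deri N x : is_derive x 1 (csc_prim0 N) (csc_kernel 0 N x).
Proof.
apply: deri_sum => i _; rewrite addr0 subr0 natr1; apply: deriD; last first.
  by apply: sinZ_deri; rewrite pnatr_eq0.
case: eqP => [->|/eqP i0]; first by rewrite mul0r cos0; exact: deri_id.
by apply: sinZ_deri; rewrite pnatr_eq0.
Qed.

Lemma sin_natpi n : sin (n%:R * pi) = 0 :> R.
Proof. by elim: n => [|n IH]; rewrite ?mul0r ?sin0// -natr1 mulrDl mul1r sinDpi IH oppr0. Qed.

Lemma cos_natpi n : cos (n%:R * pi) = (-1) ^+ n :> R.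
Proof. by elim: n => [|n IH]; rewrite ?mul0r ?cos0// -natr1 mulrDl mul1r cosDpi IH exprS mulN1r. Qed.

(** Partial sums of the partial fraction expansion of pi / sin (pi al). *)
Definition csc_series al N : R :=
  \sum_(n < N) (-1) ^+ n * ((n%:R + al)^-1 + (n%:R + 1 - al)^-1).

Lemma csc_prim_pi al N : csc_prim al N pi = sin (pi * al) * csc_series al N.
Proof.
rewrite /csc_series mulr_sumr; apply: eq_bigr => n _.
rewrite [(n%:R + al) * _]mulrDl natr1 [(_ - al) * _]mulrBl sinD sinB.
rewrite !sin_natpi !cos_natpi exprS [al * _]mulrC; ring.
Qed.

Lemma csc_prim0_pi N : (0 < N)%N -> csc_prim0 N pi = pi.
Proof.
case: N => // N _; rewrite /csc_prim0 big_ord_recl/= sin_natpi mul0r addr0.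
rewrite big1 ?addr0// => i _; rewrite /bump/= add1n.
by rewrite !sin_natpi !mul0r addr0.
Qed.

Lemma csc_prim_0 al N : csc_prim al N 0 = 0.
Proof. by rewrite /csc_prim big1// => i _; rewrite !mulr0 sin0 !mul0r addr0. Qed.

Lemma csc_prim0_0 N : csc_prim0 N 0 = 0.
Proof. by rewrite /csc_prim0 big1// => i _; rewrite !mulr0 sin0 !mul0r; case: ifP; rewrite addr0. Qed.

Lemma sin_half_ge x : 0 < x -> x <= pi -> x / 6 <= sin (x / 2).
Proof.
move=> x0 xpi; have x20 : 0 <= x / 2 by rewrite divr_ge0 ?ltW.
apply: le_trans (sin_ge_cubic x20).
have pi4 : pi <= 4 :> R by have /andP[_] := @pihalf_02 R; lra.
have x16 : x ^+ 2 <= 16 by nra.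
have -> : x / 2 - (x / 2) ^+ 3 / 6 = x / 6 + x * (16 - x ^+ 2) / 48 by field.
by rewrite lerDl divr_ge0// mulr_ge0 ?(ltW x0)//; lra.
Qed.

Section limit.
Variable al : R.
Hypotheses (al0 : 0 < al) (al1 : al < 1).

(* g x * sin (N x) is the difference of the kernels for al and for 0.  The two
   numerators cancel at x = 0, so that g and its derivative are bounded. *)
Let g x := (cos ((al - 2^-1) * x) - cos (x / 2)) / sin (x / 2).
Let dg x := (2^-1 * sin (x / 2) - (al - 2^-1) * sin ((al - 2^-1) * x)) / sin (x / 2)
  - (cos ((al - 2^-1) * x) - cos (x / 2)) * (2^-1 * cos (x / 2)) / sin (x / 2) ^+ 2.

Let be2 : (al - 2^-1) ^+ 2 <= 4^-1.
Proof.
have -> : (al - 2^-1) ^+ 2 = 4^-1 - al * (1 - al) by field.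
by rewrite lerBlDr lerDl mulr_ge0 ?subr_ge0 ?ltW.
Qed.

Let num_le x : `|cos ((al - 2^-1) * x) - cos (x / 2)| <= x ^+ 2 / 8.
Proof.
have := cos_quad_abs ((al - 2^-1) * x); have := cos_quad_abs (x / 2).
have := cos_le1 ((al - 2^-1) * x); have := cos_le1 (x / 2).
rewrite !exprMn ler_norml.
have : (al - 2^-1) ^+ 2 * x ^+ 2 <= 4^-1 * x ^+ 2 by rewrite ler_wpM2r ?sqr_ge0.
have -> : 2^-1 ^+ 2 = 4^-1 :> R by field.
by move=> *; apply/andP; split; lra.
Qed.

Let g_le x : 0 < x -> x <= pi -> `|g x| <= x.
Proof.
move=> x0 xpi; have s0 := sin_half_ge x0 xpi; have sgt : 0 < sin (x / 2) by nra.
rewrite normrM normfV [`|sin _|]gtr0_norm// ler_pdivrMr//.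
by apply: (le_trans (num_le x)); nra.
Qed.

Let dg_le x : 0 < x -> x <= pi -> `|dg x| <= 6.
Proof.
move=> x0 xpi; have s0 := sin_half_ge x0 xpi; have sgt : 0 < sin (x / 2) by nra.
apply: (le_trans (ler_normB _ _)).
have h1 : `|(2^-1 * sin (x / 2) - (al - 2^-1) * sin ((al - 2^-1) * x)) / sin (x / 2)| <= 3.
  rewrite normrM normfV [`|sin (x / 2)|]gtr0_norm// ler_pdivrMr//.
  apply: (@le_trans _ _ (x / 2)); last by nra.
  apply: (le_trans (ler_normB _ _)); rewrite !normrM.
  have := abs_sin_le (x / 2); have := abs_sin_le ((al - 2^-1) * x).
  rewrite !normrM [`|x|]gtr0_norm// [`|2^-1|]gtr0_norm// => ha hb.
  have hc : `|al - 2^-1| <= 2^-1 by move: al0 al1 => ? ?; rewrite ler_norml; apply/andP; split; lra.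
  have : `|al - 2^-1| * `|sin ((al - 2^-1) * x)| <= 2^-1 * (2^-1 * x).
    apply: ler_pM => //; apply: (le_trans ha); by apply: ler_wpM2r hc; exact: ltW.
  lra.
have h2 : `|(cos ((al - 2^-1) * x) - cos (x / 2)) * (2^-1 * cos (x / 2)) / sin (x / 2) ^+ 2| <= 3.
  rewrite normrM normfV [`|sin (x / 2) ^+ 2|]gtr0_norm ?exprn_gt0// ler_pdivrMr ?exprn_gt0//.
  rewrite normrM.
  apply: (@le_trans _ _ (x ^+ 2 / 8 * 2^-1)).
    apply: ler_pM => //; rewrite normrM gtr0_norm// ler_piMr ?invr_ge0//.
    by rewrite ler_norml cos_geN1 cos_le1.
  have : (x / 6) ^+ 2 <= sin (x / 2) ^+ 2 by rewrite ler_sqr ?nnegrE ?divr_ge0// ltW.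
  by nra.
by lra.
Qed.

Let g_deri x : 0 < x -> x <= pi -> is_derive x 1 g (dg x).
Proof.
move=> x0 xpi; have s0 := sin_half_ge x0 xpi; have sgt : 0 < sin (x / 2) by nra.
have hh : is_derive x 1 (fun y => y / 2) (2^-1 : R).
  by have := deriM (deri_id x) (deri_cst 2^-1 x); rewrite mulr0 addr0 mul1r.
have hb : is_derive x 1 (fun y => (al - 2^-1) * y) (al - 2^-1).
  by rewrite -[X in is_derive _ _ _ X]mulr1; apply: deriZ.
have hV := is_deriveV (f := fun y => sin (y / 2)) (lt0r_neq0 sgt) (deri_comp (g := fun y => y / 2) (is_derive_sin (x / 2)) hh).
have := deriM (deriB (deri_comp (is_derive_cos ((al - 2^-1) * x)) hb) (deri_comp (g := fun y => y / 2) (is_derive_cos (x / 2)) hh)) hV.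
move=> h; apply: (is_derive_eq h).
by rewrite /dg /GRing.scale/=; field; rewrite gt_eqF.
Qed.

(** The difference F of [csc_prim al N] and [csc_prim0 N] vanishes at 0 and has
    derivative g x sin (N x).  One integration by parts, that is, the function
    F + g cos (N x) / N, gains the factor 1 / N. *)
Lemma csc_series_le N : (0 < N)%N ->
  `|sin (pi * al) * csc_series al N - pi| <= 28 / N%:R.
Proof.
move=> N0; have NR0 : 0 < N%:R :> R by rewrite ltr0n.
have pi4 : pi <= 4 :> R by have /andP[_] := @pihalf_02 R; lra.
pose F x := csc_prim al N x - csc_prim0 N x.
have dF x : 0 < x -> x <= pi -> is_derive x 1 F (g x * sin (N%:R * x)).
  move=> x0 xpi; have s0 := sin_half_ge x0 xpi; have sgt : 0 < sin (x / 2) by nra.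
  apply: (is_derive_eq (deriB (csc_prim_deri N x al0 al1) (csc_prim0_deri N x))).
  apply: (@mulIf _ (sin (x / 2))); first by rewrite gt_eqF.
  rewrite mulrBl !csc_kernelE /g mulrAC divfK ?gt_eqF//.
  by rewrite -mulrBl sub0r mulNr cosN [2^-1 * x]mulrC.
have cF : continuous F.
  by move=> x; exact: deri_cont (deriB (csc_prim_deri N x al0 al1) (csc_prim0_deri N x)).
have F0 : F 0 = 0 by rewrite /F csc_prim_0 csc_prim0_0 subr0.
have Fpi : F pi = sin (pi * al) * csc_series al N - pi by rewrite /F csc_prim_pi csc_prim0_pi.
rewrite -Fpi.
have Fde (de : R) : 0 < de -> de <= pi -> `|F de| <= 4 * de.
  move=> de0 depi; have := @lipschitz_increment R F (fun x => g x * sin (N%:R * x)) 4 0 de (ltW de0).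
  rewrite F0 !subr0; apply.
  - exact: continuous_subspaceT.
  - move=> x; rewrite in_itv/= => /andP[x0 xde]; apply: dF => //; lra.
  - move=> x; rewrite in_itv/= => /andP[x0 xde].
    rewrite normrM -[4]mulr1; apply: ler_pM => //.
      by apply: le_trans (g_le x0 _) _; lra.
    by rewrite ler_norml sin_geN1 sin_le1.
have H (de : R) : 0 < de -> de <= pi -> `|F pi| <= 28 / N%:R + 5 * de.
  move=> de0 depi.
  pose H x := F x + g x * (cos (N%:R * x) / N%:R).
  have hN x : is_derive x 1 (fun y => cos (N%:R * y) / N%:R) (- sin (N%:R * x)).
    have h : is_derive x 1 (fun y => N%:R * y) (N%:R : R).
      by rewrite -[X in is_derive _ _ _ X]mulr1; apply: deriZ.
    apply: (is_derive_eq (deriM (deri_comp (is_derive_cos (N%:R * x)) h) (deri_cst N%:R^-1 x))).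
    by rewrite mulr0 addr0 mulfK ?gt_eqF.
  have dH x : 0 < x -> x <= pi -> is_derive x 1 H (dg x * (cos (N%:R * x) / N%:R)).
    move=> x0 xpi; apply: (is_derive_eq (deriD (dF x x0 xpi) (deriM (g_deri x0 xpi) (hN x)))).
    by ring.
  have cN x : `|cos (N%:R * x) / N%:R| <= N%:R^-1.
    rewrite normrM [`|_^-1|]gtr0_norm ?invr_gt0// ler_piMl ?invr_ge0 ?ler0n//.
    by rewrite ler_norml cos_geN1 cos_le1.
  have : `|H pi - H de| <= 6 / N%:R * (pi - de).
    apply: (lipschitz_increment (df := fun x => dg x * (cos (N%:R * x) / N%:R))) => //.
    - apply: derivable_within_continuous => x; rewrite in_itv/= => /andP[x0 xpi].
      by have [|//|] := dH x => //; lra.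
    - move=> x; rewrite in_itv/= => /andP[x0 xpi]; apply: dH; lra.
    - move=> x; rewrite in_itv/= => /andP[x0 xpi].
      rewrite normrM; apply: ler_pM => //; apply: dg_le; lra.
  have NV : 0 < N%:R^-1 :> R by rewrite invr_gt0.
  have N1 : N%:R^-1 <= 1 :> R by rewrite invf_le1// ler1n.
  have gc x : 0 < x -> x <= pi -> `|g x * (cos (N%:R * x) / N%:R)| <= x / N%:R.
    by move=> x0 xpi; rewrite normrM; apply: ler_pM => //; exact: g_le.
  have := gc _ (pi_gt0 R) (lexx _); have := gc _ de0 depi; have := Fde _ de0 depi.
  rewrite /H !ler_norml => /andP[? ?] /andP[? ?] /andP[? ?] /andP[? ?].
  have : de / N%:R <= de by rewrite ler_piMr// (ltW de0).
  have : pi / N%:R <= 4 / N%:R :> R by rewrite ler_wpM2r// (ltW NV).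
  have : 6 / N%:R * (pi - de) <= 24 / N%:R.
    have -> : 24 / N%:R = 6 / N%:R * 4 :> R by ring.
    by apply: ler_wpM2l; [rewrite divr_ge0// (ltW NR0)|lra].
  by move=> ? ? ?; apply/andP; split; lra.
apply/ler_addgt0Pr => e e0.
have p0 := pi_gt0 R.
have /H : 0 < Num.min (e / 5) pi by rewrite lt_min p0 andbT divr_gt0.
rewrite ge_min lexx orbT => /(_ isT) /le_trans; apply.
rewrite lerD2l -ler_pdivlMl// mulrC ge_min.
by rewrite mulrC lexx.
Qed.

End limit.
End CosecantSeries.

(** * The Euler integral *)

Section PowerIntegrals.
Context {R : realType}.
Implicit Types (u c al : R).
Local Notation mu := (@lebesgue_measure R).

Lemma powR_deri c u : 0 < u -> c != 0 -> is_derive u 1 (fun x => x `^ c / c) (u `^ (c - 1)).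
Proof.
move=> u0 c0; apply: (is_derive_eq (deriM (is_derive1_powR c u0) (deri_cst c^-1 u))).
by rewrite mulr0 addr0 mulrAC divff// mul1r.
Qed.

Lemma measurable_powRl c (D : set R) : measurable D -> measurable_fun D (fun x : R => x `^ c).
Proof. by move=> mD; apply: measurable_funTS; exact: measurable_realfun.measurable_powR. Qed.

Lemma powR_itv_integral c (a b : R) : 0 < a -> a < b -> c != 0 ->
  (\int[mu]_(x in `[a, b]) (x `^ (c - 1))%:E = (b `^ c / c - a `^ c / c)%:E)%E.
Proof.
move=> a0 ab c0; rewrite EFinB.
apply: (@continuous_FTC2 R (fun x => x `^ (c - 1)) (fun x => x `^ c / c) a b ab).
- apply: derivable_within_continuous => x; rewrite in_itv/= => /andP[ax _].
  by have [] := is_derive1_powR (c - 1) (lt_le_trans a0 ax).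
- split.
  + by move=> x; rewrite in_itv/= => /andP[ax _]; have [] := powR_deri (lt_trans a0 ax) c0.
  + by apply: cvg_at_right_filter; exact: deri_cont (powR_deri a0 c0).
  + by apply: cvg_at_left_filter; exact: deri_cont (powR_deri (lt_trans a0 ab) c0).
- move=> x; rewrite in_itv/= => /andP[ax _].
  exact: deri_derive1 (powR_deri (lt_trans a0 ax) c0).
Qed.

Lemma exhaust_integral (D : set R) (F : (set R)^nat) (f : R -> R) (v : R^nat) (l : R) :
  {homo F : n m / (n <= m)%N >-> (n <= m)%O} -> (forall n, measurable (F n)) ->
  \bigcup_n F n = D -> measurable_fun D f -> (forall x, D x -> 0 <= f x) ->
  (forall n, (\int[mu]_(x in F n) (f x)%:E = (v n)%:E)%E) ->
  v n @[n --> \oo] --> l ->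
  (\int[mu]_(x in D) (f x)%:E = l%:E)%E.
Proof.
move=> homoF mF FD mf f0 Fv vl.
have FsubD n : F n `<=` D by rewrite -FD; exact: bigcup_sup.
have := @ge0_nondecreasing_set_cvg_integral _ (measurableTypeR R) R F (EFin \o f) lebesgue_measure homoF mF.
rewrite FD => /(_ _ _)/cvg_lim <-//.
- apply/cvg_lim => //; rewrite (_ : (fun i => _) = EFin \o v); last exact/funext.
  by apply/fine_cvgP; split; [exact: nearW|exact: vl].
- move=> i; apply/measurable_EFinP; apply: measurable_funS mf => //.
  by rewrite -FD; apply: bigcup_measurable => n _; exact: mF.
- by move=> i x Fx; rewrite lee_fin; exact/f0/FsubD/Fx.
Qed.

Lemma harmonic_powR_cvg c : 0 < c -> (n.+1%:R^-1 : R) `^ c @[n --> \oo] --> (0 : R).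
Proof.
move=> c0; have /cvg_at_rightP := powR_cvg0 c0.
move=> /(_ (@harmonic R)); apply; split; first by move=> n /=; rewrite invr_gt0.
exact: (@cvg_harmonic R).
Qed.

Lemma powR_integral01 c : 0 < c ->
  (\int[mu]_(x in `]0%R, 1%R]) (x `^ (c - 1))%:E = (c^-1)%:E)%E.
Proof.
move=> c0.
apply: (@exhaust_integral _ (fun n => `[n.+2%:R^-1, 1]%classic) _
  (fun n => 1 `^ c / c - n.+2%:R^-1 `^ c / c)).
- move=> n m nm; rewrite subsetEset; apply: subset_itvr.
  by rewrite bnd_simp lef_pV2 ?posrE// ler_nat.
- by [].
- apply/seteqP; split=> x /=.
    move=> [n _] /=; rewrite !in_itv/= => /andP[h ->]; rewrite andbT.
    by apply: lt_le_trans h; rewrite invr_gt0.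
  rewrite in_itv/= => /andP[x0 x1].
  exists (Num.truncn x^-1) => //=; rewrite in_itv/= x1 andbT.
  rewrite -[leRHS]invrK lef_pV2 ?posrE ?invr_gt0//.
  have := truncnS_gt x^-1.
  by move=> /ltW /le_trans; apply; rewrite ler_nat.
- exact: measurable_powRl.
- by move=> x _; exact: powR_ge0.
- by move=> n; apply: powR_itv_integral; rewrite ?gt_eqF ?invr_gt0// invf_lt1// ltr1n.
- rewrite powR1 div1r -[X in _ --> X]subr0; apply: cvgB; first exact: cvg_cst.
  rewrite -[X in _ --> X](mul0r c^-1); apply: cvgMl.
  by have := harmonic_powR_cvg c0; rewrite -(cvg_shiftS).
Qed.

Lemma powR_integral1y c : 0 < c ->
  (\int[mu]_(x in `]1%R, +oo[) (x `^ (- c - 1))%:E = (c^-1)%:E)%E.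
Proof.
move=> c0; rewrite integral_itv_obnd_cbnd; last first.
  by apply/measurable_EFinP; exact: measurable_powRl.
apply: (@exhaust_integral _ (fun n => `[1, n.+2%:R]%classic) _
  (fun n => n.+2%:R `^ (- c) / (- c) - 1 `^ (- c) / (- c))).
- move=> n m nm; rewrite subsetEset; apply: subset_itvl.
  by rewrite bnd_simp ler_nat.
- by [].
- apply/seteqP; split=> x /=.
    by move=> [n _] /=; rewrite !in_itv/= => /andP[-> _].
  rewrite in_itv/= andbT => x1.
  exists (Num.truncn x) => //=; rewrite in_itv/= x1/=.
  have := truncnS_gt x.
  by move=> /ltW /le_trans; apply; rewrite ler_nat.
- exact: measurable_powRl.
- by move=> x _; exact: powR_ge0.
- by move=> n; apply: powR_itv_integral; rewrite ?oppr_eq0 ?gt_eqF// ltr1n.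
- rewrite powR1 div1r invrN opprK -[X in _ --> X]add0r; apply: cvgD; last exact: cvg_cst.
  rewrite -[X in _ --> X](mul0r (- c^-1)); apply: cvgMl.
  have := harmonic_powR_cvg c0; rewrite -(cvg_shiftS); apply: cvg_trans.
  apply: near_eq_cvg; apply: nearW => n /=.
  by rewrite -(powR_inv1 (ler0n _ _)) -powRrM mulN1r.
Qed.

(** The partial sums of the alternating series differ from the integral by the
    integral of f N, up to sign, and 0 <= f N <= p N. *)
Lemma alternating_integral (D : set R) (f p : nat -> R -> R) (a : nat -> R) :
  measurable D -> (forall n, measurable_fun D (f n)) ->
  (forall n, measurable_fun D (p n)) ->
  (forall n x, D x -> 0 <= f n x) ->
  (forall n x, D x -> f n x + f n.+1 x = p n x) ->
  (forall n, (\int[mu]_(x in D) (p n x)%:E = (a n)%:E)%E) ->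
  exists2 J : R, (\int[mu]_(x in D) (f 0%N x)%:E = J%:E)%E &
    forall N, `|J - \sum_(n < N) (-1) ^+ n * a n| <= a N.
Proof.
move=> mD mf mp f0 ffp pa.
have p0 n x : D x -> 0 <= p n x by move=> Dx; rewrite -ffp// addr_ge0// f0.
have le_fp n : (\int[mu]_(x in D) (f n x)%:E <= (a n)%:E)%E.
  rewrite -pa; apply: ge0_le_integral => //.
  - by move=> x Dx; rewrite lee_fin f0.
  - by apply/measurable_EFinP; exact: mf.
  - by apply/measurable_EFinP; exact: mp.
  - by move=> x Dx; rewrite lee_fin -ffp// lerDl f0.
pose J n := fine (\int[mu]_(x in D) (f n x)%:E).
have JE n : (\int[mu]_(x in D) (f n x)%:E = (J n)%:E)%E.
  rewrite fineK// ge0_fin_numE; first exact: le_lt_trans (le_fp n) (ltry _).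
  by apply: integral_ge0 => x Dx; rewrite lee_fin f0.
have J0 n : 0 <= J n by rewrite -lee_fin -JE; apply: integral_ge0 => x Dx; rewrite lee_fin f0.
have JJ n : J n + J n.+1 = a n.
  apply: EFin_inj; rewrite EFinD -!JE -pa -ge0_integralD//.
  - by apply: eq_integral => x /set_mem Dx; rewrite -EFinD ffp.
  - by move=> x Dx; rewrite lee_fin f0.
  - by apply/measurable_EFinP; exact: mf.
  - by move=> x Dx; rewrite lee_fin f0.
  - by apply/measurable_EFinP; exact: mf.
exists (J 0%N) => // N.
suff -> : J 0%N - \sum_(n < N) (-1) ^+ n * a n = (-1) ^+ N * J N.
  by rewrite normrM normrX normrN normr1 expr1n mul1r ger0_norm// -JJ lerDl.
elim: N => [|N IH]; first by rewrite big_ord0 subr0 mul1r.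
by rewrite big_ord_recr/= opprD addrA IH -JJ exprS; ring.
Qed.

(** Besides its integral, this weight is the integrable majorant, up to constants,
    of all memory functions below. *)
Definition euler_weight al u : R := u `^ (al - 1) / (1 + u).

Lemma measurable_euler_weight al (D : set R) : D `<=` `]0, +oo[ -> measurable D ->
  measurable_fun D (euler_weight al).
Proof.
move=> D0 mD; apply: measurable_funS D0 _ => //.
apply: open_continuous_measurable_fun => //.
move=> x; rewrite inE/= in_itv/= andbT => x0.
have x1 : 1 + x != 0 by rewrite gt_eqF// addr_gt0.
have hV := is_deriveV (f := fun u => 1 + u) x1 (deriD (deri_cst 1 x) (deri_id x)).
exact: deri_cont (deriM (is_derive1_powR (al - 1) x0) hV).
Qed.

(** On ]0, 1] the weight is expanded into the alternating series of
    u^(n + al - 1), on ]1, +oo[ into that of u^(- n - 1 + al - 1); the integrated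
    series are the two halves of the cosecant series. *)
Lemma euler_integral al : 0 < al -> al < 1 ->
  (\int[mu]_(u in `]0%R, +oo[) (euler_weight al u)%:E = (pi / sin (pi * al))%:E)%E.
Proof.
move=> al0 al1.
have sal : 0 < sin (pi * al).
  by apply: sin_gt0_pi; rewrite mulr_gt0 ?pi_gt0//= gtr_pMr ?pi_gt0.
pose D1 : set R := `]0%R, 1%R]%classic; pose D2 : set R := `]1%R, +oo[%classic.
have D10 : D1 `<=` `]0, +oo[.
  by move=> x; rewrite /D1/= !in_itv/= andbT => /andP[].
have D20 : D2 `<=` `]0, +oo[.
  by move=> x; rewrite /D2/= !in_itv/= !andbT => /(lt_trans _) ->.
have mD1 : measurable D1 by exact: measurable_itv.
have mD2 : measurable D2 by exact: measurable_itv.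
have [|||||J1 J1E J1N] := @alternating_integral D1 (fun n => euler_weight (n%:R + al))
    (fun n x => x `^ (n%:R + al - 1)) (fun n => (n%:R + al)^-1) mD1.
- by move=> n; exact: measurable_euler_weight.
- by move=> n; exact: measurable_powRl.
- by move=> n x /D10; rewrite /= in_itv/= andbT => x0; rewrite divr_ge0 ?powR_ge0// ltW// addr_gt0.
- move=> n x /D10; rewrite /= in_itv/= andbT => x0; rewrite /euler_weight -mulrDl.
  have -> : n.+1%:R + al - 1 = (n%:R + al - 1) + 1 by rewrite -natr1; ring.
  rewrite [x `^ (_ + 1)]powRD; last by rewrite (gt_eqF x0) implybT.
  by rewrite powRr1 ?(ltW x0)//; field; rewrite gt_eqF// addr_gt0.
- by move=> n; apply: powR_integral01; rewrite ltr_wpDl.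
have [|||||J2 J2E J2N] := @alternating_integral D2 (fun n => euler_weight (al - n%:R))
    (fun n x => x `^ (- (n%:R + 1 - al) - 1)) (fun n => (n%:R + 1 - al)^-1) mD2.
- by move=> n; exact: measurable_euler_weight.
- by move=> n; exact: measurable_powRl.
- by move=> n x /D20; rewrite /= in_itv/= andbT => x0; rewrite divr_ge0 ?powR_ge0// ltW// addr_gt0.
- move=> n x /D20; rewrite /= in_itv/= andbT => x0; rewrite /euler_weight -mulrDl.
  have -> : al - n%:R - 1 = (- (n%:R + 1 - al) - 1) + 1 by ring.
  have -> : al - n.+1%:R - 1 = - (n%:R + 1 - al) - 1 by rewrite -natr1; ring.
  rewrite [x `^ (_ + 1)]powRD; last by rewrite (gt_eqF x0) implybT.
  by rewrite powRr1 ?(ltW x0)//; field; rewrite gt_eqF// addr_gt0.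
- by move=> n; apply: powR_integral1y; rewrite -addrA ltr_wpDl// subr_gt0.
have -> : `]0%R, +oo[%classic = D1 `|` D2.
  apply/seteqP; split => x; rewrite /D1 /D2/= !in_itv/= ?andbT.
    by move=> x0; have [x1|x1] := leP x 1; [left; rewrite x0|right].
  by move=> [/andP[]//|]; exact: lt_trans.
rewrite ge0_integral_setU//=; last 3 first.
- by apply/measurable_EFinP; apply: measurable_euler_weight; [rewrite subUset|exact: measurableU].
- move=> x D12; have : `]0%R, +oo[%classic x by move: D12 => [/D10|/D20].
  by rewrite /= in_itv/= andbT lee_fin => x0; rewrite divr_ge0 ?powR_ge0// ltW// addr_gt0.
- rewrite disj_set2E; apply/eqP/seteqP; split => // x [].
  by rewrite /D1 /D2 /= !in_itv/= !andbT => /andP[_ x1] /(le_lt_trans x1); rewrite ltxx.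
have -> : (\int[mu]_(x in D1) (euler_weight al x)%:E = J1%:E)%E by rewrite -J1E add0r.
have -> : (\int[mu]_(x in D2) (euler_weight al x)%:E = J2%:E)%E by rewrite -J2E subr0.
rewrite -EFinD; congr EFin.
apply: (canRL (mulfK _)); first by rewrite gt_eqF.
apply/eqP; rewrite -subr_eq0 -normr_le0; apply/ler_addgt0Pr => e e0; rewrite add0r.
pose N := (Num.truncn (30 / e)).+1.
have N0 : (0 < N)%N by [].
have NR0 : 0 < N%:R :> R by rewrite ltr0n.
have Ne : 30 / N%:R <= e.
  rewrite ler_pdivrMr// -ler_pdivrMl// mulrC; exact/ltW/truncnS_gt.
apply: le_trans Ne.
have hS := csc_series_le al0 al1 N0.
have -> : (J1 + J2) * sin (pi * al) - pi =
   (sin (pi * al) * csc_series al N - pi) +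
   sin (pi * al) * ((J1 - \sum_(n < N) (-1) ^+ n * (n%:R + al)^-1)
     + (J2 - \sum_(n < N) (-1) ^+ n * (n%:R + 1 - al)^-1)).
  have -> : csc_series al N = \sum_(n < N) (-1) ^+ n * (n%:R + al)^-1
       + \sum_(n < N) (-1) ^+ n * (n%:R + 1 - al)^-1.
    by rewrite /csc_series -big_split/=; apply: eq_bigr => i _; rewrite mulrDr.
  by ring.
apply: (le_trans (ler_normD _ _)).
have h1 : (N%:R + al)^-1 <= N%:R^-1 by rewrite lef_pV2 ?posrE ?addr_gt0// lerDl ltW.
have h2 : (N%:R + 1 - al)^-1 <= N%:R^-1.
  have ? : 0 < 1 - al by rewrite subr_gt0.
  by rewrite lef_pV2 ?posrE//; lra.
have h3 : `|sin (pi * al) * ((J1 - \sum_(n < N) (-1) ^+ n * (n%:R + al)^-1)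
     + (J2 - \sum_(n < N) (-1) ^+ n * (n%:R + 1 - al)^-1))| <= 2 / N%:R.
  rewrite normrM -[leRHS]mul1r; apply: ler_pM => //.
    by rewrite ler_norml sin_geN1 sin_le1.
  apply: (le_trans (ler_normD _ _)); have := J1N N; have := J2N N; lra.
lra.
Qed.

Lemma euler_weight_integrable al : 0 < al -> al < 1 ->
  mu.-integrable `]0%R, +oo[ (EFin \o euler_weight al).
Proof.
move=> al0 al1; apply/integrableP; split.
  by apply/measurable_EFinP; exact: measurable_euler_weight.
apply: le_lt_trans (ltry (pi / sin (pi * al))); rewrite -euler_integral// le_eqVlt.
apply/orP; left; apply/eqP/eq_integral => x.
rewrite inE/= in_itv/= andbT => x0; rewrite ger0_norm// divr_ge0 ?powR_ge0//.
by rewrite ltW// addr_gt0.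
Qed.

End PowerIntegrals.

(** * Laplace transforms and the reflection formula *)

Section GammaReflection.
Context {R : realType}.
Implicit Types (u c al s : R).
Local Notation mu := (@lebesgue_measure R).
Local Notation Rpos := (`]0%R, +oo[%classic : set R).

Lemma pos_exhaust_cvg (s : R) (f : R -> R) : 0 < s ->
  measurable_fun Rpos f -> (forall x : R, 0 < x -> 0 <= f x) ->
  (\int[mu]_(x in `[(s * n.+1%:R^-1)%R, +oo[) (f x)%:E)%E @[n --> \oo] -->
  (\int[mu]_(x in `]0%R, +oo[) (f x)%:E)%E.
Proof.
move=> s0 mf f0.
have -> : `]0%R, +oo[%classic = \bigcup_n `[s * n.+1%:R^-1, +oo[%classic.
  apply/seteqP; split=> x /=.
    rewrite in_itv/= andbT => x0; exists (Num.truncn (x^-1 * s)) => //=.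
    rewrite in_itv/= andbT ler_pdivrMr// -ler_pdivrMl//.
    exact/ltW/truncnS_gt.
  move=> [n _] /=; rewrite !in_itv/= !andbT; apply: lt_le_trans.
  by rewrite mulr_gt0.
have pos n x : `[s * n.+1%:R^-1, +oo[%classic x -> 0 < x.
  rewrite /= in_itv/= andbT; apply: lt_le_trans; by rewrite mulr_gt0.
apply: (@ge0_nondecreasing_set_cvg_integral _ (measurableTypeR R) R
  (fun n => `[s * n.+1%:R^-1, +oo[%classic) (EFin \o f) lebesgue_measure).
- move=> n m nm; rewrite subsetEset; apply: subset_itvr.
  by rewrite bnd_simp ler_pM2l// lef_pV2 ?posrE// ler_nat.
- by [].
- move=> n; apply/measurable_EFinP; apply: measurable_funS mf => //.
  by move=> x /pos x0; rewrite /= in_itv/= andbT.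
- by move=> n x /pos x0; rewrite lee_fin f0.
Qed.

(** The substitution on the half-lines [s / (n + 1), +oo[, followed by monotone
    convergence. *)
Lemma scale_integral (s : R) (f : R -> R) : 0 < s ->
  (forall x : R, 0 < x -> {for x, continuous f}) -> (forall x : R, 0 < x -> 0 <= f x) ->
  (\int[mu]_(x in `]0%R, +oo[) (f x)%:E = \int[mu]_(u in `]0%R, +oo[) (f (s * u) * s)%:E)%E.
Proof.
move=> s0 cf f0.
have mf : measurable_fun Rpos f.
  apply: open_continuous_measurable_fun => // x.
  by rewrite inE/= in_itv/= andbT => /cf.
have ds (x : R) : is_derive x 1 (fun y => s * y) s.
  by rewrite -[X in is_derive _ _ _ X]mulr1; apply: deriZ.
have ds1 : (fun y : R => s * y)^`()%classic = cst s.
  by apply/funext => x; exact: deri_derive1 (ds x).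
have cfs x : 0 < x -> {for x, continuous (fun u => f (s * u))}.
  move=> x0; apply: continuous_comp; first exact: deri_cont (ds x).
  by apply: cf; rewrite mulr_gt0.
have mfs : measurable_fun Rpos (fun u => f (s * u) * s).
  apply: measurable_funM => //; apply: open_continuous_measurable_fun => // x.
  by rewrite inE/= in_itv/= andbT => /cfs.
apply: (@cvg_unique _ (@ereal_hausdorff R) _ _ _ _ (pos_exhaust_cvg s0 mf f0)).
have h := pos_exhaust_cvg (@ltr01 R) mfs _.
apply: cvg_trans (h _); last by move=> x x0; rewrite mulr_ge0 ?(ltW s0)// f0// mulr_gt0.
apply: near_eq_cvg; apply: nearW => n /=; rewrite mul1r.
have n0 : 0 < n.+1%:R^-1 :> R by rewrite invr_gt0.
rewrite (@increasing_ge0_integration_by_substitutiony R (fun y => s * y) f n.+1%:R^-1).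
- by apply: eq_integral => x _; rewrite /= ds1.
- by move=> x y _ _; rewrite ltr_pM2l.
- by rewrite ds1 => x _; exact: cvg_cst.
- by rewrite ds1; exact: is_cvg_cst.
- by rewrite ds1; exact: is_cvg_cst.
- split; first by move=> x _; case: (ds x).
  by apply: cvg_at_right_filter; exact: deri_cont (ds _).
- exact: gt0_cvgMry.
- apply: continuous_in_subspaceT => x; rewrite inE/= in_itv/= andbT => h1.
  by apply: cf; apply: lt_le_trans h1; rewrite mulr_gt0.
- move=> x; rewrite in_itv/= andbT => h1; apply: f0; apply: lt_trans h1.
  by rewrite mulr_gt0.
Qed.

Lemma gamma_integrand_cont al s (x : R) : 0 < x ->
  {for x, continuous (fun u => u `^ (al - 1) * expR (- (s * u)))}.
Proof.
by move=> x0; apply: (deri_cont (deriM (is_derive1_powR (al - 1) x0) _)).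
Qed.

Lemma measurable_gamma_integrand al s :
  measurable_fun Rpos (fun u => u `^ (al - 1) * expR (- (s * u))).
Proof.
apply: open_continuous_measurable_fun => // x.
by rewrite inE/= in_itv/= andbT; exact: gamma_integrand_cont.
Qed.

Lemma measurable_gamma_integrand1 al :
  measurable_fun Rpos (fun u => u `^ (al - 1) * expR (- u)).
Proof.
have := measurable_gamma_integrand al 1; congr (measurable_fun _ _).
by apply/funext => u; rewrite mul1r.
Qed.

Lemma Gamma_integral al : 0 < al -> al < 1 ->
  (\int[mu]_(u in Rpos) (u `^ (al - 1) * expR (- u))%:E = (Gamma al)%:E)%E.
Proof.
move=> al0 al1; rewrite /Gamma /Rintegral fineK// ge0_fin_numE; last first.
  by apply: integral_ge0 => x _; rewrite lee_fin mulr_ge0 ?powR_ge0 ?expR_ge0.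
apply: le_lt_trans (ltry (pi / sin (pi * al))); rewrite -euler_integral//.
apply: ge0_le_integral => //.
- by move=> x _; rewrite lee_fin mulr_ge0 ?powR_ge0 ?expR_ge0.
- by apply/measurable_EFinP; exact: measurable_gamma_integrand1.
- by apply/measurable_EFinP; exact: measurable_euler_weight.
- move=> x; rewrite /= in_itv/= andbT => x0; rewrite lee_fin ler_wpM2l ?powR_ge0//.
  by rewrite expRN lef_pV2 ?posrE ?expR_gt0// ?addr_gt0//; exact: expR_ge1Dx.
Qed.

Lemma Gamma_gt0 al : 0 < al -> al < 1 -> 0 < Gamma al.
Proof.
move=> al0 al1; rewrite -lte_fin -Gamma_integral//.
have e1 : 0 < expR (-2) :> R by exact: expR_gt0.
apply: (@lt_le_trans _ _ (\int[mu]_(x in `[1%R, 2%R]) (2^-1 * expR (- 2))%:E)%E).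
  rewrite integral_cst//= lebesgue_measure_itv/= lte_fin ltr1n.
  by rewrite -EFinD -EFinM lte_fin !mulr_gt0//; lra.
apply: (@le_trans _ _ (\int[mu]_(u in `[1%R, 2%R]) (u `^ (al - 1) * expR (- u))%:E)%E).
  have m : measurable_fun (`[1, 2]%classic : set R) (fun u : R => u `^ (al - 1) * expR (- u)).
    have := measurable_gamma_integrand1 al; apply: measurable_funS => // x; rewrite /= !in_itv/= andbT => /andP[x1 _].
    exact: lt_le_trans x1.
  apply: ge0_le_integral => //.
  - by apply/measurable_EFinP; exact: m.
  - move=> x; rewrite /= in_itv/= => /andP[x1 x2]; rewrite lee_fin ler_pM//.
    - apply: (@le_trans _ _ (x `^ (-1))).
        by rewrite powR_inv1 ?lef_pV2 ?posrE ?(le_trans _ x1)// (lt_le_trans _ x1).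
      by apply: ler_powR => //; lra.
    - by rewrite ler_expR; lra.
apply: ge0_subset_integral => //.
- by apply/measurable_EFinP; exact: measurable_gamma_integrand1.
- by move=> x _; rewrite lee_fin mulr_ge0 ?powR_ge0 ?expR_ge0.
- by move=> x; rewrite /= !in_itv/= andbT => /andP[x1 _]; exact: lt_le_trans x1.
Qed.

Lemma laplace_powR al s : 0 < al -> al < 1 -> 0 < s ->
  (\int[mu]_(l in Rpos) (l `^ (al - 1) * expR (- (s * l)))%:E = (s `^ (- al) * Gamma al)%:E)%E.
Proof.
move=> al0 al1 s0; rewrite EFinM -Gamma_integral//.
rewrite [X in (_ = _ * X)%E](@scale_integral s (fun u => u `^ (al - 1) * expR (- u)) s0); last 2 first.
- move=> x x0; have := @gamma_integrand_cont al 1 x x0.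
  congr (continuous_at _ _); by apply/funext => u; rewrite mul1r.
- by move=> x _; rewrite mulr_ge0 ?powR_ge0 ?expR_ge0.
rewrite -ge0_integralZl//; last 3 first.
- apply/measurable_EFinP; apply: measurable_funM => //.
  have h : measurable_fun Rpos (fun u => (s `^ (al - 1)) * (u `^ (al - 1) * expR (- (s * u)))).
    by apply: measurable_funM => //; exact: measurable_gamma_integrand.
  apply: eq_measurable_fun h => x; rewrite inE/= in_itv/= andbT => x0.
  by rewrite powRM ?ltW// mulrA.
- by move=> x _; rewrite lee_fin !mulr_ge0 ?powR_ge0 ?expR_ge0// ltW.
- by rewrite lee_fin powR_ge0.
apply: eq_integral => x; rewrite inE/= in_itv/= andbT => x0.
rewrite -EFinM; congr EFin; rewrite powRM ?ltW//.
have e : s `^ (- al) * (s `^ (al - 1) * s) = 1.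
  rewrite [_ * s]mulrC mulr_powRB1 ?(ltW s0)// -powRD ?addNr ?powRr0//.
  by rewrite (gt_eqF s0) implybT.
by rewrite -[LHS]mul1r -[X in X * _ = _]e; ring.
Qed.

Lemma patch_integral2 (D1 D2 : set R) (f : R * R -> \bar R) :
  (\int[mu]_(x in D1) \int[mu]_(y in D2) f (x, y) =
   \int[mu]_x \int[mu]_y (f \_ (D1 `*` D2)) (x, y))%E.
Proof.
rewrite integral_mkcond; apply: eq_integral => x _; rewrite patchE; case: ifPn => xD1.
  rewrite integral_mkcond; apply: eq_integral => y _; rewrite !patchE.
  by rewrite in_setX/= xD1.
rewrite integral0_eq// => y _; rewrite patchE in_setX/= (negbTE xD1)//.
Qed.

Lemma patch_integral2' (D1 D2 : set R) (f : R * R -> \bar R) :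
  (\int[mu]_(y in D2) \int[mu]_(x in D1) f (x, y) =
   \int[mu]_y \int[mu]_x (f \_ (D1 `*` D2)) (x, y))%E.
Proof.
rewrite integral_mkcond; apply: eq_integral => y _; rewrite patchE; case: ifPn => yD2.
  rewrite integral_mkcond; apply: eq_integral => x _; rewrite !patchE.
  by rewrite in_setX/= yD2 andbT.
rewrite integral0_eq// => x _; rewrite patchE in_setX/= (negbTE yD2) andbF//.
Qed.

Lemma tonelli_rect (D1 D2 : set R) (f : R * R -> R) :
  measurable D1 -> measurable D2 -> measurable_fun (D1 `*` D2) f ->
  (forall z, (D1 `*` D2) z -> 0 <= f z) ->
  (\int[mu]_(x in D1) \int[mu]_(y in D2) (f (x, y))%:E =
   \int[mu]_(y in D2) \int[mu]_(x in D1) (f (x, y))%:E)%E.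
Proof.
move=> mD1 mD2 mf f0.
rewrite (patch_integral2 D1 D2 (EFin \o f)) (patch_integral2' D1 D2 (EFin \o f)).
apply: (@fubini_tonelli _ _ (measurableTypeR R) (measurableTypeR R) R
  lebesgue_measure lebesgue_measure ((EFin \o f) \_ (D1 `*` D2))).
- apply/(measurable_restrictT _ _).1; first exact: measurableX.
  by apply/measurable_EFinP.
- by move=> z; rewrite patchE; case: ifPn => // /set_mem Dz; rewrite lee_fin f0.
Qed.

Lemma expR_integral c : 0 < c ->
  (\int[mu]_(x in Rpos) (expR (- (c * x)))%:E = (c^-1)%:E)%E.
Proof.
move=> c0.
have d (x : R) : is_derive x 1 (fun y => - expR (- (c * y)) / c) (expR (- (c * x))).
  have h := deriM (deriN (deri_expRZ (- c) x)) (deri_cst c^-1 x).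
  apply: (is_derive_eq (deri_ext _ h)) => [y|]; first by rewrite [- c * y]mulNr.
  by rewrite [- c * x]mulNr; field; rewrite gt_eqF.
have de (x : R) : is_derive x 1 (fun y => expR (- (c * y))) (- c * expR (- c * x)).
  by apply: deri_ext (deri_expRZ (- c) x) => y; rewrite mulNr.
rewrite integral_itv_obnd_cbnd; last first.
  apply/measurable_EFinP; apply: measurable_funTS.
  by apply: continuous_measurable_fun => x; exact: deri_cont (de x).
rewrite (@ge0_continuous_FTC2y R _ (fun y => - expR (- (c * y)) / c) 0 0).
- by rewrite mulr0 oppr0 expR0 add0e mulN1r -EFinN opprK.
- by move=> x _; exact: expR_ge0.
- by apply: continuous_subspaceT => x; exact: deri_cont (de x).
- rewrite -[X in _ --> X](mul0r c^-1) -[X in _ --> (X * _ : R)]oppr0.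
  apply: cvgM; last exact: cvg_cst.
  apply: cvgN; apply: (@cvg_comp _ _ _ (fun y => c * y) (fun y => expR (- y)) _ +oo).
    by apply: gt0_cvgMry => //; exact: cvg_id.
  exact: cvgr_expR.
- by move=> x _; case: (d x).
- by apply: cvg_at_right_filter; exact: deri_cont (d 0).
- by move=> x _; exact: deri_derive1 (d x).
Qed.

(** Tonelli for l^(al-1) e^(-(1+l) x) over x, l > 0: the inner Laplace transform in
    l leaves the product of the two Gamma values, the inner exponential integral
    in x leaves the Euler integral. *)
Lemma Gamma_reflection al : 0 < al -> al < 1 ->
  sin (pi * al) / pi * Gamma al * Gamma (1 - al) = 1.
Proof.
move=> al0 al1.
have sal : 0 < sin (pi * al).
  by apply: sin_gt0_pi; rewrite mulr_gt0 ?pi_gt0//= gtr_pMr ?pi_gt0.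
suff : Gamma (1 - al) * Gamma al = pi / sin (pi * al).
  move=> e; rewrite -mulrA [X in _ * X = _]mulrC e mulrA divfK ?divff ?lt0r_neq0//.
  exact: pi_gt0.
have ? : 0 < 1 - al by rewrite subr_gt0.
have ? : 1 - al < 1 by rewrite gtrBl.
apply: EFin_inj; rewrite -euler_integral// EFinM -Gamma_integral//.
pose f (z : R * R) := z.2 `^ (al - 1) * expR (- ((1 + z.2) * z.1)).
transitivity (\int[mu]_(x in Rpos) \int[mu]_(l in Rpos) (f (x, l))%:E)%E.
  rewrite -ge0_integralZr//.
  - apply: eq_integral => x; rewrite inE/= in_itv/= andbT => x0.
    rewrite -EFinM [1 - al - 1](_ : _ = - al); last by ring.
    rewrite mulrAC EFinM -laplace_powR// -ge0_integralZr//.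
    + apply: eq_integral => l _; rewrite -EFinM /f/= -mulrA -expRD; congr (_ * expR _)%:E.
      by ring.
    + by apply/measurable_EFinP; exact: measurable_gamma_integrand.
    + by move=> l _; rewrite lee_fin mulr_ge0 ?powR_ge0 ?expR_ge0.
  - by apply/measurable_EFinP; exact: measurable_gamma_integrand1.
  - by move=> l _; rewrite lee_fin mulr_ge0 ?powR_ge0 ?expR_ge0.
  - by rewrite lee_fin ltW// Gamma_gt0.
rewrite tonelli_rect//.
- apply: eq_integral => l; rewrite inE/= in_itv/= andbT => l0; rewrite /f/=.
  under eq_integral do rewrite EFinM.
  have l1 : 0 < 1 + l by rewrite addr_gt0.
  rewrite ge0_integralZl//; last 2 first.
  + apply/measurable_EFinP; apply: measurable_funTS; apply: continuous_measurable_fun => x.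
    apply: (deri_cont (a := - (1 + l) * expR (- (1 + l) * x))).
    by apply: deri_ext (deri_expRZ (- (1 + l)) x) => y; rewrite mulNr.
  + by rewrite lee_fin powR_ge0.
  by rewrite expR_integral.
- apply: measurable_funTS; apply: measurable_funM.
    apply: (@measurableT_comp _ _ _ _ _ _ (fun x : R => x `^ (al - 1)) _ snd) => //.
  apply: (@measurableT_comp _ _ _ _ _ _ (@expR R)) => //.
  apply: (@measurableT_comp _ _ _ _ _ _ (-%R : R -> R)) => //.
  by apply: measurable_funM => //; apply: measurable_funD.
- by move=> z _; rewrite /f mulr_ge0 ?powR_ge0 ?expR_ge0.
Qed.

Lemma fubini_rect (D1 D2 : set R) (f : R * R -> R) :
  measurable D1 -> measurable D2 -> measurable_fun (D1 `*` D2) f ->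
  (forall x, D1 x -> mu.-integrable D2 (fun y => (f (x, y))%:E)) ->
  (forall y, D2 y -> mu.-integrable D1 (fun x => (f (x, y))%:E)) ->
  (\int[mu]_(x in D1) (\int[mu]_(y in D2) `|f (x, y)|)%:E < +oo)%E ->
  mu.-integrable D1 (fun x => (\int[mu]_(y in D2) f (x, y))%:E) /\
      \int[mu]_(x in D1) \int[mu]_(y in D2) f (x, y) =
      \int[mu]_(y in D2) \int[mu]_(x in D1) f (x, y).
Proof.
move=> mD1 mD2 mf i1 i2 ltoo.
pose g := (EFin \o f) \_ (D1 `*` D2).
have mg : measurable_fun setT g.
  apply/(measurable_restrictT _ _).1; first exact: measurableX.
  by apply/measurable_EFinP.
have E1 x : D1 x -> (\int[mu]_(y in D2) (f (x, y))%:E = (\int[mu]_(y in D2) f (x, y))%:E)%E.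
  by move=> Dx; rewrite /Rintegral fineK//; apply: integrable_fin_num => //; exact: i1.
have E2 y : D2 y -> (\int[mu]_(x in D1) (f (x, y))%:E = (\int[mu]_(x in D1) f (x, y))%:E)%E.
  by move=> Dx; rewrite /Rintegral fineK//; apply: integrable_fin_num => //; exact: i2.
have EP x : D1 x -> (\int[mu]_(y in D2) `|(f (x, y))%:E| = (\int[mu]_(y in D2) `|f (x, y)|)%:E)%E.
  move=> Dx; rewrite /Rintegral fineK// ge0_fin_numE; last by apply: integral_ge0 => y _; rewrite lee_fin.
  by have /integrableP[_] := i1 x Dx.
have ig : ((@lebesgue_measure R) \x (@lebesgue_measure R))%E.-integrable setT g.
  apply/integrable12ltyP => //.
  apply: le_lt_trans ltoo; rewrite le_eqVlt; apply/orP; left; apply/eqP.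
  transitivity (\int[mu]_(x in D1) \int[mu]_(y in D2) `|(f (x, y))%:E|)%E.
    rewrite (patch_integral2 D1 D2 (fun z => `|(f z)%:E|%E)).
    apply: eq_integral => x _; apply: eq_integral => y _; rewrite /g !patchE.
    by case: ifPn => // _; rewrite abse0.
  by apply: eq_integral => x /set_mem; exact: EP.
have gF : fubini_F lebesgue_measure g = (fun x => (\int[mu]_(y in D2) f (x, y))%:E) \_ D1.
  apply/funext => x; rewrite /fubini_F patchE; case: ifPn => [/set_mem xD1|xD1].
    rewrite -E1// [RHS]integral_mkcond; apply: eq_integral => y _; rewrite /g !patchE.
    by rewrite in_setX/= (mem_set xD1).
  by rewrite integral0_eq// => y _; rewrite /g patchE in_setX/= (negbTE xD1).
have gG : fubini_G lebesgue_measure g = (fun y => (\int[mu]_(x in D1) f (x, y))%:E) \_ D2.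
  apply/funext => y; rewrite /fubini_G patchE; case: ifPn => [/set_mem yD2|yD2].
    rewrite -E2// [RHS]integral_mkcond; apply: eq_integral => x _; rewrite /g !patchE.
    by rewrite in_setX/= (mem_set yD2) andbT.
  by rewrite integral0_eq// => x _; rewrite /g patchE in_setX/= (negbTE yD2) andbF.
split.
- by rewrite integrable_mkcond// -gF; exact: integrable_fubini_F.
- rewrite /Rintegral; congr fine.
  rewrite integral_mkcond [RHS]integral_mkcond.
  transitivity (\int[lebesgue_measure]_x fubini_F lebesgue_measure g x)%E; first by rewrite gF.
  transitivity (\int[lebesgue_measure]_x fubini_G lebesgue_measure g x)%E; last by rewrite gG.
  exact: Fubini.
Qed.

End GammaReflection.

(** * Solutions of the memory equation *)

Section Memory.
Context {R : realType}.
Implicit Types (u c al s t l : R).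
Local Notation mu := (@lebesgue_measure R).
Local Notation Rpos := (`]0%R, +oo[%classic : set R).

Lemma deri_under_int (D : set R) (f df : R -> R -> R) (G : R -> R) (u v a : R) :
  measurable D -> a \in `]u, v[ ->
  (forall x, x \in `]u, v[ -> mu.-integrable D (fun y => (f x y)%:E)) ->
  (forall x y, x \in `]u, v[ -> D y -> is_derive x 1 (f ^~ y) (df x y)) ->
  mu.-integrable D (fun y => (G y)%:E) ->
  (forall x y, x \in `]u, v[ -> D y -> `|df x y| <= G y) ->
  is_derive a 1 (fun x => \int[mu]_(y in D) f x y) (\int[mu]_(y in D) df a y).
Proof.
move=> mD auv intf der intG ubG.
have d1 x y : x \in `]u, v[ -> D y -> partial1of2 f x y = df x y.
  by move=> xuv Dy; exact: deri_derive1 (der x y xuv Dy).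
have intG' : mu.-integrable D (EFin \o (fun y => `|G y|)).
  have := integrable_norm intG; exact.
have der1 x y : `]u, v[%classic x -> D y -> derivable (f ^~ y) x 1.
  by move=> xuv Dy; case: (der x y xuv Dy).
have ub x y : `]u, v[%classic x -> D y -> `|partial1of2 f x y| <= `|G y|.
  by move=> xuv Dy; rewrite d1// (le_trans (ubG x y xuv Dy))// ler_norm.
have dF := @derivable_under_integral R _ (measurableTypeR R) lebesgue_measure f D mD a u v auv
  intf der1 (fun y => `|G y|) (fun y => normr_ge0 _) intG' ub.
have := @differentiation_under_integral R _ (measurableTypeR R) lebesgue_measure f D mD a u v auv
  intf der1 (fun y => `|G y|) (fun y => normr_ge0 _) intG' ub.
move=> e; apply: (is_derive_eq (derivable_deri dF)); rewrite e.
by apply: eq_Rintegral => y /set_mem Dy; rewrite d1.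
Qed.

(** A polarization p, with derivative dp, and its memory variable psi, indexed by
    the relaxation rate l.  No bound on dp is assumed near t = 0, where the
    discrete polarization behaves like t^al. *)
Record memory_pair al c (p dp : R -> R) (psi : R -> R -> R) : Prop := MemoryPair {
  mem_contp : continuous p;
  mem_p0 : forall t, t <= 0 -> p t = 0;
  mem_derip : forall t, 0 < t -> is_derive t 1 p (dp t);
  mem_dp_bound : forall d T, 0 < d -> exists B : R, forall t, d <= t -> t <= T -> `|dp t| <= B;
  mem_contpsi : forall l, 0 < l -> continuous (psi ^~ l);
  mem_psi0 : forall t l, t <= 0 -> 0 < l -> psi t l = 0;
  mem_deripsi : forall t l, 0 < t -> 0 < l ->
    is_derive t 1 (psi ^~ l) (- l * psi t l + c * l `^ (al - 1) * dp t);
  mem_int : forall t, 0 < t -> mu.-integrable Rpos (fun l => (psi t l)%:E) }.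

Definition mem_prim (psi : R -> R -> R) t l := prim (psi ^~ l) t.

Section lemmas.
Variables (al c : R) (p dp : R -> R) (psi : R -> R -> R).
Hypotheses (al0 : 0 < al) (al1 : al < 1) (c0 : 0 < c).
Hypothesis mem : memory_pair al c p dp psi.
Local Notation Phi := (mem_prim psi).
Local Notation W := (euler_weight al).

Let Phi_deri t l : 0 < l -> -1 < t -> is_derive t 1 (Phi ^~ l) (psi t l).
Proof. by move=> l0 t1; apply: prim_deri => //; exact: (mem_contpsi mem). Qed.

Let Phi0 t l : 0 < l -> t <= 0 -> Phi t l = 0.
Proof. by move=> l0 t0; apply: prim_eq0 => // y y0; exact: (mem_psi0 mem). Qed.

Let itv_cont (f : R -> R) (a b : R) : -1 < a -> (forall t, -1 < t -> {for t, continuous f}) ->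
  {within `[a, b], continuous f}.
Proof.
move=> a1 cf; apply: continuous_in_subspaceT => x; rewrite inE/= in_itv/= => /andP[ax _].
by apply: cf; apply: lt_le_trans ax.
Qed.

(** The memory equation integrated once in time.  It expresses the memory through
    p itself, and p is bounded up to t = 0, unlike dp. *)
Lemma mem_primE t l : 0 < l -> -1 < t -> l * Phi t l = c * l `^ (al - 1) * p t - psi t l.
Proof.
move=> l0 t1; have [t0|t0] := leP t 0.
  by rewrite Phi0// (mem_p0 mem)// (mem_psi0 mem)// !mulr0 subr0.
have := @lipschitz_increment R (fun t => l * Phi t l - (c * l `^ (al - 1) * p t - psi t l))
  (fun=> 0) 0 0 t (ltW t0).
rewrite (Phi0 l0 (lexx _)) (mem_p0 mem (lexx _)) (mem_psi0 mem (lexx _) l0) !mulr0 !subr0 mul0r.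
move=> h; apply/eqP; rewrite -subr_eq0 -normr_le0; apply: h.
- apply: itv_cont => [|x x1]; first by lra.
  apply: contB.
    by apply: contM; [exact: cvg_cst|exact: deri_cont (Phi_deri l0 x1)].
  apply: contB; last exact: (mem_contpsi mem).
  by apply: contM; [exact: cvg_cst|exact: (mem_contp mem)].
- move=> x; rewrite in_itv/= => /andP[x0 _].
  have x1 : -1 < x by lra.
  have h1 := deriB (deriZ l (Phi_deri l0 x1)) (deriB (deriZ (c * l `^ (al - 1))
    (mem_derip mem x0)) (mem_deripsi mem x0 l0)).
  by apply: (is_derive_eq h1); ring.
- by move=> x _; rewrite normr0.
Qed.

Lemma weight_ge0 l : 0 < l -> 0 <= W l.
Proof. by move=> l0; rewrite divr_ge0 ?powR_ge0// addr_ge0// ltW. Qed.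

(** The quotient on the left is at most t - t1 and at most 1 / l. *)
Lemma exp_decay_le l t t1 : 0 < l -> t1 <= t ->
  l `^ (al - 1) * ((1 - expR (- l * (t - t1))) / l) <= (1 + (t - t1)) * W l.
Proof.
move=> l0 t0.
have -> : (1 + (t - t1)) * W l = l `^ (al - 1) * ((1 + (t - t1)) / (1 + l)).
  by rewrite /euler_weight; ring.
apply: ler_wpM2l; first exact: powR_ge0.
rewrite ler_pdivrMr// mulrAC ler_pdivlMr ?addr_gt0//.
have e0 : 0 < expR (- l * (t - t1)) by exact: expR_gt0.
have := expR_ge1Dx (- l * (t - t1)); nra.
Qed.

Lemma mem_prim_le (B T : R) t l : 0 < l -> -1 < t -> t <= T -> 0 <= T -> 0 <= B ->
  (forall u, 0 <= u -> u <= T -> `|p u| <= B) ->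
  `|Phi t l| <= c * B * (1 + T) * W l.
Proof.
move=> l0 t1 tT T0 B0 pB; have W0 := weight_ge0 l0.
have [t0|t0] := leP t 0.
  rewrite Phi0// normr0; apply: mulr_ge0 => //; apply: mulr_ge0; last by lra.
  by apply: mulr_ge0 => //; exact: ltW.
pose k := c * l `^ (al - 1).
have k0 : 0 <= k by rewrite mulr_ge0 ?powR_ge0// ltW.
have dE (x : R) : is_derive x 1 (fun x => expR (l * x)) (l * expR (l * x)) by exact: deri_expRZ.
have : `|expR (l * t) * Phi t l - expR (l * 0) * Phi 0 l| <=
   k * B / l * expR (l * t) - k * B / l * expR (l * 0).
  apply: (@le_norm_increment R (fun t => expR (l * t) * Phi t l) (fun t => k * B / l * expR (l * t))
    (fun t => expR (l * t) * (k * p t)) (fun t => k * B / l * (l * expR (l * t)))).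
  - exact: ltW.
  - apply: itv_cont => [|x x1]; first by lra.
    by apply: contM; [exact: deri_cont (dE x)|exact: deri_cont (Phi_deri l0 x1)].
  - by apply: continuous_subspaceT => x; exact: deri_cont (deriZ _ (dE x)).
  - move=> x; rewrite in_itv/= => /andP[x0 _]; have x1 : -1 < x by lra.
    apply: (is_derive_eq (deriM (dE x) (Phi_deri l0 x1))).
    by rewrite -[psi x l](subKr (k * p x)) -(mem_primE l0 x1) /k; ring.
  - move=> x; rewrite in_itv/= => /andP[x0 xt].
    have e0 : 0 < expR (l * x) by exact: expR_gt0.
    rewrite normrM (gtr0_norm e0) normrM (ger0_norm k0).
    have -> : k * B / l * (l * expR (l * x)) = expR (l * x) * (k * B).
      by field; rewrite gt_eqF.
    rewrite ler_pM2l// ler_wpM2l// pB//; lra.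
rewrite (Phi0 l0 (lexx _)) !mulr0 subr0 expR0 mulr1 normrM.
rewrite [`|expR _|]gtr0_norm ?expR_gt0// -ler_pdivlMl ?expR_gt0// => h.
apply: (le_trans h).
have -> : (expR (l * t))^-1 * (k * B / l * expR (l * t) - k * B / l) =
   c * B * (l `^ (al - 1) * ((1 - expR (- l * (t - 0))) / l)).
  rewrite subr0 mulNr expRN /k; field.
  by rewrite !gt_eqF ?expR_gt0.
rewrite -[leRHS]mulrA; apply: ler_wpM2l; first by rewrite mulr_ge0// ltW.
apply: (le_trans (exp_decay_le l0 (ltW t0))).
by apply: ler_wpM2r => //; lra.
Qed.

Lemma weightZ_integrable (C : R) : mu.-integrable Rpos (fun l => (C * W l)%:E).
Proof. by apply: intgZ => //; exact: euler_weight_integrable. Qed.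

Lemma mem_prim_integrable t : -1 < t -> mu.-integrable Rpos (fun l => (Phi t l)%:E).
Proof.
move=> t1; have [t0|t0] := leP t 0.
  apply: (eq_integrable _ (cst 0%E)) => //; last exact: integrable0.
  by move=> l; rewrite inE/= in_itv/= andbT => l0; rewrite Phi0.
have [B pB] : exists B : R, forall u, 0 <= u -> u <= t -> `|p u| <= B.
  have cp : {within `[0, t], continuous (fun u => `|p u|)}.
    apply: continuous_subspaceT => x; apply: continuous_comp; first exact: (mem_contp mem).
    exact: norm_continuous.
  have [u0 _ Hu] := EVT_max (ltW t0) cp.
  by exists `|p u0| => u u0' ut; apply: Hu; rewrite in_itv/= u0'.
have B0 : 0 <= B by apply: le_trans (pB 0 _ _) => //; exact: ltW.
have mPhi : measurable_fun Rpos (Phi t).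
  have m : measurable_fun Rpos (fun l => (c * l `^ (al - 1) * p t - psi t l) / l).
    apply: measurable_funM.
      apply: measurable_funB.
        apply: measurable_funM => //; apply: measurable_funM => //.
        exact: measurable_powRl.
      by have /integrableP[/measurable_EFinP] := mem_int mem t0.
    have : measurable_fun Rpos (fun l : R => l `^ (-1)) by exact: measurable_powRl.
    apply: eq_measurable_fun => l; rewrite inE/= in_itv/= andbT => l0.
    by rewrite powR_inv1// ltW.
  apply: eq_measurable_fun m => l; rewrite inE/= in_itv/= andbT => l0.
  by rewrite -(mem_primE l0 t1) mulrC mulKf// gt_eqF.
have iW := weightZ_integrable (c * B * (1 + t)).
apply: le_integrable iW => //.
  by apply/measurable_EFinP; exact: mPhi.
move=> l /=; rewrite in_itv/= andbT => l0; rewrite lee_fin.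
apply: le_trans (mem_prim_le l0 t1 (lexx _) (ltW t0) B0 pB) _.
exact: ler_norm.
Qed.

Definition mem_total t := \int[mu]_(l in Rpos) Phi t l.

Lemma mem_total0 t : t <= 0 -> mem_total t = 0.
Proof.
move=> t0; rewrite /mem_total (@eq_Rintegral _ _ _ _ _ (cst 0)); last first.
  by move=> l; rewrite inE/= in_itv/= andbT => l0; rewrite Phi0.
by rewrite Rintegral_cst//= mul0r.
Qed.

Lemma mem_total_le (B T : R) t : -1 < t -> t <= T -> 0 <= T -> 0 <= B ->
  (forall u, 0 <= u -> u <= T -> `|p u| <= B) ->
  `|mem_total t| <= c * B * (1 + T) * \int[mu]_(l in Rpos) W l.
Proof.
move=> t1 tT T0 B0 pB; have iP := mem_prim_integrable t1.
have iW := euler_weight_integrable al0 al1.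
apply: (le_trans (le_normr_Rintegral _ iP)) => //.
rewrite -RintegralZl//; apply: le_Rintegral => //.
- exact: integrable_norm.
- exact: weightZ_integrable.
- move=> l /=; rewrite in_itv/= andbT => l0.
  exact: mem_prim_le.
Qed.

(** Started from a positive time d, the memory is dominated by an integrable
    function of l; this is what allows differentiation under the integral. *)
Lemma mem_psi_le (B d T : R) t l : 0 < d -> 0 < l -> d <= t -> t <= T -> 0 <= B ->
  (forall u, d <= u -> u <= T -> `|dp u| <= B) ->
  `|psi t l| <= `|psi d l| + c * B * (1 + T) * W l.
Proof.
move=> d0 l0 dt tT B0 dpB; have W0 := weight_ge0 l0.
pose k := c * l `^ (al - 1).
have k0 : 0 <= k by rewrite mulr_ge0 ?powR_ge0// ltW.
have dE (x : R) : is_derive x 1 (fun x => expR (l * x)) (l * expR (l * x)) by exact: deri_expRZ.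
have h : `|expR (l * t) * psi t l - expR (l * d) * psi d l| <=
   k * B / l * expR (l * t) - k * B / l * expR (l * d).
  apply: (@le_norm_increment R (fun t => expR (l * t) * psi t l) (fun t => k * B / l * expR (l * t))
    (fun t => expR (l * t) * (k * dp t)) (fun t => k * B / l * (l * expR (l * t)))).
  - exact: dt.
  - have ce : continuous (fun t0 : R => expR (l * t0) * psi t0 l).
      move=> x; have := contM (deri_cont (dE x)) (mem_contpsi mem l0 (x:=x)). exact.
    exact: continuous_subspaceT.
  - by apply: continuous_subspaceT => x; exact: deri_cont (deriZ _ (dE x)).
  - move=> x; rewrite in_itv/= => /andP[x0 _].
    have x0' : 0 < x by lra.
    apply: (is_derive_eq (deriM (dE x) (mem_deripsi mem x0' l0))).
    by rewrite /k; ring.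
  - move=> x; rewrite in_itv/= => /andP[x0 xt].
    have e0 : 0 < expR (l * x) by exact: expR_gt0.
    rewrite normrM (gtr0_norm e0) normrM (ger0_norm k0).
    have -> : k * B / l * (l * expR (l * x)) = expR (l * x) * (k * B).
      by field; rewrite gt_eqF.
    rewrite ler_pM2l// ler_wpM2l// dpB//; lra.
have et : 0 < expR (l * t) by exact: expR_gt0.
have {}h : `|psi t l - expR (- l * (t - d)) * psi d l| <= c * B * (1 + T) * W l.
  have -> : psi t l - expR (- l * (t - d)) * psi d l =
    (expR (l * t))^-1 * (expR (l * t) * psi t l - expR (l * d) * psi d l).
    have -> : - l * (t - d) = l * d - l * t by ring.
    rewrite expRB; field; exact: lt0r_neq0.
  rewrite normrM gtr0_norm ?invr_gt0// ler_pdivrMl//.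
  apply: (le_trans h); rewrite -ler_pdivrMl//.
  have -> : (expR (l * t))^-1 * (k * B / l * expR (l * t) - k * B / l * expR (l * d)) =
     c * B * (l `^ (al - 1) * ((1 - expR (- l * (t - d))) / l)).
    have -> : - l * (t - d) = l * d - l * t by ring.
    rewrite expRB /k; field; by rewrite !lt0r_neq0.
  rewrite -[leRHS]mulrA; apply: ler_wpM2l; first by rewrite mulr_ge0// ltW.
  apply: (le_trans (exp_decay_le l0 dt)).
  by apply: ler_wpM2r => //; lra.
have e1 : `|expR (- l * (t - d)) * psi d l| <= `|psi d l|.
  rewrite normrM gtr0_norm ?expR_gt0// ler_piMl// -expR0 ler_expR; nra.
have -> : psi t l = expR (- l * (t - d)) * psi d l + (psi t l - expR (- l * (t - d)) * psi d l) by ring.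
by apply: (le_trans (ler_normD _ _)); exact: lerD.
Qed.

(** The domination of [mem_psi_le] holds on a neighbourhood of each t > 0. *)
Lemma mem_total_deri t : 0 < t ->
  is_derive t 1 mem_total (\int[mu]_(l in Rpos) psi t l).
Proof.
move=> t0; pose d := t / 2; have d0 : 0 < d by rewrite divr_gt0.
have [B dpB] := mem_dp_bound mem (t + 1) d0.
have B0 : 0 <= B by apply: le_trans (dpB t _ _) => //; rewrite /d; lra.
have iW := weightZ_integrable (c * B * (1 + (t + 1))).
have id := intg_norm (mem_int mem d0).
apply: (@deri_under_int _ Phi psi (fun l => `|psi d l| + c * B * (1 + (t + 1)) * W l) d (t + 1)) => //.
- by rewrite in_itv/= /d; apply/andP; split; lra.
- by move=> x; rewrite in_itv/= => /andP[dx _]; apply: mem_prim_integrable; lra.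
- move=> x l; rewrite in_itv/= => /andP[dx _] /=; rewrite in_itv/= andbT => l0.
  by apply: Phi_deri => //; lra.
- exact: intgD.
- move=> x l; rewrite in_itv/= => /andP[dx xt] /=; rewrite in_itv/= andbT => l0.
  by apply: mem_psi_le => //; exact: ltW.
Qed.

Lemma mem_total_cont t : {for t, continuous mem_total}.
Proof.
have [t0|t0|->] := ltgtP t 0; last first.
- apply/cvgrPdist_le => /= e e0.
  have [w wE] : exists w, \int[mu]_(l in Rpos) W l = w by exists (\int[mu]_(l in Rpos) W l).
  have w0 : 0 <= w.
    by rewrite -wE; apply: Rintegral_ge0 => l /=; rewrite in_itv/= andbT; exact: weight_ge0.
  pose I := c * 2 * w.
  have I0 : 0 <= I by rewrite mulr_ge0// mulr_ge0// ltW.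
  have eI : 0 < e / (I + 1) by rewrite divr_gt0// ltr_wpDl.
  have := mem_contp mem (x := 0); move=> /cvgrPdist_le/(_ _ eI)/nbhs_ballP[r /= r0 Hr].
  have m0 : 0 < Num.min r 1 by rewrite lt_min r0 ltr01.
  have [mr m1] : Num.min r 1 <= r /\ Num.min r 1 <= 1 by rewrite !ge_min !lexx orbT.
  apply/nbhs_ballP; exists (Num.min r 1 / 2); first by rewrite /= divr_gt0.
  move=> {}t; rewrite /ball/= sub0r normrN ltr_norml => /andP[t1 t2].
  rewrite mem_total0// sub0r normrN.
  have pB u : 0 <= u -> u <= Num.min r 1 / 2 -> `|p u| <= e / (I + 1).
    move=> u0 ur; have := Hr u; rewrite /ball/= sub0r normrN ger0_norm//.
    by rewrite (mem_p0 mem)// sub0r normrN; apply; lra.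
  have ht1 : -1 < t by lra.
  have hm : 0 <= Num.min r 1 / 2 by lra.
  apply: (le_trans (mem_total_le ht1 (ltW t2) hm (ltW eI) pB)).
  apply: (@le_trans _ _ (e / (I + 1) * I)).
    rewrite wE; have -> : e / (I + 1) * I = c * (e / (I + 1)) * 2 * w by rewrite {2}/I; ring.
    apply: ler_wpM2r => //; apply: ler_wpM2l; last by lra.
    by rewrite mulr_ge0// ltW.
  by rewrite -mulrA ler_piMr ?(ltW e0)// mulrC ler_pdivrMr ?mul1r ?ltr_wpDl// lerDl.
- exact: deri_cont (mem_total_deri t0).
- have : is_derive t 1 mem_total 0.
    apply: deri_near (deri_cst 0 t).
    near=> u; rewrite mem_total0//.
    by apply/ltW; near: u; exact: lt_nbhsl.
  exact: deri_cont.
Unshelve. all: by end_near. Qed.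

End lemmas.
End Memory.

(** * Energy of the memory *)

Section StoredEnergy.
Context {R : realType}.
Local Notation mu := (@lebesgue_measure R).
Local Notation Rpos := (`]0%R, +oo[%classic : set R).
Variables (al c : R) (p dp : R -> R) (psi : R -> R -> R).
Hypotheses (al0 : 0 < al) (al1 : al < 1) (c0 : 0 < c).
Hypothesis mem : memory_pair al c p dp psi.
Variable s : R.
Hypotheses (s0 : 0 < s) (s1 : s < 2^-1).
Local Notation Phi := (mem_prim psi).
Local Notation W := (euler_weight al).

Definition mem_shift (t l : R) := Phi t l - Phi (t - s) l.

(** The weight is chosen so that the source term c l^(al-1) p of the integrated
    memory equation is paired with the integrated memory with coefficient one,
    while the relaxation term only dissipates. *)
Definition mem_energy (t : R) :=
  \int[mu]_(l in Rpos) (l `^ (1 - al) / (2 * c) * mem_shift t l ^+ 2).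

Let p_bound (T : R) : 0 <= T -> exists2 B : R, 0 <= B & forall u, u <= T -> `|p u| <= B.
Proof.
move=> T0.
have cp : {within `[0, T], continuous (fun u => `|p u|)}.
  apply: continuous_subspaceT => x; apply: continuous_comp; first exact: (mem_contp mem).
  exact: norm_continuous.
have [u0 _ Hu] := EVT_max T0 cp.
exists `|p u0| => // u uT; have [u0'|u0'] := leP 0 u; last by rewrite (mem_p0 mem) ?normr0// ltW.
by apply: Hu; rewrite in_itv/= u0'.
Qed.

Let lpow (l : R) : 0 < l -> l `^ (1 - al) * l `^ (al - 1) = 1.
Proof.
move=> l0; rewrite -powRD; last by rewrite (gt_eqF l0) implybT.
by rewrite (_ : 1 - al + (al - 1) = 0) ?powRr0//; ring.
Qed.

Let lpowW (l : R) : 0 < l -> l `^ (1 - al) * W l = (1 + l)^-1.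
Proof. by move=> l0; rewrite /euler_weight mulrA lpow// mul1r. Qed.

Let W0 (l : R) : 0 < l -> 0 <= W l.
Proof. by move=> l0; rewrite divr_ge0 ?powR_ge0// addr_ge0// ltW. Qed.

Lemma mem_shift_intg (t : R) : -2^-1 < t -> mu.-integrable Rpos (fun l => (mem_shift t l)%:E).
Proof.
move=> t0; move: s0 s1 => s0' s1'.
by apply: intgB => //; apply: (mem_prim_integrable al0 al1 c0 mem); lra.
Qed.

Let shift_bounds (T : R) : 0 <= T -> exists2 C : R, 0 <= C &
  forall t l : R, -2^-1 < t -> t <= T -> 0 < l ->
   `|mem_shift t l| <= C * W l /\ `|psi t l - psi (t - s) l| <= C * l `^ (al - 1).
Proof.
move=> T0; have [B B0 pB] := p_bound T0; move: (s0) (s1) => s0' s1'.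
pose C := c * B * (1 + T).
have C0 : 0 <= C by rewrite !mulr_ge0 ?addr_ge0// ltW.
have cB : 0 <= c * B by rewrite mulr_ge0// ltW.
exists (2 * (c * B + C)); first by rewrite mulr_ge0// addr_ge0.
move=> t l t0 tT l0.
have hP u : -1 < u -> u <= T -> `|Phi u l| <= C * W l.
  by move=> u1 uT; apply: (mem_prim_le c0 mem) => // v _; exact: pB.
have hpsi u : -1 < u -> u <= T -> `|psi u l| <= (c * B + C) * l `^ (al - 1).
  move=> u1 uT; rewrite -[psi u l](subKr (c * l `^ (al - 1) * p u)) -(mem_primE mem l0 u1).
  apply: (le_trans (ler_normB _ _)); rewrite mulrDl; apply: lerD.
    rewrite !normrM (gtr0_norm c0) (ger0_norm (powR_ge0 _ _)) mulrAC.
    by apply: ler_wpM2r; rewrite ?powR_ge0// ler_wpM2l ?pB// ltW.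
  rewrite normrM (gtr0_norm l0); apply: (@le_trans _ _ (l * (C * W l))).
    by apply: ler_wpM2l; [exact: ltW|exact: hP].
  rewrite mulrCA; apply: ler_wpM2l => //; rewrite /euler_weight mulrCA.
  by rewrite ler_piMr ?powR_ge0// ler_pdivrMr ?mul1r ?addr_gt0// lerDr.
split.
  apply: (le_trans (ler_normB _ _)).
  have h1 : `|Phi t l| <= C * W l by apply: hP; lra.
  have h2 : `|Phi (t - s) l| <= C * W l by apply: hP; lra.
  have h3 : C * W l <= (c * B + C) * W l by apply: ler_wpM2r; [exact: W0|lra].
  lra.
apply: (le_trans (ler_normB _ _)).
have h1 : `|psi t l| <= (c * B + C) * l `^ (al - 1) by apply: hpsi; lra.
have h2 : `|psi (t - s) l| <= (c * B + C) * l `^ (al - 1) by apply: hpsi; lra.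
lra.
Qed.

Let energy_intg (t : R) : -2^-1 < t ->
  mu.-integrable Rpos (fun l => (l `^ (1 - al) / (2 * c) * mem_shift t l ^+ 2)%:E).
Proof.
move=> t0; have T0 : 0 <= t + 1 by lra.
have [C C0 hC] := shift_bounds T0.
apply: (@intg_le _ _ _ _ (fun l => (C ^+ 2 / (2 * c)) * W l)) => //.
- apply: measurable_funM.
    by apply: measurable_funM => //; exact: measurable_powRl.
  by apply: measurable_funX; apply: (intg_measurable (mem_shift_intg t0)).
- move=> l; rewrite /= in_itv/= andbT => l0.
  have tt : t <= t + 1 by lra.
  have [h1 _] := hC t l t0 tt l0.
  have cc : 0 < 2 * c by rewrite mulr_gt0.
  rewrite normrM ger0_norm; last by rewrite divr_ge0 ?powR_ge0// ltW.
  rewrite normrX; apply: (@le_trans _ _ (l `^ (1 - al) / (2 * c) * (C * W l) ^+ 2)).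
    apply: ler_wpM2l; first by rewrite divr_ge0 ?powR_ge0// ltW.
    by rewrite ler_sqr ?nnegrE// mulr_ge0// W0.
  have -> : l `^ (1 - al) / (2 * c) * (C * W l) ^+ 2 =
    C ^+ 2 / (2 * c) * ((l `^ (1 - al) * W l) * W l) by ring.
  apply: ler_wpM2l; first by rewrite divr_ge0 ?sqr_ge0// ltW.
  by rewrite lpowW// ler_piMl ?W0// invf_le1 ?addr_gt0// lerDl ltW.
- exact: weightZ_integrable.
Qed.

Let dJ (t l : R) := l `^ (1 - al) / c * (mem_shift t l * (psi t l - psi (t - s) l)).

Let dJE (t l : R) : -2^-1 < t -> 0 < l ->
  dJ t l = (p t - p (t - s)) * mem_shift t l - l `^ (1 - al) * l / c * mem_shift t l ^+ 2.
Proof.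
move=> t0 l0; move: (s0) (s1) => s0' s1'; rewrite /dJ /mem_shift.
have h1 := @mem_primE R al c p dp psi mem t l l0.
have h2 := @mem_primE R al c p dp psi mem (t - s) l l0.
have -> : psi t l - psi (t - s) l =
   c * l `^ (al - 1) * (p t - p (t - s)) - l * (Phi t l - Phi (t - s) l).
  rewrite mulrBr [X in _ = _ - X]mulrBr h1 ?h2; [ring|lra|lra].
set X := Phi t l - _; have e := lpow l0.
transitivity ((l `^ (1 - al) * l `^ (al - 1)) * (p t - p (t - s)) * X - l `^ (1 - al) * l / c * X ^+ 2).
  by field; rewrite gt_eqF.
by rewrite e mul1r.
Qed.

(** By [mem_primE], the derivative of the energy density is the product of the
    increments of p and of the integrated memory, minus a square. *)
Lemma mem_energy_deri (t : R) : -2^-1 < t -> exists2 d, is_derive t 1 mem_energy d &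
  d <= (p t - p (t - s)) * (mem_total psi t - mem_total psi (t - s)).
Proof.
move=> t0; have T0 : 0 <= t + 1 by lra.
have [C C0 hC] := shift_bounds T0.
have dom (x l : R) : x \in `](-2^-1)%R, (t + 1)[ -> Rpos l -> `|dJ x l| <= (C ^+ 2 / c) * W l.
  rewrite in_itv/= => /andP[x0 xt]; rewrite /= in_itv/= andbT => l0.
  have [h1 h2] := hC x l x0 (ltW xt) l0.
  rewrite /dJ normrM ger0_norm; last by rewrite divr_ge0 ?powR_ge0// ltW.
  rewrite normrM; apply: (@le_trans _ _ (l `^ (1 - al) / c * ((C * W l) * (C * l `^ (al - 1))))).
    apply: ler_wpM2l; first by rewrite divr_ge0 ?powR_ge0// ltW.
    exact: ler_pM.
  rewrite le_eqVlt; apply/orP; left; apply/eqP.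
  by rewrite -[RHS]mul1r -[X in _ = X * _](lpow l0); ring.
exists (\int[mu]_(l in Rpos) dJ t l).
  apply: (@deri_under_int _ _ (fun t l => l `^ (1 - al) / (2 * c) * mem_shift t l ^+ 2) dJ
    (fun l => (C ^+ 2 / c) * W l) (-2^-1) (t + 1)) => //.
  - by rewrite in_itv/= t0/=; lra.
  - by move=> x; rewrite in_itv/= => /andP[x0 _]; exact: energy_intg.
  - move=> x l; rewrite in_itv/= => /andP[x0 _] /=; rewrite in_itv/= andbT => l0.
    move: (s0) (s1) => s0' s1'.
    have d1 : is_derive x 1 (Phi ^~ l) (psi x l).
      by apply: prim_deri => //; [exact: (mem_contpsi mem)|lra].
    have d2 : is_derive x 1 (fun x => Phi (x - s) l) (psi (x - s) l).
      apply: (@deri_shift _ (Phi ^~ l)).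
      by apply: prim_deri => //; [exact: (mem_contpsi mem)|lra].
    apply: (is_derive_eq (deriZ _ (deri_sqr (deriB d1 d2)))).
    by rewrite /dJ /mem_shift; field; rewrite gt_eqF.
  - exact: weightZ_integrable.
move: (s0) (s1) => s0' s1'.
rewrite /mem_total -RintegralB//; last 2 first.
- by apply: (mem_prim_integrable al0 al1 c0 mem); lra.
- by apply: (mem_prim_integrable al0 al1 c0 mem); lra.
rewrite -RintegralZl//; last exact: mem_shift_intg.
have mS := intg_measurable (mem_shift_intg t0).
have iS : mu.-integrable Rpos (fun l => ((p t - p (t - s)) * mem_shift t l)%:E).
  by apply: intgZ => //; exact: mem_shift_intg.
apply: le_Rintegral => //.
- apply: (@intg_le _ _ _ _ (fun l => (C ^+ 2 / c) * W l)) => //.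
  + have m : measurable_fun Rpos (fun l => (p t - p (t - s)) * mem_shift t l -
        l `^ (1 - al) * l / c * mem_shift t l ^+ 2).
      apply: measurable_funB; first by apply: measurable_funM.
      apply: measurable_funM; last exact: measurable_funX.
      apply: measurable_funM => //; apply: measurable_funM => //.
      exact: measurable_powRl.
    by apply: eq_measurable_fun m => l; rewrite inE/= in_itv/= andbT => l0; rewrite dJE.
  + move=> l l0; apply: dom => //; rewrite in_itv/= t0/=; lra.
  + exact: weightZ_integrable.
- move=> l /=; rewrite in_itv/= andbT => l0; rewrite dJE// gerBl mulr_ge0 ?sqr_ge0//.
  by rewrite divr_ge0 ?mulr_ge0 ?powR_ge0// ltW.
Qed.

Lemma mem_energy_ge0 t : 0 <= mem_energy t.
Proof.
apply: Rintegral_ge0 => l _; rewrite mulr_ge0 ?sqr_ge0// divr_ge0 ?powR_ge0//.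
by rewrite mulr_ge0// ltW.
Qed.

Lemma mem_energy0 : mem_energy 0 = 0.
Proof.
rewrite /mem_energy (@eq_Rintegral _ _ _ _ _ (cst 0)) ?Rintegral_cst//= ?mul0r//.
move=> l; rewrite inE/= in_itv/= andbT => l0; rewrite /mem_shift /mem_prim.
rewrite !prim_eq0 ?subr0 ?expr0n/= ?mulr0//.
- by move=> y y0; exact: (mem_psi0 mem).
- by rewrite sub0r oppr_le0 ltW.
- by move=> y y0; exact: (mem_psi0 mem).
Qed.

End StoredEnergy.

(** * The energy estimate *)

Section Energy.
Context {R : realType}.
Local Notation mu := (@lebesgue_measure R).
Local Notation Rpos := (`]0%R, +oo[%classic : set R).
Variable T : finType.
Implicit Types (i k : T) (t s : R).

(** What the energy argument needs of the discrete space operators: they are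
    additive and commute with time derivatives. *)
Record field_form (B : (T -> R) -> (T -> R) -> T -> R) : Prop := FieldForm {
  form_sub : forall y x y' x' i,
    B (fun k => y k - y' k) (fun k => x k - x' k) i = B y x i - B y' x' i;
  form_deri : forall (Y X : T -> R -> R) y x t i,
    (forall k, is_derive t 1 (Y k) (y k)) -> (forall k, is_derive t 1 (X k) (x k)) ->
    is_derive t 1 (fun u => B (Y ^~ u) (X ^~ u) i) (B y x i) }.

Lemma form0 B i : field_form B -> B (fun=> 0) (fun=> 0) i = 0.
Proof.
move=> FB; have h := form_sub FB (fun=> 0) (fun=> 0) (fun=> 0) (fun=> 0) i.
have e : (fun _ : T => 0 - 0 : R) = (fun=> 0) by apply/funext => k; rewrite subrr.
by move: h; rewrite e => ->; rewrite subrr.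
Qed.

Lemma shift_lipschitz (f df : R -> R) (rho s t Tm : R) :
  (forall u : R, -1 < u -> {for u, continuous f}) -> (forall u : R, u <= 0 -> f u = 0) ->
  (forall u : R, 0 < u -> is_derive u 1 f (df u)) ->
  (forall u : R, 0 < u -> u <= Tm -> `|df u| <= rho) -> 0 <= rho ->
  0 < s -> 0 <= t -> t <= Tm -> `|f t - f (t - s)| <= rho * s.
Proof.
move=> cf f0 df1 bf rho0 s0 t0 tT.
have cw (a b : R) : 0 <= a -> {within `[a, b], continuous f}.
  move=> a0; apply: continuous_in_subspaceT => u; rewrite inE/= in_itv/= => /andP[au _].
  by apply: cf; lra.
have [ts|ts] := leP 0 (t - s).
  have ts' : t - s <= t by lra.
  apply: le_trans (@lipschitz_increment R f df rho (t - s) t ts' (cw _ _ ts) _ _) _.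
  - by move=> u; rewrite in_itv/= => /andP[u1 u2]; apply: df1; lra.
  - by move=> u; rewrite in_itv/= => /andP[u1 u2]; apply: bf; lra.
  - by rewrite (_ : t - (t - s) = s)//; ring.
rewrite (f0 (t - s) (ltW ts)) -(f0 0 (lexx 0)).
apply: le_trans (@lipschitz_increment R f df rho 0 t t0 (cw _ _ (lexx _)) _ _) _.
- by move=> u; rewrite in_itv/= => /andP[u1 u2]; apply: df1; lra.
- by move=> u; rewrite in_itv/= => /andP[u1 u2]; apply: bf; lra.
- by apply: ler_wpM2l => //; lra.
Qed.

Lemma young_le (th x' r : R) : 0 < th -> x' * r <= th / 2 * x' ^+ 2 + r ^+ 2 / (2 * th).
Proof.
move=> th0; have : 0 <= (th * x' - r) ^+ 2 / (2 * th).
  by rewrite divr_ge0 ?sqr_ge0// ltW// mulr_gt0.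
have -> : (th * x' - r) ^+ 2 / (2 * th) = th / 2 * x' ^+ 2 + r ^+ 2 / (2 * th) - x' * r.
  by field; rewrite gt_eqF.
by lra.
Qed.

Lemma memory_split (a b k k' q q' y y' : R) :
  a * (k - k') = (a * k + q / b - y) - (a * k' + q' / b - y') - (q - q') / b + (y - y').
Proof. by ring. Qed.

Lemma energy_rate_le (m e b a X Y Q xd yd qd U1 U2 bX bY D D' dJ kd : R) :
  m * xd = U1 - bX -> e * yd = U2 - bY - qd -> a * kd = D - Q / b + Y ->
  0 < a -> dJ <= qd * kd ->
  m * (X * xd) + e * (Y * yd) + b^-1 * (Q * qd) - (qd * D + Q * D') + a * dJ <=
  X * U1 + Y * U2 - Q * D' - (bX * X + bY * Y).
Proof.
move=> e1 e2 e3 a0 hJ.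
have hJa : a * dJ <= qd * (D - Q / b + Y) by rewrite -e3 mulrCA ler_pM2l.
have -> : m * (X * xd) + e * (Y * yd) + b^-1 * (Q * qd) - (qd * D + Q * D') + a * dJ =
  X * (m * xd) + Y * (e * yd) + Q / b * qd - (qd * D + Q * D') + a * dJ by ring.
rewrite e1 e2; move: hJa.
have -> : qd * (D - Q / b + Y) = qd * D - Q / b * qd + Y * qd by ring.
by rewrite !mulrBr; lra.
Qed.

Lemma rate_sum_le (P1 P2 P3 X2 Y2 Q2 V1 V2 r e th : R) :
  P1 <= th * X2 + V1 -> P2 <= th * Y2 + V2 -> - P3 <= th * Q2 + r + e ->
  V1 <= r -> V2 <= r -> P1 + P2 - P3 <= th * (X2 + Y2 + Q2) + 3 * r + e.
Proof. by rewrite !mulrDr; lra. Qed.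

(** The growth rate k2 holds at all times, and the extra rate k1 only up to
    time s. *)
Lemma two_phase_growth (f : R -> R) (k1 k2 s Tm : R) :
  0 <= k1 -> 0 <= k2 -> 0 < s -> s <= Tm ->
  (forall u : R, 0 <= u -> {for u, continuous f}) -> f 0 = 0 ->
  (forall u : R, 0 < u -> u < Tm -> u != s -> exists2 d, is_derive u 1 f d &
     d <= k2 + (if u <= s then k1 else 0)) ->
  forall t, 0 <= t -> t <= Tm -> f t <= k1 * s + k2 * Tm.
Proof.
move=> k10 k20 s0 sT cf f0 hd.
have cw (u v : R) : 0 <= u -> {within `[u, v], continuous f}.
  move=> u0; apply: continuous_in_subspaceT => w; rewrite inE/= in_itv/= => /andP[w0 _].
  by apply: cf; lra.
have df (t : R) : 0 < t -> t < Tm -> t != s -> is_derive t 1 f (derive1 f t).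
  by move=> t0 tT ts; have [d h _] := hd t t0 tT ts; rewrite (deri_derive1 h).
have ledf (t : R) : 0 < t -> t < Tm -> t != s -> derive1 f t <= k2 + (if t <= s then k1 else 0).
  by move=> t0 tT ts; have [d h hd'] := hd t t0 tT ts; rewrite (deri_derive1 h).
have linear_cont (k u v : R) : {within `[u, v], continuous (fun t => k * t)}.
  by apply: continuous_subspaceT => t; exact: mulrl_continuous.
have linear_deri (k t : R) : is_derive t 1 (fun t => k * t) k.
  by rewrite -[X in is_derive _ _ _ X]mulr1; apply: deriZ.
have first t : 0 <= t -> t <= s -> f t <= (k2 + k1) * t.
  move=> t0 ts.
  have h : f t - f 0 <= (k2 + k1) * t - (k2 + k1) * 0.
    apply: (le_increment t0 (cw _ _ (lexx _)) (linear_cont _ _ _)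
      (df := derive1 f) (dg := fun=> k2 + k1)).
    - move=> u; rewrite in_itv/= => /andP[u0 ut].
      have us : u < s by exact: lt_le_trans ts.
      by apply: df => //; [exact: lt_le_trans sT|rewrite lt_eqF].
    - move=> u; rewrite in_itv/= => /andP[u0 ut]; have us : u < s by exact: lt_le_trans ts.
      by have := ledf u u0 (lt_le_trans us sT); rewrite (lt_eqF us) (ltW us); exact.
  by move: h; rewrite f0 mulr0 !subr0.
move=> t t0 tT; have [ts|ts] := leP t s.
  apply: (le_trans (first t t0 ts)); rewrite mulrDl addrC.
  by apply: lerD; apply: ler_wpM2l.
have h : f t - f s <= k2 * t - k2 * s.
  apply: (le_increment (ltW ts) (cw _ _ (ltW s0)) (linear_cont _ _ _)
      (df := derive1 f) (dg := fun=> k2)).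
  - move=> u; rewrite in_itv/= => /andP[u0 ut].
    by apply: df; [exact: lt_trans u0|exact: lt_le_trans tT|rewrite gt_eqF].
  - move=> u; rewrite in_itv/= => /andP[u0 ut].
    have := ledf u (lt_trans s0 u0) (lt_le_trans ut tT).
    by rewrite (gt_eqF u0) [u <= s]leNgt u0/= addr0; exact.
have h1 := first s (ltW s0) (lexx _).
have h2 : k2 * t <= k2 * Tm by apply: ler_wpM2l.
by move: h1; rewrite mulrDl; lra.
Qed.

(** The factor th = kap / (1 + Tm) makes the terms with the maximal energy m on
    the right exactly half of the left-hand side. *)
Lemma energy_absorb (kap m Tm n r2 om rho s th : R) : 0 < kap -> 0 < Tm -> 0 <= n ->
  0 <= r2 -> th = kap / (1 + Tm) ->
  kap * m <= th / 2 * m + n * (r2 / (2 * th)) +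
     (n * (om * s * rho) * s + (th / 2 * m + n * (3 * r2 / (2 * th))) * Tm) ->
  m <= n * (3 * (1 + Tm) ^+ 2 * r2 / kap ^+ 2) + 2 * n * om * rho / kap * s ^+ 2.
Proof.
move=> k0 T0 n0 r20 thE key.
have th0 : 0 < th by rewrite thE divr_gt0// addr_gt0.
have e1 : th / 2 * m + th / 2 * m * Tm = kap / 2 * m.
  by rewrite thE; field; rewrite gt_eqF// addr_gt0.
have e2 : n * (3 * (1 + Tm) ^+ 2 * r2 / (2 * kap)) = n * (3 * r2 / (2 * th)) * (1 + Tm).
  by rewrite thE; field; rewrite !gt_eqF// addr_gt0.
have e3 : n * (r2 / (2 * th)) <= n * (3 * r2 / (2 * th)).
  apply: ler_wpM2l => //; apply: ler_wpM2r; first by rewrite invr_ge0 mulr_ge0// ltW.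
  by lra.
have e4 : kap * m = kap / 2 * m + kap / 2 * m by field.
have mle : kap / 2 * m <= n * (3 * (1 + Tm) ^+ 2 * r2 / (2 * kap)) + n * (om * s * rho) * s.
  move: key; rewrite e4 e2; move: e1 e3.
  move: (th / 2 * m) (kap / 2 * m) (n * (r2 / (2 * th))) (n * (3 * r2 / (2 * th))) => z2 z3 z4 z5.
  by lra.
rewrite -(ler_pM2l (divr_gt0 k0 (ltr0n _ 2))).
apply: (le_trans mle); rewrite le_eqVlt; apply/orP; left; apply/eqP.
by field; rewrite gt_eqF.
Qed.

Variables (m0 eps b a c al : R).
Variables (x y p dx dy dp : T -> R -> R) (psi : T -> R -> R -> R).
Variables (B1 B2 : (T -> R) -> (T -> R) -> T -> R).
Variables (r1 r2 sg : T -> R -> R).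

(** x, y, p and psi are the coordinates of the errors of H, E, P and of the memory
    variable; r1, r2 and sg are the residuals.  The unknowns vanish for t <= 0,
    so that increments over a time s make sense from t = 0 on. *)
Record error_system : Prop := ErrorSystem {
  es_m0 : 0 < m0; es_eps : 0 < eps; es_b : 0 < b; es_a : 0 < a; es_c : 0 < c;
  es_al0 : 0 < al; es_al1 : al < 1;
  es_B1 : field_form B1; es_B2 : field_form B2;
  es_diss : forall y x, 0 <= \sum_i (B1 y x i * x i + B2 y x i * y i);
  es_contx : forall i, continuous (x i); es_conty : forall i, continuous (y i);
  es_x0 : forall i t, t <= 0 -> x i t = 0; es_y0 : forall i t, t <= 0 -> y i t = 0;
  es_derx : forall i t, 0 < t -> is_derive t 1 (x i) (dx i t);
  es_dery : forall i t, 0 < t -> is_derive t 1 (y i) (dy i t);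
  es_mem : forall i, memory_pair al c (p i) (dp i) (psi i);
  es_eq1 : forall i t, 0 < t -> m0 * dx i t + B1 (y ^~ t) (x ^~ t) i = r1 i t;
  es_eq2 : forall i t, 0 < t -> eps * dy i t + dp i t + B2 (y ^~ t) (x ^~ t) i = r2 i t;
  es_eq3 : forall i t, 0 < t ->
    a * (\int[mu]_(l in Rpos) psi i t l) + p i t / b - y i t = sg i t }.

Hypothesis ES : error_system.

(** The energy controls at least this multiple of x^2 + y^2 + p^2. *)
Definition energy_coef : R := Num.min (Num.min m0 eps) b^-1 / 2.

Lemma energy_coef_gt0 : 0 < energy_coef.
Proof.
by rewrite divr_gt0// !lt_min invr_gt0 (es_m0 ES) (es_eps ES) (es_b ES).
Qed.

Section shifted.
Variables (Tm rho om s : R).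
Hypotheses (T0 : 0 < Tm) (rho0 : 0 <= rho) (om0 : 0 <= om) (s0 : 0 < s) (s1 : s < 2^-1) (sT : s <= Tm).
Hypothesis r1_le : forall i t, 0 < t -> t <= Tm -> `|r1 i t| <= rho.
Hypothesis r2_le : forall i t, 0 < t -> t <= Tm -> `|r2 i t| <= rho.
Hypothesis sg_le : forall i t, 0 < t -> t <= Tm -> `|sg i t| <= rho.
Hypothesis dsg_le : forall i t t', 0 < t' -> t' <= t -> t <= Tm -> `|sg i t - sg i t'| <= rho * (t - t').
Hypothesis p_om : forall i t, 0 <= t -> t <= s -> `|p i t| <= om.

(* Increments over a time s of the primitives of the unknowns. *)
Let X i t := prim (x i) t - prim (x i) (t - s).
Let Y i t := prim (y i) t - prim (y i) (t - s).
Let Q i t := prim (p i) t - prim (p i) (t - s).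
(* The equations integrated once in time: u1, u2 and S have the residuals as
   derivatives. *)
Let u1 i t := m0 * x i t + B1 (fun k => prim (y k) t) (fun k => prim (x k) t) i.
Let u2 i t := eps * y i t + p i t + B2 (fun k => prim (y k) t) (fun k => prim (x k) t) i.
Let K i t := mem_total (psi i) t.
Let S i t := a * K i t + prim (p i) t / b - prim (y i) t.
Let J i t := mem_energy al c (psi i) s t.
Let contp i : continuous (p i) := mem_contp (es_mem ES i).
Let p0 i t : t <= 0 -> p i t = 0 := mem_p0 (es_mem ES i) (t:=t).

Let dprimx i t : -1 < t -> is_derive t 1 (prim (x i)) (x i t).
Proof. by apply: prim_deri; exact: es_contx. Qed.
Let dprimy i t : -1 < t -> is_derive t 1 (prim (y i)) (y i t).
Proof. by apply: prim_deri; exact: es_conty. Qed.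
Let dprimp i t : -1 < t -> is_derive t 1 (prim (p i)) (p i t).
Proof. by apply: prim_deri. Qed.

Let dX i t : -2^-1 < t -> is_derive t 1 (X i) (x i t - x i (t - s)).
Proof.
move=> t0; move: (s1) => s1'; apply: deriB; first by apply: dprimx; lra.
by apply: deri_shift; apply: dprimx; lra.
Qed.
Let dY i t : -2^-1 < t -> is_derive t 1 (Y i) (y i t - y i (t - s)).
Proof.
move=> t0; move: (s1) => s1'; apply: deriB; first by apply: dprimy; lra.
by apply: deri_shift; apply: dprimy; lra.
Qed.
Let dQ i t : -2^-1 < t -> is_derive t 1 (Q i) (p i t - p i (t - s)).
Proof.
move=> t0; move: (s1) => s1'; apply: deriB; first by apply: dprimp; lra.
by apply: deri_shift; apply: dprimp; lra.
Qed.

Let u1_lip i t : 0 <= t -> t <= Tm -> `|u1 i t - u1 i (t - s)| <= rho * s.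
Proof.
apply: (@shift_lipschitz _ (r1 i)) => //.
- move=> u u1'; apply: contD.
    by apply: contZ; exact: (es_contx ES).
  apply: (deri_cont (form_deri (es_B1 ES) (Y := fun k => prim (y k)) (X := fun k => prim (x k)) i _ _)).
    by move=> k; exact: dprimy.
  by move=> k; exact: dprimx.
- move=> u u0; rewrite /u1 (es_x0 ES)// mulr0 add0r -[RHS](form0 i (es_B1 ES)).
  congr (B1 _ _ _); apply/funext => k; apply: prim_eq0 => // v v0; [exact: (es_y0 ES)|exact: (es_x0 ES)].
- move=> u u0; rewrite -(es_eq1 ES)//.
  apply: deriD; first by apply: deriZ; exact: (es_derx ES).
  by apply: (form_deri (es_B1 ES)) => k; [apply: dprimy; lra|apply: dprimx; lra].
- by move=> u; exact: r1_le.
Qed.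

Let u2_lip i t : 0 <= t -> t <= Tm -> `|u2 i t - u2 i (t - s)| <= rho * s.
Proof.
apply: (@shift_lipschitz _ (r2 i)) => //.
- move=> u u1'; apply: contD.
    by apply: contD; [apply: contZ; exact: (es_conty ES)|exact: contp].
  apply: (deri_cont (form_deri (es_B2 ES) (Y := fun k => prim (y k)) (X := fun k => prim (x k)) i _ _)).
    by move=> k; exact: dprimy.
  by move=> k; exact: dprimx.
- move=> u u0; rewrite /u2 (es_y0 ES)// p0// mulr0 !add0r -[RHS](form0 i (es_B2 ES)).
  congr (B2 _ _ _); apply/funext => k; apply: prim_eq0 => // v v0; [exact: (es_y0 ES)|exact: (es_x0 ES)].
- move=> u u0; rewrite -(es_eq2 ES)//.
  apply: deriD.
    by apply: deriD; [apply: deriZ; exact: (es_dery ES)|exact: (mem_derip (es_mem ES i))].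
  by apply: (form_deri (es_B2 ES)) => k; [apply: dprimy; lra|apply: dprimx; lra].
- by move=> u; exact: r2_le.
Qed.

Let dS i t : 0 < t -> is_derive t 1 (S i) (sg i t).
Proof.
move=> t0; rewrite -(es_eq3 ES)//; apply: deriB; last by apply: dprimy; lra.
apply: deriD.
  by apply: deriZ; exact: (mem_total_deri (es_al0 ES) (es_al1 ES) (es_c ES) (es_mem ES i)).
have t1 : -1 < t by lra.
by apply: (is_derive_eq (deriM (dprimp i t1) (deri_cst b^-1 t))); rewrite mulr0 addr0.
Qed.

Let contS i t : -1 < t -> {for t, continuous (S i)}.
Proof.
move=> t1; apply: contB; last by apply: deri_cont (dprimy i t1).
apply: contD.
  by apply: contZ; exact: (mem_total_cont (es_al0 ES) (es_al1 ES) (es_c ES) (es_mem ES i)).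
by apply: contM; [apply: deri_cont (dprimp i t1)|exact: cvg_cst].
Qed.

Let S0 i t : t <= 0 -> S i t = 0.
Proof.
move=> t0; rewrite /S /K (mem_total0 (es_mem ES i))// !prim_eq0 ?mulr0 ?mul0r ?add0r ?oppr0//.
  by move=> v; exact: (es_y0 ES).
by move=> v; exact: p0.
Qed.

Let S_lip i t : 0 <= t -> t <= Tm -> `|S i t - S i (t - s)| <= rho * s.
Proof.
apply: (@shift_lipschitz _ (sg i)) => //; first exact: contS.
- exact: S0.
- exact: dS.
- by move=> u; exact: sg_le.
Qed.

Let DS i t := S i t - S i (t - s).
Let dDS i t := sg i t - (if t <= s then 0 else sg i (t - s)).
(* The energy, corrected by the term Q DS: its derivative contains Q times the
   derivative of DS instead of the derivative of Q times DS. *)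
Let W t := \sum_i (m0 / 2 * X i t ^+ 2 + eps / 2 * Y i t ^+ 2 + (2 * b)^-1 * Q i t ^+ 2
   - Q i t * DS i t + a * J i t).

Let dDS_deri i t : 0 < t -> t != s -> is_derive t 1 (DS i) (dDS i t).
Proof.
move=> t0 ts; apply: deriB; first exact: dS.
rewrite /dDS; case: leP => h.
  have {}h : t < s by rewrite lt_neqAle ts.
  apply: deri_near (deri_cst 0 t); near=> u.
  rewrite S0// subr_le0; apply/ltW; near: u; exact: lt_nbhsl.
by apply: deri_shift; apply: dS; rewrite subr_gt0.
Unshelve. all: by end_near. Qed.

Let W_deri t : 0 < t -> t != s -> exists2 d, is_derive t 1 W d &
  d <= \sum_i (X i t * (u1 i t - u1 i (t - s)) + Y i t * (u2 i t - u2 i (t - s)) - Q i t * dDS i t).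
Proof.
move=> t0 ts.
have t2 : -2^-1 < t by lra.
pose dJ i := derive1 (J i) t.
have hJ i : is_derive t 1 (J i) (dJ i) /\ dJ i <= (p i t - p i (t - s)) * (K i t - K i (t - s)).
  have [d h1 h2] := mem_energy_deri (es_al0 ES) (es_al1 ES) (es_c ES) (es_mem ES i) s0 s1 t2.
  by rewrite /dJ (deri_derive1 h1).
pose D i := m0 * (X i t * (x i t - x i (t - s))) + eps * (Y i t * (y i t - y i (t - s)))
  + b^-1 * (Q i t * (p i t - p i (t - s)))
  - ((p i t - p i (t - s)) * DS i t + Q i t * dDS i t) + a * dJ i.
exists (\sum_i D i).
  apply: deri_sum => i _.
  have h1 := deriZ (m0 / 2) (deri_sqr (dX i t2)).
  have h2 := deriZ (eps / 2) (deri_sqr (dY i t2)).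
  have h3 := deriZ (2 * b)^-1 (deri_sqr (dQ i t2)).
  have h4 := deriM (dQ i t2) (dDS_deri i t0 ts).
  have h5 := deriZ a (hJ i).1.
  apply: (is_derive_eq (deriD (deriB (deriD (deriD h1 h2) h3) h4) h5)).
  by rewrite /D; field; rewrite gt_eqF// (es_b ES).
pose bX i := B1 (fun k => Y k t) (fun k => X k t) i.
pose bY i := B2 (fun k => Y k t) (fun k => X k t) i.
have e1 i : m0 * (x i t - x i (t - s)) = u1 i t - u1 i (t - s) - bX i.
  by rewrite /bX /X /Y (form_sub (es_B1 ES)) /u1; ring.
have e2 i : eps * (y i t - y i (t - s)) = u2 i t - u2 i (t - s) - bY i - (p i t - p i (t - s)).
  by rewrite /bY /X /Y (form_sub (es_B2 ES)) /u2; ring.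
have e3 i : a * (K i t - K i (t - s)) = DS i t - Q i t / b + Y i t.
  exact: memory_split.
have diss := es_diss ES (fun k => Y k t) (fun k => X k t).
apply: (@le_trans _ _ (\sum_i (X i t * (u1 i t - u1 i (t - s)) + Y i t * (u2 i t - u2 i (t - s))
    - Q i t * dDS i t) - \sum_i (bX i * X i t + bY i * Y i t))); last by rewrite gerBl.
rewrite -sumrB; apply: ler_sum => i _.
rewrite /D; apply: energy_rate_le (e1 i) (e2 i) (e3 i) (es_a ES) (hJ i).2.
Qed.

Let kap := energy_coef.
Let n : R := #|T|%:R.
Let G t := \sum_i (X i t ^+ 2 + Y i t ^+ 2 + Q i t ^+ 2).

Let contX i t : -2^-1 < t -> {for t, continuous (X i)}.
Proof. by move=> t0; exact: deri_cont (dX i t0). Qed.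
Let contY i t : -2^-1 < t -> {for t, continuous (Y i)}.
Proof. by move=> t0; exact: deri_cont (dY i t0). Qed.
Let contQ i t : -2^-1 < t -> {for t, continuous (Q i)}.
Proof. by move=> t0; exact: deri_cont (dQ i t0). Qed.

Let contDS i t : -2^-1 < t -> {for t, continuous (DS i)}.
Proof.
move=> t0; move: (s1) => s1'; apply: contB; first by apply: contS; lra.
by apply: (@cont_shift _ (S i)); apply: contS; lra.
Qed.

Let contsqr (f : R -> R) t : {for t, continuous f} -> {for t, continuous (fun t => f t ^+ 2)}.
Proof. by move=> cf; exact: (contM cf cf). Qed.

Let contG t : -2^-1 < t -> {for t, continuous G}.
Proof.
move=> t0; apply: cont_sum => i _; apply: contD; last by apply: contsqr; exact: contQ.
by apply: contD; apply: contsqr; [exact: contX|exact: contY].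
Qed.

Let contW t : -2^-1 < t -> {for t, continuous W}.
Proof.
move=> t0; apply: cont_sum => i _; apply: contD; last first.
  have [d h _] := mem_energy_deri (es_al0 ES) (es_al1 ES) (es_c ES) (es_mem ES i) s0 s1 t0.
  by apply: contZ; exact: deri_cont h.
apply: contB; last by apply: contM; [exact: contQ|exact: contDS].
apply: contD; last by apply: contZ; apply: contsqr; exact: contQ.
by apply: contD; apply: contZ; apply: contsqr; [exact: contX|exact: contY].
Qed.

Let W0 : W 0 = 0.
Proof.
rewrite /W big1// => i _; rewrite /J (mem_energy0 (es_mem ES i) s0)//.
have z (f : R -> R) : (forall u : R, u <= 0 -> f u = 0) -> prim f 0 - prim f (0 - s) = 0.
  by move=> f0; rewrite !prim_eq0 ?subr0// sub0r oppr_le0 ltW.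
rewrite /X /Y /Q !z ?expr0n/= ?mulr0 ?mul0r ?subr0 ?addr0//.
- by move=> u; exact: p0.
- by move=> u; exact: (es_y0 ES).
- by move=> u; exact: (es_x0 ES).
Qed.

Let W_ge t : kap * G t - \sum_i (Q i t * DS i t) <= W t.
Proof.
rewrite /G mulr_sumr -sumrB; apply: ler_sum => i _.
have k1 : kap <= m0 / 2 by rewrite ler_wpM2r// !ge_min lexx.
have k2 : kap <= eps / 2 by rewrite ler_wpM2r// !ge_min lexx orbT.
have k3 : kap <= (2 * b)^-1 by rewrite invfM mulrC ler_wpM2r// ge_min lexx orbT.
have aJ : 0 <= a * J i t.
  by rewrite mulr_ge0 ?(ltW (es_a ES))//; apply: mem_energy_ge0; exact: (es_c ES).
have h1 := ler_wpM2r (sqr_ge0 (X i t)) k1.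
have h2 := ler_wpM2r (sqr_ge0 (Y i t)) k2.
have h3 := ler_wpM2r (sqr_ge0 (Q i t)) k3.
rewrite !mulrDr; move: h1 h2 h3 aJ; move: (Q i t * DS i t) (a * J i t) => q j.
by move: (kap * _) (kap * _) (kap * _) (m0 / 2 * _) (eps / 2 * _) ((2 * b)^-1 * _) => *; lra.
Qed.

Let Q_om i t : 0 <= t -> t <= s -> `|Q i t| <= om * s.
Proof.
move=> t0 ts.
have -> : Q i t = prim (p i) t - prim (p i) 0.
  rewrite /Q (@prim_eq0 _ _ (t - s)) ?(@prim_eq0 _ _ 0)//; [|by move=> u; exact: p0..|].
    by move=> u; exact: p0.
  by rewrite subr_le0.
apply: (@le_trans _ _ (om * (t - 0))); last by rewrite ler_wpM2l// subr0.
apply: (@lipschitz_increment R (prim (p i)) (p i)) => //.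
- apply: continuous_in_subspaceT => u; rewrite inE/= in_itv/= => /andP[u0 _].
  by apply: deri_cont (dprimp i _); lra.
- by move=> u; rewrite in_itv/= => /andP[u0 _]; apply: dprimp; lra.
- by move=> u; rewrite in_itv/= => /andP[u0 ut]; apply: p_om; lra.
Qed.

Let sqr_le_ (u v : R) : `|u| <= v -> u ^+ 2 <= v ^+ 2.
Proof. by move=> uv; rewrite -[u ^+ 2]real_normK ?num_real// ler_sqr ?nnegrE// (le_trans _ uv). Qed.

Let rs2 := (rho * s) ^+ 2.

Let QDS_le th t : 0 < th -> 0 <= t -> t <= Tm ->
  \sum_i (Q i t * DS i t) <= th / 2 * G t + n * (rs2 / (2 * th)).
Proof.
move=> th0 t0 tT; rewrite /G mulr_sumr /n mulr_natl -[_ *+ #|T|]sumr_const -big_split/=.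
apply: ler_sum => i _; apply: le_trans (young_le _ _ th0) _; apply: lerD.
  apply: ler_wpM2l; first by rewrite divr_ge0// ltW.
  by rewrite lerDr addr_ge0 ?sqr_ge0.
apply: ler_wpM2r; first by rewrite invr_ge0 mulr_ge0// ltW.
by apply: sqr_le_; exact: S_lip.
Qed.

(* Before time s the increment of the integrated residual of the third equation
   has a derivative of size rho, and not rho * s; the factor Q is then bounded by
   om * s, with om small because p is continuous and vanishes at 0. *)
Let rate_le th t m : 0 < th -> 0 < t -> t < Tm -> t != s -> G t <= m ->
  \sum_i (X i t * (u1 i t - u1 i (t - s)) + Y i t * (u2 i t - u2 i (t - s)) - Q i t * dDS i t)
  <= th / 2 * m + n * (3 * rs2 / (2 * th)) + (if t <= s then n * (om * s * rho) else 0).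
Proof.
move=> th0 t0 tT ts Gm.
apply: (@le_trans _ _ (th / 2 * G t + n * (3 * rs2 / (2 * th)) + (if t <= s then n * (om * s * rho) else 0))).
  rewrite /G mulr_sumr /n mulr_natl -[_ *+ #|T|]sumr_const.
  have -> : (if t <= s then #|T|%:R * (om * s * rho) else 0) =
      \sum_(i : T) (if t <= s then om * s * rho else 0).
    by rewrite sumr_const; case: ifP => _; [rewrite mulr_natl|rewrite mul0rn].
  rewrite -!big_split/=; apply: ler_sum => i _.
  have Y1 := young_le (X i t) (u1 i t - u1 i (t - s)) th0.
  have Y2 := young_le (Y i t) (u2 i t - u2 i (t - s)) th0.
  have t0' := ltW t0; have tT' := ltW tT.
  have th2 : 0 <= (2 * th)^-1 by rewrite invr_ge0 mulr_ge0// ltW.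
  have L1 := ler_wpM2r th2 (sqr_le_ (u1_lip i t0' tT')).
  have L2 := ler_wpM2r th2 (sqr_le_ (u2_lip i t0' tT')).
  have Y3 : - (Q i t * dDS i t) <= th / 2 * Q i t ^+ 2 + rs2 / (2 * th) + (if t <= s then om * s * rho else 0).
    have [ts'|ts'] := leP t s.
      apply: (@le_trans _ _ (om * s * rho)); last first.
        rewrite lerDr addr_ge0//; apply: mulr_ge0; rewrite ?sqr_ge0//.
        by rewrite divr_ge0// ltW.
      apply: (le_trans (ler_norm _)); rewrite normrN normrM; apply: ler_pM => //.
        by apply: Q_om.
      by rewrite /dDS ts' subr0; exact: sg_le.
    rewrite addr0 -mulrN; apply: le_trans (young_le _ _ th0) _.
    rewrite lerD2l; apply: ler_wpM2r => //; apply: sqr_le_; rewrite normrN /dDS [t <= s]leNgt ts'/=.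
    have -> : rho * s = rho * (t - (t - s)) by ring.
    apply: dsg_le => //; first by rewrite subr_gt0.
    by rewrite gerBl ltW.
  rewrite -/rs2 in L1 L2.
  have -> : 3 * rs2 / (2 * th) = 3 * (rs2 / (2 * th)) by rewrite mulrA.
  exact: rate_sum_le Y1 Y2 Y3 L1 L2.
rewrite !lerD2r; apply: ler_wpM2l => //.
by rewrite divr_ge0// ltW.
Qed.

(** The energy inequality is used at the time where G is maximal on [0, Tm], which
    lets Young's inequality absorb the unknowns without a Gronwall argument. *)
Lemma shifted_energy_le :
  G Tm <= s ^+ 2 * (n * (3 * (1 + Tm) ^+ 2 * rho ^+ 2 / kap ^+ 2 + 2 * om * rho / kap)).
Proof.
have k0 : 0 < kap := energy_coef_gt0.
have T0' := ltW T0.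
have cG : {within `[0, Tm], continuous G}.
  apply: continuous_in_subspaceT => u; rewrite inE/= in_itv/= => /andP[u0 _].
  by apply: contG; lra.
have [tm] := EVT_max T0' cG; rewrite in_itv/= => /andP[tm0 tmT] Gmax.
pose m := G tm.
have Gm t : 0 <= t -> t <= Tm -> G t <= m by move=> ? ?; apply: Gmax; rewrite in_itv/=; apply/andP.
have m_ge0 : 0 <= m by apply: sumr_ge0 => i _; rewrite !addr_ge0 ?sqr_ge0.
pose th := kap / (1 + Tm).
have th0 : 0 < th by rewrite divr_gt0// addr_gt0.
pose k2 := th / 2 * m + n * (3 * rs2 / (2 * th)).
pose k1 := n * (om * s * rho).
have n0 : 0 <= n by rewrite ler0n.
have k20 : 0 <= k2.
  have h1 : 0 <= th / 2 * m by apply: mulr_ge0 => //; rewrite divr_ge0// ltW.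
  have h2 : 0 <= 3 * rs2 / (2 * th).
    by apply: divr_ge0; rewrite mulr_ge0 ?(ltW th0)//; exact: sqr_ge0.
  by rewrite /k2 addr_ge0// mulr_ge0.
have k10 : 0 <= k1 by rewrite /k1 mulr_ge0// mulr_ge0// mulr_ge0// ltW.
have Wle t : 0 <= t -> t <= Tm -> W t <= k1 * s + k2 * Tm.
  apply: (two_phase_growth k10 k20 s0 sT) => //.
  - by move=> u u0; apply: contW; lra.
  - move=> u u0 uT us; have [d h hd] := W_deri u0 us; exists d => //.
    by apply: (le_trans hd); apply: rate_le => //; apply: Gm; exact: ltW.
have key : kap * m <= th / 2 * m + n * (rs2 / (2 * th)) + (k1 * s + k2 * Tm).
  have := Wle tm tm0 tmT; have := W_ge tm; have := QDS_le th0 tm0 tmT; rewrite -/m.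
  move: (W tm) (\sum_i _) (th / 2 * m + _) (k1 * s + _) (kap * m) => *; lra.
apply: (le_trans (Gm _ T0' (lexx _))).
have r20 : 0 <= rs2 by exact: sqr_ge0.
apply: (le_trans (energy_absorb k0 T0 n0 r20 erefl key)).
by rewrite /rs2 le_eqVlt; apply/orP; left; apply/eqP; ring.
Qed.

End shifted.

Lemma near_close (f : R -> R) (u0 e : R) : {for u0, continuous f} -> 0 < e ->
  \forall s \near (0 : R)^'+, forall u, `|u0 - u| <= s -> `|f u0 - f u| <= e.
Proof.
move=> cf e0; have /cvgrPdist_le/(_ _ e0)/nbhs_ballP[r /= r0 Hr] := cf.
near=> s => u us; apply: Hr; rewrite /ball/=; apply: le_lt_trans us _.
near: s; exact: nbhs_right_lt.
Unshelve. all: by end_near. Qed.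

Lemma near_close_all (f : T -> R -> R) (u0 e : R) : (forall i, {for u0, continuous (f i)}) -> 0 < e ->
  \forall s \near (0 : R)^'+, forall i u, `|u0 - u| <= s -> `|f i u0 - f i u| <= e.
Proof. by move=> cf e0; apply: filter_forall => i; exact: near_close. Qed.

(** The increment over s of a primitive is s times a value of the function close
    to Tm; so dividing [shifted_energy_le] by s^2 and letting s tend to 0 gives a
    bound on the unknowns themselves. *)
Lemma energy_estimate (Tm rho : R) : 0 < Tm -> 0 <= rho ->
  (forall i t, 0 < t -> t <= Tm -> `|r1 i t| <= rho) ->
  (forall i t, 0 < t -> t <= Tm -> `|r2 i t| <= rho) ->
  (forall i t, 0 < t -> t <= Tm -> `|sg i t| <= rho) ->
  (forall i t t', 0 < t' -> t' <= t -> t <= Tm -> `|sg i t - sg i t'| <= rho * (t - t')) ->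
  \sum_i (x i Tm ^+ 2 + y i Tm ^+ 2 + p i Tm ^+ 2) <=
  #|T|%:R * (3 * (1 + Tm) ^+ 2 / energy_coef ^+ 2 * rho ^+ 2).
Proof.
move=> T0 rho0 h1 h2 h3 h4; set A := leRHS.
have k0 := energy_coef_gt0.
pose n : R := #|T|%:R.
pose B := n * (2 * rho / energy_coef + 3).
have B0 : 0 <= B.
  by rewrite /B mulr_ge0 ?ler0n// addr_ge0// divr_ge0 ?(ltW k0)// mulr_ge0.
apply/ler_addgt0Pr => d d0.
pose e := d / (B + 1).
have e0 : 0 < e by rewrite divr_gt0// ltr_wpDl.
have csqr (f : R -> R) t : {for t, continuous f} -> {for t, continuous (fun t => f t ^+ 2)}.
  by move=> cf; exact: (contM cf cf).
have contp i : continuous (p i) := mem_contp (es_mem ES i).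
have [s] : exists s : R, [/\ 0 < s < 2^-1, s <= Tm,
   (forall i u, `|0 - u| <= s -> `|p i 0 - p i u| <= e) &
   [/\ (forall i u, `|Tm - u| <= s -> `|x i Tm ^+ 2 - x i u ^+ 2| <= e),
       (forall i u, `|Tm - u| <= s -> `|y i Tm ^+ 2 - y i u ^+ 2| <= e) &
       (forall i u, `|Tm - u| <= s -> `|p i Tm ^+ 2 - p i u ^+ 2| <= e)]].
  near (0 : R)^'+ => s; exists s; split.
  - apply/andP; split; near: s; first exact: nbhs_right_gt.
    by apply: nbhs_right_lt; rewrite invr_gt0.
  - by near: s; exact: nbhs_right_le.
  - by near: s; apply: near_close_all => // i; exact: contp.
  - split; near: s; apply: (@near_close_all (fun i u => _ i u ^+ 2)) => // i; apply: csqr.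
    + exact: (es_contx ES).
    + exact: (es_conty ES).
    + exact: contp.
move=> [/andP[s0 s1] sT pe [xe ye pe']].
have := @shifted_energy_le Tm rho e s T0 rho0 (ltW e0) s0 s1 sT h1 h2 h3 h4.
have pom i t : 0 <= t -> t <= s -> `|p i t| <= e.
  move=> t0 ts; have := pe i t; rewrite (mem_p0 (es_mem ES i) (lexx 0)) !sub0r !normrN ger0_norm//.
  exact.
move=> /(_ pom).
have mv (f : R -> R) : continuous f -> (forall u, `|Tm - u| <= s -> `|f Tm ^+ 2 - f u ^+ 2| <= e) ->
    s ^+ 2 * (f Tm ^+ 2 - e) <= (prim f Tm - prim f (Tm - s)) ^+ 2.
  move=> cf fe; have Ts : Tm - s < Tm by rewrite gtrBl.
  have [||u] := @MVT R (prim f) f (Tm - s) Tm Ts.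
  - by move=> u; rewrite in_itv/= => /andP[u0 _]; apply: prim_deri => //; lra.
  - apply: continuous_in_subspaceT => u; rewrite inE/= in_itv/= => /andP[u0 _].
    by apply: deri_cont (prim_deri cf _); lra.
  rewrite in_itv/= => /andP[u1 u2] ->; rewrite (_ : Tm - (Tm - s) = s); last by ring.
  rewrite exprMn mulrC ler_wpM2r ?sqr_ge0//.
  have /fe : `|Tm - u| <= s by rewrite ger0_norm; lra.
  by rewrite ler_norml => /andP[_]; lra.
move=> hG.
have : s ^+ 2 * \sum_i (x i Tm ^+ 2 + y i Tm ^+ 2 + p i Tm ^+ 2 - 3 * e) <=
   s ^+ 2 * (n * (3 * (1 + Tm) ^+ 2 * rho ^+ 2 / energy_coef ^+ 2 + 2 * e * rho / energy_coef)).
  apply: le_trans hG; rewrite mulr_sumr; apply: ler_sum => i _.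
  have := mv (x i) (es_contx ES (i:=i)) (xe i).
  have := mv (y i) (es_conty ES (i:=i)) (ye i).
  have := mv (p i) (contp i) (pe' i).
  by rewrite !(mulrBr, mulrDr); move: (prim _ _ - _) (prim _ _ - _) (prim _ _ - _) => ? ? ?; lra.
rewrite ler_pM2l ?exprn_gt0// sumrB sumr_const -mulr_natl -/n => hfin.
have -> : A = n * (3 * (1 + Tm) ^+ 2 * rho ^+ 2 / energy_coef ^+ 2) by rewrite /A /n; ring.
have eB : e * B <= d.
  rewrite /e mulrAC ler_pdivrMr ?ltr_wpDl// ler_pM2l// lerDl//.
have e1 : e * B = n * (2 * e * rho / energy_coef) + n * (3 * e) by rewrite /B; ring.
by move: hfin eB; rewrite e1 mulrDr; lra.
Unshelve. all: by end_near. Qed.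

End Energy.

(** * Polynomials on the reference cell *)

Section ReferenceBasis.
Context {R : realType}.
Local Notation mu := (@lebesgue_measure R).
Implicit Types (p q : {poly R}).

(** The formal antiderivative vanishing at 0: inner products on [0, 1] become
    algebraic expressions in the coefficients. *)
Definition primp p : {poly R} :=
  \poly_(i < (size p).+1) (if i is j.+1 then p`_j / j.+1%:R else 0).

Lemma coef_primp p i : (primp p)`_i = if i is j.+1 then p`_j / j.+1%:R else 0.
Proof.
rewrite coef_poly; case: i => [|j] /=; first by [].
by rewrite ltnS; case: ltnP => // h; rewrite nth_default// mul0r.
Qed.

Lemma deriv_primp p : (primp p)^`() = p.
Proof. by apply/polyP => i; rewrite coef_deriv coef_primp /= -[LHS]mulr_natr divfK// pnatr_eq0. Qed.

Lemma primpD p q : primp (p + q) = primp p + primp q.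
Proof. by apply/polyP => -[|i]; rewrite coefD !coef_primp ?addr0// coefD mulrDl. Qed.

Lemma primpZ c p : primp (c *: p) = c *: primp p.
Proof. by apply/polyP => -[|i]; rewrite coefZ !coef_primp ?mulr0// coefZ mulrA. Qed.

Lemma primp0 p : (primp p).[0] = 0.
Proof. by rewrite horner_coef0 coef_primp. Qed.

Definition pint p : R := (primp p).[1].

Lemma pintD p q : pint (p + q) = pint p + pint q.
Proof. by rewrite /pint primpD hornerD. Qed.

Lemma pintZ c p : pint (c *: p) = c * pint p.
Proof. by rewrite /pint primpZ hornerZ. Qed.

Lemma pint0 : pint 0 = 0.
Proof. by rewrite -(scale0r 0) pintZ mul0r. Qed.

Lemma pintN p : pint (- p) = - pint p.
Proof. by rewrite -scaleN1r pintZ mulN1r. Qed.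

Lemma pint_sum (I : Type) (r : seq I) (P : pred I) (f : I -> {poly R}) :
  pint (\sum_(i <- r | P i) f i) = \sum_(i <- r | P i) pint (f i).
Proof. exact: (big_morph pint pintD pint0). Qed.

Lemma horner_deri p (x : R) : is_derive x 1 (horner p) (p^`()).[x].
Proof.
have h := @derivable_horner R p x; apply: (is_derive_eq (derivable_deri h)).
by rewrite -derivE.
Qed.

Lemma horner_cont p : continuous (horner p).
Proof. by move=> x; exact: deri_cont (horner_deri p x). Qed.

Lemma poly_eq0_itv p : (forall x : R, 0 <= x -> x <= 1 -> p.[x] = 0) -> p = 0.
Proof.
move=> p0; apply: (@roots_geq_poly_eq0 _ p [seq (i.+1%:R)^-1 | i <- iota 0 (size p)]).
- apply/allP => x /mapP[i _ ->]; apply/rootP; apply: p0; first by rewrite invr_ge0.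
  by rewrite invf_le1// ler1n.
- rewrite map_inj_uniq ?iota_uniq// => i j /invr_inj/eqP.
  by rewrite eqr_nat eqSS => /eqP.
- by rewrite size_map size_iota.
Qed.

Lemma primp_homo p (x y : R) : (forall x : R, 0 <= x -> x <= 1 -> 0 <= p.[x]) ->
  0 <= x -> x <= y -> y <= 1 -> (primp p).[x] <= (primp p).[y].
Proof.
move=> p0 x0 xy y1.
have := @le_increment R (fun=> 0) (horner (primp p)) (fun=> 0) (horner p) x y xy.
rewrite subr0 subr_ge0; apply.
- by apply: continuous_subspaceT => u; exact: cvg_cst.
- by apply: continuous_subspaceT; exact: horner_cont.
- by move=> u _; have := horner_deri (primp p) u; rewrite deriv_primp.
- by move=> u; rewrite in_itv/= => /andP[xu uy]; apply: p0; lra.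
Qed.

Lemma pint_ge0 p : (forall x : R, 0 <= x -> x <= 1 -> 0 <= p.[x]) -> 0 <= pint p.
Proof. by move=> p0; rewrite -(primp0 p); apply: primp_homo. Qed.

Lemma pint_eq0 p : (forall x : R, 0 <= x -> x <= 1 -> 0 <= p.[x]) -> pint p = 0 -> p = 0.
Proof.
move=> p0 pp; have : primp p = 0.
  apply: poly_eq0_itv => x x0 x1; apply/eqP; rewrite eq_le; apply/andP; split.
    by rewrite -pp; apply: primp_homo.
  by rewrite -(primp0 p); apply: primp_homo.
by move=> e; rewrite -(deriv_primp p) e derivC.
Qed.

Definition ip p q := pint (p * q).

Lemma ipC p q : ip p q = ip q p. Proof. by rewrite /ip mulrC. Qed.

Lemma ipBl p p' q : ip (p - p') q = ip p q - ip p' q.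
Proof. by rewrite /ip mulrBl pintD pintN. Qed.

Lemma ipZl c p q : ip (c *: p) q = c * ip p q.
Proof. by rewrite /ip -scalerAl pintZ. Qed.

Lemma ipZr c p q : ip p (c *: q) = c * ip p q.
Proof. by rewrite ipC ipZl ipC. Qed.

Lemma ip_suml (I : Type) (r : seq I) (P : pred I) (f : I -> {poly R}) q :
  ip (\sum_(i <- r | P i) f i) q = \sum_(i <- r | P i) ip (f i) q.
Proof. by rewrite /ip mulr_suml pint_sum. Qed.

Lemma ip_ge0 p : 0 <= ip p p.
Proof. by apply: pint_ge0 => x _ _; rewrite hornerM -expr2 sqr_ge0. Qed.

Lemma ip_eq0 p : ip p p = 0 -> p = 0.
Proof.
move=> h; have /eqP : p * p = 0.
  by apply: pint_eq0 => // x _ _; rewrite hornerM -expr2 sqr_ge0.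
by rewrite mulf_eq0 orbb => /eqP.
Qed.

Definition orthonormal_upto n (L : nat -> {poly R}) :=
  (forall m, (m < n)%N -> size (L m) = m.+1) /\
  (forall m m', (m < n)%N -> (m' < n)%N -> ip (L m) (L m') = (m == m')%:R).

(** Gram-Schmidt on the powers of X. *)
Lemma orthonormal_exists n : exists L, orthonormal_upto n L.
Proof.
elim: n => [|n [L [sL oL]]]; first by exists (fun=> 0); split.
pose s := \sum_(m < n) ip 'X^n (L m) *: L m.
pose q := 'X^n - s.
have ss : (size s <= n)%N.
  apply: leq_trans (size_sum _ _ _) _; apply/bigmax_leqP => m _.
  by apply: leq_trans (size_scale_leq _ _) _; rewrite sL.
have sq : size q = n.+1 by rewrite size_polyDl size_polyXn// size_polyN ltnS.
have q0 : q != 0 by rewrite -size_poly_eq0 sq.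
have oq m : (m < n)%N -> ip q (L m) = 0.
  move=> mn; rewrite ipBl ip_suml (bigD1 (Ordinal mn))//= ipZl oL// eqxx mulr1.
  rewrite big1 ?addr0 ?subrr// => i im; rewrite ipZl oL//.
  by rewrite -(inj_eq val_inj)/= in im; rewrite (negbTE im) mulr0.
have qq : 0 < ip q q.
  by rewrite lt_neqAle ip_ge0 andbT eq_sym; apply: contra q0 => /eqP/ip_eq0 ->.
pose r := Num.sqrt (ip q q).
have r0 : r != 0 by rewrite gt_eqF// sqrtr_gt0.
exists (fun m => if m == n then r^-1 *: q else L m); split.
  move=> m; rewrite ltnS leq_eqVlt => /orP[/eqP ->|mn].
    by rewrite eqxx size_scale ?invr_eq0.
  by rewrite (ltn_eqF mn) sL.
have cases m : (m < n.+1)%N -> m = n \/ (m < n)%N.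
  by rewrite ltnS leq_eqVlt => /orP[/eqP ->|]; [left|right].
move=> m m' /cases[->|mn] /cases[->|m'n].
- rewrite !eqxx ipZl ipZr mulrA -invfM -expr2 sqr_sqrtr ?ip_ge0//.
  by rewrite mulVf ?gt_eqF.
- by rewrite eqxx (ltn_eqF m'n) ipZl oq// mulr0 eq_sym (ltn_eqF m'n).
- by rewrite eqxx (ltn_eqF mn) ipC ipZl oq// mulr0.
- by rewrite (ltn_eqF mn) (ltn_eqF m'n) oL.
Qed.

Section basis.
Variables (k : nat) (L : nat -> {poly R}).
Hypothesis HL : orthonormal_upto k.+1 L.

Lemma orthonormal_span n q : (n <= k.+1)%N -> (size q <= n)%N ->
  q = \sum_(m < n) ip q (L m) *: L m.
Proof.
have [sL oL] := HL.
suff : forall n, (n <= k.+1)%N -> forall q, (size q <= n)%N ->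
    exists c : nat -> R, q = \sum_(m < n) c m *: L m.
  move=> h nk sq; have [c qE] := h n nk q sq.
  rewrite {1}qE; apply: eq_bigr => m _; congr (_ *: _).
  have mk : (m < k.+1)%N by apply: leq_trans nk.
  rewrite qE ip_suml (bigD1 m)//= ipZl oL// eqxx mulr1 big1 ?addr0// => i im.
  rewrite ipZl oL//; last by apply: leq_trans nk.
  by rewrite -(inj_eq val_inj)/= in im; rewrite (negbTE im) mulr0.
elim=> [|{}n IH] nk {}q sq.
  by exists (fun=> 0); rewrite big_ord0; apply/eqP; rewrite -size_poly_leq0.
have sLn := sL n nk.
have ln : lead_coef (L n) != 0 by rewrite lead_coef_eq0 -size_poly_eq0 sLn.
have lE : lead_coef (L n) = (L n)`_n by rewrite lead_coefE sLn.
pose d := q`_n / lead_coef (L n).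
have sqd : (size (q - d *: L n)%R <= n)%N.
  apply/leq_sizeP => j; rewrite leq_eqVlt => /orP[/eqP <-|nj].
    by rewrite coefB coefZ /d lE divfK ?subrr// -lE.
  rewrite coefB coefZ !nth_default ?mulr0 ?subr0//; first by rewrite sLn.
  exact: leq_trans sq nj.
have [c cE] := IH (ltnW nk) _ sqd.
exists (fun m => if m == n then d else c m); rewrite big_ord_recr/= eqxx.
rewrite -[LHS](subrK (d *: L n)) cE; congr (_ + _); apply: eq_bigr => i _.
by rewrite (ltn_eqF (ltn_ord i)).
Qed.

Lemma orthonormal_low m q : (m <= k)%N -> (size q <= m)%N -> ip (L m) q = 0.
Proof.
move=> mk sq; have [sL oL] := HL.
rewrite ipC (orthonormal_span (leqW mk) sq) ip_suml big1// => i _.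
rewrite ipZl oL ?ltnS//; last by rewrite ltnW// (leq_trans (ltn_ord i)).
by rewrite (ltn_eqF (ltn_ord i)) mulr0.
Qed.

(** If [L k] vanished at an end, it would be X q or (X - 1) q with q of degree
    k - 1, orthogonal to [L k]; then the integral of X q^2 or (1 - X) q^2 would
    vanish.  This is the unique solvability of the Gauss-Radau conditions. *)
Lemma top_end_neq0 : (L k).[0] != 0 /\ (L k).[1] != 0.
Proof.
have [sL oL] := HL; have sk := sL k (ltnSn k).
have Lk0 : L k != 0 by rewrite -size_poly_eq0 sk.
split; apply/negP => /factor_theorem[q qE].
  have sq : (size q <= k)%N.
    have q0 : q != 0 by apply: contra Lk0 => /eqP q0; rewrite qE q0 mul0r.
    by move: sk; rewrite qE size_Mmonic ?monicXsubC// size_XsubC addn2/= => -[->].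
  have h := orthonormal_low (leqnn k) sq.
  have : q * q * 'X = 0.
    apply: pint_eq0.
      by move=> x x0 _; rewrite !hornerM hornerX mulr_ge0// -expr2 sqr_ge0.
    by rewrite -h /ip qE subr0; congr pint; ring.
  move/eqP; rewrite !mulf_eq0 polyX_eq0 orbF orbb => /eqP q0.
  by move: Lk0; rewrite qE q0 mul0r eqxx.
have sq : (size q <= k)%N.
  have q0 : q != 0 by apply: contra Lk0 => /eqP q0; rewrite qE q0 mul0r.
  by move: sk; rewrite qE size_Mmonic ?monicXsubC// size_XsubC addn2/= => -[->].
have h := orthonormal_low (leqnn k) sq.
have : q * q * (1 - 'X) = 0.
  apply: pint_eq0.
    move=> x _ x1; rewrite !hornerM hornerD hornerN hornerX hornerC mulr_ge0//.
      by rewrite -expr2 sqr_ge0.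
    by rewrite subr_ge0.
  have -> : q * q * (1 - 'X) = - (L k * q) by rewrite qE; ring.
  by rewrite pintN -/(ip _ _) h oppr0.
move/eqP; rewrite !mulf_eq0 orbb => /orP[/eqP q0|].
  by move: Lk0; rewrite qE q0 mul0r eqxx.
by rewrite -opprB oppr_eq0 polyXsubC_eq0.
Qed.

End basis.

Lemma poly_bounded p : exists2 B : R, 0 <= B & forall x : R, 0 <= x -> x <= 1 -> `|p.[x]| <= B.
Proof.
have cp : {within `[0 : R, 1], continuous (fun x => `|p.[x]|)}.
  apply: continuous_subspaceT => x; apply: continuous_comp; first exact: horner_cont.
  exact: norm_continuous.
have [u _ Hu] := EVT_max ler01 cp.
by exists `|p.[u]| => // x x0 x1; apply: Hu; rewrite in_itv/= x0.
Qed.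

End ReferenceBasis.

(** * Projections on one cell *)

Section Cell.
Context {R : realType}.
Local Notation mu := (@lebesgue_measure R).
Implicit Types (p q : {poly R}) (f g : R -> R) (a b x : R).

Lemma contw_intg f a b : {within `[a, b], continuous f} ->
  mu.-integrable `[a, b] (fun x => (f x)%:E).
Proof. by move=> cf; exact: cont_itv_integrable. Qed.

Lemma contwM f g a b : {within `[a, b], continuous f} -> {within `[a, b], continuous g} ->
  {within `[a, b], continuous (fun x => f x * g x)}.
Proof. by move=> cf cg x; apply: continuousM; [exact: cf|exact: cg]. Qed.

Lemma contwB f g a b : {within `[a, b], continuous f} -> {within `[a, b], continuous g} ->
  {within `[a, b], continuous (fun x => f x - g x)}.
Proof. by move=> cf cg x; apply: continuousB; [exact: cf|exact: cg]. Qed.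

Lemma contwZ c f a b : {within `[a, b], continuous f} ->
  {within `[a, b], continuous (fun x => c * f x)}.
Proof. by move=> cf x; apply: continuousM; [exact: cvg_cst|exact: cf]. Qed.

Lemma contw_poly p a b : {within `[a, b], continuous (horner p)}.
Proof. by apply: continuous_subspaceT; exact: horner_cont. Qed.

Lemma contw_fpoly f p a b : {within `[a, b], continuous f} ->
  {within `[a, b], continuous (fun x => f x * p.[x])}.
Proof. by move=> cf; apply: contwM => //; exact: contw_poly. Qed.

Lemma Rint_le_cst f a b (B : R) : a < b -> {within `[a, b], continuous f} ->
  (forall x, x \in `[a, b] -> `|f x| <= B) ->
  `|\int[mu]_(x in `[a, b]) f x| <= B * (b - a).
Proof.
move=> ab cf fB; have fi := contw_intg cf.
apply: (le_trans (le_normr_Rintegral _ fi)) => //.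
apply: (@le_trans _ _ (\int[mu]_(x in `[a, b]) B)).
  apply: le_Rintegral => //.
  - exact: intg_norm.
  - by apply: contw_intg; apply: continuous_subspaceT => x; exact: cvg_cst.
by rewrite Rintegral_cst//= lebesgue_measure_itv/= lte_fin ab -EFinD.
Qed.

Lemma poly_integral (F f : {poly R}) a b : a < b -> F^`() = f ->
  \int[mu]_(x in `[a, b]) f.[x] = F.[b] - F.[a].
Proof.
move=> ab Ff; rewrite /Rintegral (@continuous_FTC2 R (horner f) (horner F) a b ab).
- by [].
- exact: contw_poly.
- split.
  + by move=> x _; exact: derivable_horner.
  + by apply: cvg_at_right_filter; exact: horner_cont.
  + by apply: cvg_at_left_filter; exact: horner_cont.
- by move=> x _; rewrite -derivE Ff.
Qed.

(** The affine map of the cell [a, b] onto [0, 1], and its inverse. *)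
Definition aff a b : {poly R} := (b - a)^-1 *: ('X - a%:P).
Definition affinv a b : {poly R} := (b - a) *: 'X + a%:P.

Lemma affE a b x : (aff a b).[x] = (x - a) / (b - a).
Proof. by rewrite /aff hornerZ hornerD hornerN hornerX hornerC mulrC. Qed.

Lemma deriv_aff a b : (aff a b)^`() = ((b - a)^-1)%:P.
Proof. by rewrite /aff derivZ derivB derivX derivC subr0 -alg_polyC. Qed.

Lemma aff_itv a b x : a < b -> x \in `[a, b] -> 0 <= (aff a b).[x] /\ (aff a b).[x] <= 1.
Proof.
move=> ab; rewrite in_itv/= affE => /andP[ax xb].
have ba : 0 < b - a by rewrite subr_gt0.
by rewrite divr_ge0 ?subr_ge0 ?(ltW ab)// ler_pdivrMr// mul1r lerD2r.
Qed.

Lemma aff_affinv a b : a < b -> affinv a b \Po aff a b = 'X.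
Proof.
move=> ab; have ba : b - a != 0 by rewrite subr_eq0 gt_eqF.
by rewrite /affinv comp_polyD comp_polyZ comp_polyX comp_polyC /aff scalerA divff// scale1r subrK.
Qed.

Lemma size_affinv a b : a < b -> size (affinv a b) = 2%N.
Proof.
move=> ab; have ba : b - a != 0 by rewrite subr_eq0 gt_eqF.
rewrite /affinv size_polyDl size_scale ?size_polyX//.
by rewrite ltnS size_polyC_leq1.
Qed.

Lemma size_aff a b : a < b -> size (aff a b) = 2%N.
Proof.
move=> ab; have ba : b - a != 0 by rewrite subr_eq0 gt_eqF.
by rewrite /aff size_scale ?invr_eq0// size_XsubC.
Qed.

Lemma cell_pint a b q : a < b ->
  \int[mu]_(x in `[a, b]) (q \Po aff a b).[x] = (b - a) * pint q.
Proof.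
move=> ab; have ba : b - a != 0 by rewrite subr_eq0 gt_eqF.
rewrite (@poly_integral ((b - a) *: (primp q \Po aff a b)))//.
  rewrite !hornerZ !horner_comp !affE subrr mul0r divff// primp0 mulr0 subr0 //.
rewrite derivZ deriv_comp deriv_primp deriv_aff mulrC mul_polyC scalerA divff// scale1r//.
Qed.

Section basis.
Variables (k : nat) (L : nat -> {poly R}).
Hypothesis HL : orthonormal_upto k.+1 L.
Variables a b : R.
Hypothesis ab : a < b.

Definition bas m : {poly R} := L m \Po aff a b.

(** Normalized by the length of the cell, because the basis is orthonormal on the
    reference cell. *)
Definition coef f m : R := (b - a)^-1 * \int[mu]_(x in `[a, b]) (f x * (bas m).[x]).

Lemma basE m x : (bas m).[x] = (L m).[(x - a) / (b - a)].
Proof. by rewrite /bas horner_comp affE. Qed.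

Lemma bas_left m : (bas m).[a] = (L m).[0].
Proof. by rewrite basE subrr mul0r. Qed.

Lemma bas_right m : (bas m).[b] = (L m).[1].
Proof. by rewrite basE divff// subr_eq0 gt_eqF. Qed.

Lemma size_bas m : (m <= k)%N -> size (bas m) = m.+1.
Proof.
by move=> mk; rewrite /bas size_comp_poly2 ?size_aff// (HL.1 m).
Qed.

Lemma int_coef f m : \int[mu]_(x in `[a, b]) (f x * (bas m).[x]) = (b - a) * coef f m.
Proof. by rewrite /coef mulrA divff ?mul1r// subr_eq0 gt_eqF. Qed.

Lemma coefD_fun f g m : {within `[a, b], continuous f} -> {within `[a, b], continuous g} ->
  coef (fun x => f x + g x) m = coef f m + coef g m.
Proof.
move=> cf cg; rewrite /coef -mulrDr; congr (_ * _).
rewrite -RintegralD//; [|by apply: contw_intg; exact: contw_fpoly..].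
by apply: Rint_eq => x _; rewrite mulrDl.
Qed.

Lemma coefB_fun f g m : {within `[a, b], continuous f} -> {within `[a, b], continuous g} ->
  coef (fun x => f x - g x) m = coef f m - coef g m.
Proof.
move=> cf cg; rewrite /coef -mulrBr; congr (_ * _).
rewrite -RintegralB//; [|by apply: contw_intg; exact: contw_fpoly..].
by apply: Rint_eq => x _; rewrite mulrBl.
Qed.

Lemma coefZ_fun c f m : {within `[a, b], continuous f} ->
  coef (fun x => c * f x) m = c * coef f m.
Proof.
move=> cf; rewrite /coef mulrCA; congr (_ * _).
rewrite -RintegralZl//; last by apply: contw_intg; exact: contw_fpoly.
by apply: Rint_eq => x _; rewrite mulrA.
Qed.

Lemma coef_bas n m : (n <= k)%N -> (m <= k)%N -> coef (horner (bas n)) m = (n == m)%:R.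
Proof.
move=> nk mk; rewrite /coef.
rewrite (@Rint_eq _ _ _ (fun x => ((L n * L m) \Po aff a b).[x])); last first.
  by move=> x _; rewrite -hornerM /bas -comp_polyM.
have ba : b - a != 0 by rewrite subr_eq0 gt_eqF.
by rewrite (cell_pint _ ab) mulKf// -/(ip _ _) (HL.2 n m).
Qed.

Lemma poly_bas q : (size q <= k.+1)%N ->
  q = \sum_(m < k.+1) coef (horner q) m *: bas m.
Proof.
move=> sq; pose q' := q \Po affinv a b.
have qE : q = q' \Po aff a b by rewrite /q' -comp_polyA aff_affinv// comp_polyXr.
have sq' : (size q' <= k.+1)%N by rewrite /q' size_comp_poly2 ?size_affinv.
rewrite {1}qE {1}(orthonormal_span HL (leqnn _) sq') raddf_sum/=; apply: eq_bigr => m _.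
rewrite comp_polyZ; congr (_ *: _); rewrite /coef.
rewrite (@Rint_eq _ _ _ (fun x => ((q' * L m) \Po aff a b).[x])); last first.
  by move=> x _; rewrite {1}qE -hornerM /bas -comp_polyM.
by rewrite (cell_pint _ ab) mulKf ?subr_eq0 ?gt_eqF.
Qed.

Lemma bas_deriv_int n m : \int[mu]_(x in `[a, b]) ((bas n).[x] * (bas m)^`().[x]) = pint (L n * (L m)^`()).
Proof.
have ba : b - a != 0 by rewrite subr_eq0 gt_eqF.
rewrite (@Rint_eq _ _ _ (fun x => (b - a)^-1 * ((L n * (L m)^`()) \Po aff a b).[x])); last first.
  move=> x _; rewrite -hornerM /bas deriv_comp deriv_aff comp_polyM !hornerM hornerC.
  by rewrite mulrA mulrC.
rewrite RintegralZl//; last by apply: contw_intg; exact: contw_poly.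
by rewrite (cell_pint _ ab) mulKf.
Qed.

Lemma coef_ext f g m : {in `[a, b], f =1 g} -> coef f m = coef g m.
Proof.
by move=> fg; rewrite /coef; congr (_ * _); apply: Rint_eq => x /= xab; rewrite fg.
Qed.

Lemma coef_sum_fun (c : nat -> R) m : (m <= k)%N ->
  coef (fun x => \sum_(n < k.+1) c n * (bas n).[x]) m = c m.
Proof.
move=> mk; rewrite /coef.
have -> : \int[mu]_(x in `[a, b]) ((\sum_(n < k.+1) c n * (bas n).[x]) * (bas m).[x])
   = \sum_(n < k.+1) c n * ((b - a) * coef (horner (bas n)) m).
  rewrite (@Rint_eq _ _ _ (fun x => \sum_(n < k.+1) c n * ((bas n).[x] * (bas m).[x]))); last first.
    by move=> x _; rewrite mulr_suml; apply: eq_bigr => n _; rewrite mulrA.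
  rewrite Rint_sum//.
    apply: eq_bigr => n _; rewrite RintegralZl ?int_coef//.
    by apply: contw_intg; apply: contw_fpoly; exact: contw_poly.
  move=> n _; apply: contw_intg; apply: contwZ; apply: contw_fpoly; exact: contw_poly.
rewrite (bigD1 (Ordinal (mk : (m < k.+1)%N)))//= coef_bas// eqxx mulr1 big1 ?addr0.
  by rewrite mulrCA mulVf ?mulr1// subr_eq0 gt_eqF.
move=> i im; rewrite coef_bas//; last by rewrite -ltnS.
by rewrite -(inj_eq val_inj)/= in im; rewrite (negbTE im) !mulr0.
Qed.

Lemma bas_parseval (c : nat -> R) :
  \int[mu]_(x in `[a, b]) (\sum_(n < k.+1) c n * (bas n).[x]) ^+ 2 =
  (b - a) * \sum_(n < k.+1) c n ^+ 2.
Proof.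
have cs : {within `[a, b], continuous (fun x => \sum_(n < k.+1) c n * (bas n).[x])}.
  apply: continuous_subspaceT => x; apply: cont_sum => i _; apply: contZ; exact: horner_cont.
rewrite (@Rint_eq _ _ _ (fun x => \sum_(m < k.+1)
    c m * ((\sum_(n < k.+1) c n * (bas n).[x]) * (bas m).[x]))); last first.
  move=> x _; rewrite expr2 mulr_sumr; apply: eq_bigr => m _; ring.
rewrite Rint_sum//.
  rewrite mulr_sumr; apply: eq_bigr => m _; rewrite RintegralZl//.
    have mk : (m <= k)%N by rewrite -ltnS.
    by rewrite int_coef (coef_sum_fun _ mk) mulrCA expr2.
  by apply: contw_intg; exact: contw_fpoly.
by move=> m _; apply: contw_intg; apply: contwZ; exact: contw_fpoly.
Qed.

Variable Lam : R.
Hypothesis Lam_ge : forall m x, (m <= k)%N -> 0 <= x -> x <= 1 -> `|(L m).[x]| <= Lam.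

Lemma bas_le m x : (m <= k)%N -> x \in `[a, b] -> `|(bas m).[x]| <= Lam.
Proof. by move=> mk xab; have [h1 h2] := aff_itv ab xab; rewrite basE -affE; exact: Lam_ge. Qed.

Lemma coef_le f m (B : R) : (m <= k)%N -> {within `[a, b], continuous f} ->
  (forall x, x \in `[a, b] -> `|f x| <= B) -> `|coef f m| <= B * Lam.
Proof.
move=> mk cf fB; have ba : 0 < b - a by rewrite subr_gt0.
rewrite /coef normrM gtr0_norm ?invr_gt0// ler_pdivrMl// mulrC.
apply: Rint_le_cst => //; first exact: contw_fpoly.
by move=> x xab; rewrite normrM; apply: ler_pM => //; [exact: fB|exact: bas_le].
Qed.

Definition l2res f x := f x - \sum_(m < k.+1) coef f m * (bas m).[x].

Definition res_const : R := 1 + k.+1%:R * Lam ^+ 2.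

Lemma l2res_le f q (B : R) : (size q <= k.+1)%N -> {within `[a, b], continuous f} ->
  (forall x, x \in `[a, b] -> `|f x - q.[x]| <= B) ->
  forall x, x \in `[a, b] -> `|l2res f x| <= res_const * B.
Proof.
move=> sq cf fB x xab.
have Lam0 : 0 <= Lam by apply: le_trans (Lam_ge (leq0n k) (lexx 0) ler01).
have B0 : 0 <= B by apply: le_trans (fB x xab).
have -> : l2res f x = (f x - q.[x]) - \sum_(m < k.+1) coef (fun x => f x - q.[x]) m * (bas m).[x].
  have qx : q.[x] = \sum_(m < k.+1) coef (horner q) m * (bas m).[x].
    rewrite {1}(poly_bas sq) horner_sum; apply: eq_bigr => m _; exact: hornerZ.
  have cB m : coef (fun x => f x - q.[x]) m = coef f m - coef (horner q) m.
    by apply: coefB_fun => //; exact: contw_poly.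
  rewrite (eq_bigr (fun m : 'I_k.+1 => coef f m * (bas m).[x] - coef (horner q) m * (bas m).[x])); last first.
    by move=> m _; rewrite cB mulrBl.
  by rewrite sumrB -qx opprB /l2res; set S := \sum_(_ < _) _; ring.
apply: (le_trans (ler_normB _ _)); rewrite /res_const mulrDl mul1r; apply: lerD; first exact: fB.
apply: (le_trans (ler_norm_sum _ _ _)).
apply: (@le_trans _ _ (\sum_(m < k.+1) (B * Lam * Lam))).
  apply: ler_sum => m _; rewrite normrM; apply: ler_pM => //; last by apply: bas_le; rewrite // -ltnS.
  apply: coef_le => //; first by rewrite -ltnS.
  by apply: contwB => //; exact: contw_poly.
by rewrite sumr_const card_ord -[leLHS]mulr_natl (_ : B * Lam * Lam = Lam ^+ 2 * B) ?mulrA//; ring.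
Qed.

(** The multiple of the top basis function that has to be added to the L2
    projection of f to make it exact at c ([radau_coef]). *)
Definition end_res c f : R := l2res f c / (bas k).[c].

Lemma end_res_le c f q (B : R) : c \in `[a, b] -> (size q <= k.+1)%N ->
  {within `[a, b], continuous f} -> (forall x, x \in `[a, b] -> `|f x - q.[x]| <= B) ->
  `|end_res c f| <= res_const / `|(bas k).[c]| * B.
Proof.
move=> cab sq cf fB; rewrite /end_res normrM normfV mulrAC.
by rewrite ler_wpM2r ?invr_ge0//; exact: (l2res_le sq).
Qed.

Lemma l2proj_coef f q : {within `[a, b], continuous f} ->
  (forall v : {poly R}, (size v <= k.+1)%N ->
     \int[mu]_(x in `[a, b]) ((q.[x] - f x) * v.[x]) = 0) ->
  forall m, (m <= k)%N -> coef (horner q) m = coef f m.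
Proof.
move=> cf qf m mk; apply/eqP; rewrite -subr_eq0 -coefB_fun//; last exact: contw_poly.
by rewrite /coef qf ?mulr0// size_bas.
Qed.

(** The moments of degree less than k determine all coordinates but the top one,
    which is then determined by the value at c. *)
Lemma radau_coef c f q : (bas k).[c] != 0 -> {within `[a, b], continuous f} ->
  (size q <= k.+1)%N ->
  (forall v : {poly R}, (size v <= k)%N ->
     \int[mu]_(x in `[a, b]) ((q.[x] - f x) * v.[x]) = 0) ->
  q.[c] = f c ->
  forall m, (m <= k)%N -> coef (horner q) m = coef f m + (m == k)%:R * end_res c f.
Proof.
move=> Lc cf sq qf qc.
have low m : (m < k)%N -> coef (horner q) m = coef f m.
  move=> mk; apply/eqP; rewrite -subr_eq0 -coefB_fun//; last exact: contw_poly.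
  by rewrite /coef qf ?mulr0// size_bas// ltnW.
move=> m; rewrite leq_eqVlt => /orP[/eqP ->|mk]; last first.
  by rewrite low// (ltn_eqF mk) mul0r addr0.
rewrite eqxx mul1r; apply: (mulIf Lc); rewrite /end_res mulrDl divfK// /l2res -qc {2}(poly_bas sq).
rewrite horner_sum !big_ord_recr/= hornerZ.
rewrite [X in _ = _ + (X + _ - _)](_ : _ = \sum_(i < k) coef f i * (bas i).[c]).
  by set S := \sum_(_ < _) _; ring.
by apply: eq_bigr => i _; rewrite hornerZ low.
Qed.

End basis.

(** Taylor expansion at a, by induction on the order: q is the antiderivative of
    the polynomial approximating g 1. *)
Lemma poly_approx n (g : nat -> R -> R) a b (B : R) : a < b ->
  (forall i, (i <= n)%N -> {within `[a, b], continuous (g i)}) ->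
  (forall i x, (i < n)%N -> x \in `]a, b[ -> is_derive x 1 (g i) (g i.+1 x)) ->
  (forall x, x \in `[a, b] -> `|g n x| <= B) ->
  exists2 q : {poly R}, (size q <= n)%N &
    forall x, x \in `[a, b] -> `|g 0%N x - q.[x]| <= B * (b - a) ^+ n.
Proof.
move=> ab; elim: n g => [|n IH] g cg dg gB.
  by exists 0; rewrite ?size_poly0// => x xab; rewrite horner0 subr0 expr0 mulr1 gB.
have [|||q1 sq1 hq1] := IH (fun i => g i.+1).
- by move=> i ni; exact: cg.
- by move=> i x ni; exact: dg.
- by [].
have B0 : 0 <= B by apply: le_trans (gB a _); rewrite ?in_itv/= ?lexx ?(ltW ab).
pose q := primp q1 + (g 0%N a - (primp q1).[a])%:P.
have hq x : q.[x] = (primp q1).[x] + (g 0%N a - (primp q1).[a]).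
  by rewrite /q hornerD hornerC.
exists q.
  rewrite (leq_trans (size_polyD _ _))// geq_max; apply/andP; split.
    by apply: leq_trans (size_poly _ _) _; rewrite ltnS.
  by apply: leq_trans (size_polyC_leq1 _) _.
move=> x xab; have := xab; rewrite in_itv/= => /andP[ax xb].
have sub : `[a, x] `<=` `[a, b].
  by move=> y /=; rewrite !in_itv/= => /andP[-> yx]; rewrite (le_trans yx).
have ba : 0 <= b - a by rewrite subr_ge0 ltW.
have qa : q.[a] = g 0%N a by rewrite hq addrC subrK.
have -> : g 0%N x - q.[x] = (g 0%N x - q.[x]) - (g 0%N a - q.[a]) by rewrite qa subrr subr0.
apply: (le_trans (@lipschitz_increment R (fun x => g 0%N x - q.[x]) (fun x => g 1%N x - q1.[x])
  (B * (b - a) ^+ n) a x ax _ _ _)).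
- apply: continuous_subspaceW sub _; apply: contwB; [exact: cg|exact: contw_poly].
- move=> y; rewrite in_itv/= => /andP[ay yx]; apply: deriB.
    by apply: dg; rewrite // in_itv/= ay (lt_le_trans yx).
  have := horner_deri q y; rewrite /q derivD derivC addr0 deriv_primp.
  by [].
- move=> y; rewrite in_itv/= => /andP[ay yx]; apply: hq1.
  by rewrite in_itv/= (ltW ay) (le_trans (ltW yx)).
rewrite exprSr mulrA ler_wpM2l ?lerD2r// mulr_ge0// exprn_ge0//.
Qed.
End Cell.

(** * Jointly continuous functions and smooth fields *)

Section ExactFields.
Context {R : realType}.
Local Notation mu := (@lebesgue_measure R).
Local Notation mR := (measurableTypeR R).
Implicit Types (a b x t xl xr : R).

(** Joint continuity for curried functions. *)
Definition jcont (F : R -> R -> R) := continuous (fun p : R * R => F p.1 p.2).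

Lemma jcont_comp (T : topologicalType) F (f g : T -> R) (x : T) : jcont F ->
  {for x, continuous f} -> {for x, continuous g} ->
  {for x, continuous (fun y => F (f y) (g y))}.
Proof. by move=> cF cf cg; apply: continuous2_cvg cf cg; exact: cF (f x, g x). Qed.

Lemma jcont_l F t : jcont F -> continuous (F ^~ t).
Proof. by move=> cF x; apply: (@jcont_comp _ F id (fun=> t)) => //; exact: cvg_cst. Qed.

Lemma jcont_r F x : jcont F -> continuous (F x).
Proof. by move=> cF t; apply: (@jcont_comp _ F (fun=> x) id) => //; exact: cvg_cst. Qed.

Lemma jcont_bounded F a b s t : jcont F ->
  exists2 B : R, 0 <= B & forall x u, a <= x -> x <= b -> s <= u -> u <= t -> `|F x u| <= B.
Proof.
move=> cF.
have cK : compact ((`[a, b]%classic `*` `[s, t]%classic) : set (R * R)).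
  by apply: compact_setX; exact: segment_compact.
have : compact ((fun p : R * R => F p.1 p.2) @` (`[a, b]%classic `*` `[s, t]%classic)).
  by apply: continuous_compact => //; exact: continuous_subspaceT.
move=> /compact_bounded[N [_ hN]].
exists `|N + 1| => // x u ax xb su ut.
have N1 : N < `|N + 1| by apply: (lt_le_trans _ (ler_norm _)); rewrite ltrDl.
apply: (hN _ N1 (F x u)); exists (x, u) => //=; split => /=; rewrite in_itv/=; exact/andP.
Qed.

Lemma clamp_cont (A : set (R * R)) (F : R -> R -> R) (f : R * R -> R * R) :
  {within A, continuous (fun p : R * R => F p.1 p.2)} ->
  continuous f -> (forall p, A (f p)) -> continuous (fun p => F (f p).1 (f p).2).
Proof.
move=> cF cf Af p; have /subspace_continuousP cF' := cF.
apply: (@cvg_comp _ _ _ f (fun p : R * R => F p.1 p.2) (nbhs p) (within A (nbhs (f p)))).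
  by move=> U /= hU; have := cf p _ hU; rewrite /= /nbhs/=; apply: filterS => q; apply.
exact: cF'.
Qed.

(** Rounding the first variable down to a multiple of 1 / (n + 1) gives functions
    that are measurable piece by piece and converge to F. *)
Lemma jcont_measurable F : jcont F ->
  measurable_fun setT (fun p : mR * mR => F p.1 p.2).
Proof.
move=> cF.
pose r n (x : R) : R := (Num.floor (n.+1%:R * x))%:~R / n.+1%:R.
apply: (@measurable_fun_cvg _ _ _ setT (fun n (p : mR * mR) => F (r n p.1) p.2)).
  move=> n _ Y mY; rewrite setTI.
  rewrite [X in measurable X](_ : _ = \bigcup_(z in [set: int])
     ([set x | Num.floor (n.+1%:R * x) = z] `*` (F (z%:~R / n.+1%:R) @^-1` Y))).
    apply: countable_bigcupT_measurable; first exact: countableP.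
    move=> z; apply: measurableX.
      rewrite [X in measurable X](_ : _ = `[z%:~R / n.+1%:R, (z + 1)%:~R / n.+1%:R[%classic) ?measurable_itv//.
      apply/seteqP; split => x /=; rewrite in_itv/= ler_pdivrMr// ltr_pdivlMr// [x * _]mulrC.
        by move=> <-; exact: floor_itv.
      exact: floor_def.
    by rewrite -[X in measurable X]setTI; apply: continuous_measurable_fun => //; exact: jcont_r.
  apply/seteqP; split => [[x t]/= h|[x t] [z _ [/= <-]]] //.
  by exists (Num.floor (n.+1%:R * x)).
move=> [x t] _ /=.
apply: (@cvg_comp _ _ _ (fun n => r n x) (F ^~ t) _ (nbhs x)); last exact: jcont_l.
apply/cvgrPdist_le => /= e e0; near=> n.
have n0 : (0 : R) < n.+1%:R by [].
have /andP[h1 h2] := floor_itv (n.+1%:R * x).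
have h : n.+1%:R * (x - r n x) = n.+1%:R * x - (Num.floor (n.+1%:R * x))%:~R.
  by rewrite /r mulrBr mulrCA divff ?mulr1// gt_eqF.
have hx : 0 <= n.+1%:R * (x - r n x) by rewrite h; lra.
have hx1 : n.+1%:R * (x - r n x) <= 1 by rewrite h; move: h2; rewrite intrD; lra.
rewrite ger0_norm; last by rewrite -(pmulr_rge0 _ n0).
apply: (@le_trans _ _ n.+1%:R^-1); first by rewrite -[leRHS]mulr1 ler_pdivlMl.
by apply: ltW; near: n; exact: (near_infty_natSinv_lt (PosNum e0)).
Unshelve. all: by end_near. Qed.

Lemma max_cont (c : R) : continuous (fun x : R => Num.max c x).
Proof.
by move=> x; apply: (@continuous2_cvg _ _ _ _ _ _ (fun=> c) id Num.max c x);
  [exact: max_continuous (c, x)|exact: cvg_cst|exact: cvg_id].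
Qed.

Lemma min_cont (c : R) : continuous (fun x : R => Num.min c x).
Proof.
by move=> x; apply: (@continuous2_cvg _ _ _ _ _ _ (fun=> c) id Num.min c x);
  [exact: min_continuous (c, x)|exact: cvg_cst|exact: cvg_id].
Qed.

Lemma jcont_int F a b : jcont F -> continuous (fun t => \int[mu]_(x in `[a, b]) F x t).
Proof.
move=> cF t.
have [B B0 hB] := jcont_bounded a b (t - 1) (t + 1) cF.
have tI : t \in (`]t - 1, t + 1[%classic : set R).
  by rewrite inE/= in_itv/=; apply/andP; split; lra.
apply: (@continuity_under_integral R _ mR mu (fun t x => F x t) `[a, b] _ (t - 1) (t + 1) _ _ (fun=> B)).
- exact: measurable_itv.
- by move=> u _; apply: cont_itv_integrable; apply: continuous_subspaceT; exact: jcont_l.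
- by apply/aeW => x _ u _; exact: jcont_r.
- by apply: cont_itv_integrable; apply: continuous_subspaceT => x; exact: cvg_cst.
- move=> u /=; rewrite in_itv/= => /andP[u1 u2]; apply/aeW => x; rewrite /= in_itv/= => /andP[ax xb].
  by apply: hB => //; exact: ltW.
- exact: tI.
Qed.

Lemma jcont_int_deri F dF a b t u v : jcont F -> jcont dF -> t \in `]u, v[ ->
  (forall x s, x \in `[a, b] -> s \in `]u, v[ -> is_derive s 1 (F x) (dF x s)) ->
  is_derive t 1 (fun t => \int[mu]_(x in `[a, b]) F x t) (\int[mu]_(x in `[a, b]) dF x t).
Proof.
move=> cF cdF tuv hd.
have [B B0 hB] := jcont_bounded a b u v cdF.
have h1 x : x \in `]u, v[ -> mu.-integrable `[a, b] (fun y => (F y x)%:E).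
  by move=> _; apply: cont_itv_integrable; apply: continuous_subspaceT; exact: jcont_l.
have h2 : mu.-integrable `[a, b] (fun=> B%:E).
  by apply: cont_itv_integrable; apply: continuous_subspaceT => x; exact: cvg_cst.
have h3 s x : s \in `]u, v[ -> `[a, b]%classic x -> `|dF x s| <= B.
  rewrite /= !in_itv/= => /andP[us sv] /andP[ax xb].
  by apply: hB => //; exact: ltW.
have h4 s x : s \in `]u, v[ -> `[a, b]%classic x -> is_derive s 1 ((fun t x => F x t)^~ x) (dF x s).
  by move=> suv xab; exact: hd.
exact (@deri_under_int R `[a, b] (fun t x => F x t) (fun t x => dF x t) (fun=> B) u v t
  (measurable_itv _) tuv h1 h4 h2 h3).
Qed.

Lemma jcont_mul F (g : R -> R) : jcont F -> continuous g -> jcont (fun x t => F x t * g x).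
Proof.
move=> cF cg p; apply: (@continuousM _ _ (fun p : R * R => F p.1 p.2) (fun p => g p.1)).
  exact: cF.
by apply: continuous_comp; [exact: cvg_fst|exact: cg].
Qed.

Lemma jcont_lin F G (c : R) : jcont F -> jcont G -> jcont (fun x t => F x t + c * G x t).
Proof.
move=> cF cG p.
apply: (@continuousD _ _ _ (fun p : R * R => F p.1 p.2) (fun p => c * G p.1 p.2)); first exact: cF.
by apply: (@continuousM _ _ (fun=> c) (fun p : R * R => G p.1 p.2)); [exact: cvg_cst|exact: cG].
Qed.

(** The derivatives of a solution, extended to the whole plane by freezing the
    arguments at the boundary of the domain: all continuity statements become
    global ones. *)
Record smooth_field xl xr n (G : nat -> nat -> R -> R -> R) : Prop := SmoothField {
  sf_cont : forall i j, (i <= n)%N -> (j <= 1)%N -> jcont (G i j);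
  sf_neg : forall i j x t, t <= 0 -> G i j x t = G i j x 0;
  sf_dx : forall i j x t, (i < n)%N -> (j <= 1)%N -> x \in `]xl, xr[ ->
    is_derive x 1 (G i j ^~ t) (G i.+1 j x t);
  sf_dt : forall x t, x \in `[xl, xr] -> 0 < t ->
    is_derive t 1 (G 0%N 0%N x) (G 0%N 1%N x t) }.

Lemma smooth_field_exists xl xr n u : xl < xr -> smooth_class xl xr n 1 u ->
  exists2 G, smooth_field xl xr n G & forall x t, x \in `[xl, xr] -> 0 <= t -> u x t = G 0%N 0%N x t.
Proof.
move=> lr [D [Du cD dxD dtD]].
pose cl x := Num.max xl (Num.min xr x).
have clE x : x \in `[xl, xr] -> cl x = x.
  by rewrite in_itv/= /cl => /andP[h1 h2]; rewrite (min_r h2) (max_r h1).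
have clI x : cl x \in `[xl, xr].
  rewrite in_itv/= /cl le_max lexx/= ge_max (ltW lr)/=.
  by rewrite ge_min lexx.
have ccl : continuous cl.
  move=> x; apply: (@continuous_comp _ _ _ (fun x => Num.min xr x) (fun x => Num.max xl x)).
    exact: min_cont.
  exact: max_cont.
have pos t : 0 <= t -> Num.max 0 t = t by move=> t0; rewrite max_r.
exists (fun i j x t => D i j (cl x) (Num.max 0 t)); last first.
  by move=> x t xlr t0; rewrite clE// pos// Du.
split.
- move=> i j iN j1.
  apply: (@clamp_cont _ (D i j) (fun p => (cl p.1, Num.max 0 p.2)) (cD i j iN j1)).
    move=> p; apply: (@continuous2_cvg _ _ _ _ _ _ (fun p : R * R => cl p.1) (fun p => Num.max 0 p.2) (fun x y => (x, y))).
    + rewrite [X in X @ _](_ : _ = id); first exact: cvg_id.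
      by apply/funext => -[].
    + by apply: continuous_comp; [exact: cvg_fst|exact: ccl].
    + by apply: continuous_comp; [exact: cvg_snd|exact: max_cont].
  move=> p; split => /=; first exact: clI.
  by rewrite in_itv/= le_max lexx.
- by move=> i j x t t0; rewrite max_l// maxxx.
- move=> i j x t iN j1 xlr.
  have := dxD i j x (Num.max 0 t) iN j1 xlr _; rewrite le_max lexx => /(_ isT) h.
  rewrite clE; last exact: subset_itv_oo_cc.
  apply: deri_near h; near=> y; rewrite clE//; apply: subset_itv_oo_cc.
  by near: y; exact: near_in_itvoo.
- move=> x t xlr t0; rewrite clE// (pos t (ltW t0)).
  apply: deri_near (dtD _ _ _ _ (leq0n _) (ltnSn 0) xlr t0).
  near=> s; rewrite pos//; apply: ltW; near: s.
  exact: lt_nbhsr.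
Unshelve. all: by end_near. Qed.
End ExactFields.

(** * Projection coefficients of smooth fields *)

Section FieldCoefficients.
Context {R : realType}.
Local Notation mu := (@lebesgue_measure R).
Local Notation mR := (measurableTypeR R).
Implicit Types (a b c x t s xl xr : R) (F dF : R -> R -> R).
Variables (k : nat) (L : nat -> {poly R}) (Lam : R).
Hypothesis HL : orthonormal_upto k.+1 L.
Hypothesis Lam_ge : forall m x, (m <= k)%N -> 0 <= x -> x <= 1 -> `|(L m).[x]| <= Lam.

Lemma coef_jcont F a b m : jcont F -> continuous (fun t => coef L a b (F ^~ t) m).
Proof.
move=> cF t; apply: contZ.
exact: (@jcont_int _ _ a b (jcont_mul cF (@horner_cont _ (bas L a b m))) t).
Qed.

Lemma jcontw F a b t : jcont F -> {within `[a, b], continuous (F ^~ t)}.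
Proof. by move=> cF; apply: continuous_subspaceT; exact: jcont_l. Qed.

Section time_derivative.
Variables (F dF : R -> R -> R) (a b : R).
Hypotheses (ab : a < b) (cF : jcont F) (cdF : jcont dF).
Hypothesis hd : forall x s, x \in `[a, b] -> 0 < s -> is_derive s 1 (F x) (dF x s).

Lemma coef_deri m t : 0 < t ->
  is_derive t 1 (fun t => coef L a b (F ^~ t) m) (coef L a b (dF ^~ t) m).
Proof.
move=> t0; apply: deriZ.
have cb := @horner_cont _ (bas L a b m).
have tI : t \in `]0, t + 1[ by rewrite in_itv/= t0/= ltrDl.
refine (@jcont_int_deri _ _ _ a b t 0 (t + 1) (jcont_mul cF cb) (jcont_mul cdF cb) tI _).
move=> x s xab; rewrite in_itv/= => /andP[s0 _].
rewrite [X in is_derive _ _ _ X]mulrC; under eq_fun do rewrite mulrC.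
by apply: deriZ; exact: hd.
Qed.

Lemma end_res_deri c t : c \in `[a, b] -> 0 < t ->
  is_derive t 1 (fun t => end_res k L a b c (F ^~ t)) (end_res k L a b c (dF ^~ t)).
Proof.
move=> cab t0; rewrite /end_res [X in is_derive _ _ _ X]mulrC.
under [X in is_derive _ _ X]eq_fun do rewrite mulrC.
apply: deriZ; rewrite /l2res; apply: deriB; first exact: hd.
apply: deri_sum => m _; rewrite [X in is_derive _ _ _ X]mulrC.
under eq_fun do rewrite mulrC.
by apply: deriZ; exact: coef_deri.
Qed.

End time_derivative.

Lemma field_lin xl xr n G H (c : R) : smooth_field xl xr n G -> smooth_field xl xr n H ->
  smooth_field xl xr n (fun i j x t => G i j x t + c * H i j x t).
Proof.
move=> [cG nG dG tG] [cH nH dH tH]; split.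
- by move=> i j iN j1; apply: jcont_lin; [exact: cG|exact: cH].
- by move=> i j x t t0; rewrite nG// nH.
- by move=> i j x t iN j1 xlr; apply: deriD; [exact: dG|apply: deriZ; exact: dH].
- by move=> x t xlr t0; apply: deriD; [exact: tG|apply: deriZ; exact: tH].
Qed.

Lemma cell_ibp xl xr n G a b t (v : {poly R}) : smooth_field xl xr n.+1 G ->
  xl <= a -> a < b -> b <= xr ->
  \int[mu]_(x in `[a, b]) (G 1%N 0%N x t * v.[x]) =
  G 0%N 0%N b t * v.[b] - G 0%N 0%N a t * v.[a]
  - \int[mu]_(x in `[a, b]) (G 0%N 0%N x t * v^`().[x]).
Proof.
move=> SG la ab br.
have c0 := @jcont_l _ _ t (sf_cont SG (leq0n n.+1) (leq0n 1)).
have c1 := @jcont_l _ _ t (sf_cont SG (ltn0Sn n) (leq0n 1)).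
have d0 x : x \in `]a, b[ -> is_derive x 1 (G 0%N 0%N ^~ t) (G 1%N 0%N x t).
  rewrite in_itv/= => /andP[ax xb]; apply: (sf_dx SG) => //.
  by rewrite in_itv/= (le_lt_trans la)//= (lt_le_trans xb).
rewrite (@Rint_eq _ _ _ (fun x => v.[x] * G 1%N 0%N x t)); last by move=> x _; rewrite mulrC.
rewrite (@Rintegration_by_parts R (horner v) (G 0%N 0%N ^~ t) (horner v^`()) (G 1%N 0%N ^~ t) a b ab).
- rewrite [v.[b] * _]mulrC [v.[a] * _]mulrC; congr (_ - _).
  by apply: Rint_eq => x _; rewrite mulrC.
- exact: contw_poly.
- split.
  + by move=> x _; exact: derivable_horner.
  + by apply: cvg_at_right_filter; exact: horner_cont.
  + by apply: cvg_at_left_filter; exact: horner_cont.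
- by move=> x _; rewrite -derivE.
- exact: continuous_subspaceT.
- split.
  + by move=> x xab; have [] := d0 x xab.
  + by apply: cvg_at_right_filter; exact: c0.
  + by apply: cvg_at_left_filter; exact: c0.
- by move=> x xab; exact: deri_derive1 (d0 x xab).
Qed.

(** The constant is the same for all subintervals [a, b] of the domain and all
    times up to Tm: this is what makes the final constant independent of the
    mesh. *)
Definition cell_bound xl xr (G : nat -> nat -> R -> R -> R) (Tm C : R) :=
  forall a b c j t, xl <= a -> a < b -> b <= xr -> (j <= 1)%N ->
    0 <= t -> t <= Tm -> c = a \/ c = b ->
    (forall x, x \in `[a, b] -> `|l2res k L a b (G 0%N j ^~ t) x| <= C * (b - a) ^+ k.+1) /\
    `|end_res k L a b c (G 0%N j ^~ t)| <= C * (b - a) ^+ k.+1.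

(** The projections reproduce polynomials of degree k, so it is enough to bound
    the remainder of the Taylor expansion at the left end of the cell, hence the
    derivative of order k + 1, which is bounded on the compact domain. *)
Lemma field_bound xl xr G (Tm : R) : xl < xr -> smooth_field xl xr k.+1 G ->
  exists2 C : R, 0 <= C & cell_bound xl xr G Tm C.
Proof.
move=> lr SG.
have [B0 B00 hB0] := @jcont_bounded _ _ xl xr 0 Tm (sf_cont SG (leqnn k.+1) (leq0n 1)).
have [B1 B10 hB1] := @jcont_bounded _ _ xl xr 0 Tm (sf_cont SG (leqnn k.+1) (leqnn 1)).
pose B := B0 + B1; have B_ge0 : 0 <= B by rewrite addr_ge0.
have [Lk0 Lk1] := top_end_neq0 HL.
pose e := 1 + `|(L k).[0]|^-1 + `|(L k).[1]|^-1.
have i0 : 0 <= `|(L k).[0]|^-1 by rewrite invr_ge0.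
have i1 : 0 <= `|(L k).[1]|^-1 by rewrite invr_ge0.
have rc0 : 0 <= res_const k Lam by rewrite addr_ge0// mulr_ge0// sqr_ge0.
exists (res_const k Lam * e * B).
  by rewrite !mulr_ge0// /e !addr_ge0.
move=> a b c j t la ab br j1 t0 tT hc.
have cab : c \in `[a, b] by rewrite in_itv/=; case: hc => ->; rewrite lexx (ltW ab).
have hB x : x \in `[a, b] -> `|G k.+1 j x t| <= B.
  rewrite in_itv/= => /andP[ax xb]; have lx := le_trans la ax; have xr' := le_trans xb br.
  case: j j1 => [|[|//]] _; rewrite /B.
    by rewrite (le_trans (hB0 _ _ lx xr' t0 tT))// lerDl.
  by rewrite (le_trans (hB1 _ _ lx xr' t0 tT))// lerDr.
have [||q sq hq] := @poly_approx _ k.+1 (fun i => G i j ^~ t) a b B ab _ _ hB.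
- by move=> i ik; apply: jcontw; apply: (sf_cont SG).
- move=> i x ik; rewrite in_itv/= => /andP[ax xb]; apply: (sf_dx SG) => //.
  by rewrite in_itv/= (le_lt_trans la)//= (lt_le_trans xb).
have cw : {within `[a, b], continuous (G 0%N j ^~ t)} by apply: jcontw; exact: (sf_cont SG).
have X0 : 0 <= B * (b - a) ^+ k.+1 by rewrite mulr_ge0// exprn_ge0// subr_ge0 ltW.
have eq1 : res_const k Lam * e * B * (b - a) ^+ k.+1 = res_const k Lam * e * (B * (b - a) ^+ k.+1).
  by rewrite !mulrA.
rewrite eq1; split.
  move=> x xab; apply: (le_trans (l2res_le HL ab Lam_ge sq cw hq xab)).
  by apply: ler_wpM2r => //; rewrite -[leLHS]mulr1; apply: ler_wpM2l => //; rewrite /e; lra.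
apply: (le_trans (end_res_le HL ab Lam_ge cab sq cw hq)).
apply: ler_wpM2r => //; apply: ler_wpM2l => //.
case: hc => ->; [rewrite bas_left|rewrite bas_right//]; rewrite /e; lra.
Qed.
End FieldCoefficients.

(** * The Caputo derivative *)

Section Caputo.
Context {R : realType}.
Local Notation mu := (@lebesgue_measure R).
Local Notation mR := (measurableTypeR R).
Local Notation Rpos := (`]0%R, +oo[%classic : set R).
Implicit Types (a b x t l : R) (f g : R -> R).

Lemma Rint_itv_oo f a b : measurable_fun (`]a, b[ : set R) f ->
  \int[mu]_(x in `[a, b]) f x = \int[mu]_(x in `]a, b[) f x.
Proof. by move=> mf; rewrite /Rintegral integral_itv_bndoo//; exact/measurable_EFinP. Qed.

Lemma cont_measurable f (D : set R) : measurable D -> continuous f -> measurable_fun D f.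
Proof. by move=> mD cf; apply: measurable_funTS; exact: continuous_measurable_fun. Qed.

Lemma cont_integrable_oo f a b : continuous f ->
  mu.-integrable `]a, b[ (fun x => (f x)%:E).
Proof.
move=> cf; apply: (@integrableS _ _ _ mu `[a, b]) => //.
  exact: subset_itv_oo_cc.
by apply: cont_itv_integrable; exact: continuous_subspaceT.
Qed.

Lemma intg_EFin (D : set R) f : measurable D -> mu.-integrable D (fun x => (f x)%:E) ->
  (\int[mu]_(x in D) (f x)%:E = (\int[mu]_(x in D) f x)%:E)%E.
Proof. by move=> mD fi; rewrite /Rintegral fineK//; exact: integrable_fin_num. Qed.

Variables (al t : R).
Hypotheses (al0 : 0 < al) (al1 : al < 1) (t0 : 0 < t).
Local Notation T0 := (`]0%R, t[%classic : set R).
Let mT0 : measurable T0. Proof. exact: measurable_itv. Qed.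
Let mRpos : measurable Rpos. Proof. exact: measurable_itv. Qed.

(* The kernel of the memory of a solution, before the integration in time. *)
Let K (z : R * R) := z.1 `^ (al - 1) * expR (- ((t - z.2) * z.1)).

Let jexp : jcont (fun s l => expR (- ((t - s) * l))).
Proof.
move=> p; apply: (@continuous_comp _ _ _ (fun p : R * R => - ((t - p.1) * p.2)) expR).
  apply: (@continuousN _ _ _ (fun p : R * R => (t - p.1) * p.2)).
  apply: (@continuousM _ _ (fun p : R * R => t - p.1) snd); last exact: cvg_snd.
  by apply: (@continuousB _ _ _ (fun=> t) (fst : R * R -> R)); [exact: cvg_cst|exact: cvg_fst].
exact: continuous_expR.
Qed.

Let mK (g : R -> R) : continuous g ->
  measurable_fun (Rpos `*` T0) (fun z : mR * mR => K z * g z.2).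
Proof.
move=> cg; apply: measurable_funTS; apply: measurable_funM.
  apply: measurable_funM.
    by apply: (measurableT_comp (@measurable_realfun.measurable_powR R (al - 1))); exact: measurable_fst.
  have cs : jcont (fun l s => expR (- ((t - s) * l))).
    move=> p; apply: (@continuous_comp _ _ _ (fun p : R * R => (p.2, p.1)) (fun q : R * R => expR (- ((t - q.1) * q.2)))).
      apply: (@continuous2_cvg _ _ _ _ _ _ snd fst (fun x y => (x, y))); last 2 first.
        exact: cvg_snd.
        exact: cvg_fst.
      rewrite [X in X @ _](_ : _ = id); first exact: cvg_id.
      by apply/funext => -[].
    exact: jexp.
  exact: jcont_measurable cs.
by apply: (measurableT_comp (continuous_measurable_fun cg)); exact: measurable_snd.
Qed.

Let cKg (g : R -> R) l : continuous g -> continuous (fun s : R => K (l, s) * g s).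
Proof.
move=> cg s; have c1 : {for s, continuous (fun s : R => K (l, s))}.
  by have := @contZ _ (l `^ (al - 1)) _ _ (@jcont_l _ _ l jexp s).
exact: (contM c1 (cg s)).
Qed.

Let decay (g : R -> R) l := \int[mu]_(s in `[0, t]) (expR (- ((t - s) * l)) * g s).

Let decay_cont g : continuous g -> continuous (decay g).
Proof. by move=> cg; exact: (@jcont_int _ _ 0 t (jcont_mul jexp cg)). Qed.

Let decay_oo g l : continuous g ->
  \int[mu]_(s in T0) (K (l, s) * g s) = l `^ (al - 1) * decay g l.
Proof.
move=> cg; have ci : continuous (fun s => expR (- ((t - s) * l)) * g s).
  by have := @jcont_l _ _ l (jcont_mul jexp cg).
rewrite /decay Rint_itv_oo; last exact: cont_measurable.
rewrite -RintegralZl//; last exact: cont_integrable_oo.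
by apply: Rint_eq => s _; rewrite /K/= mulrA.
Qed.

Let decay_le g (B : R) l : 0 < l -> continuous g -> 0 <= B ->
  (forall s, 0 <= s -> s <= t -> `|g s| <= B) ->
  `|decay g l| <= B * ((1 - expR (- l * (t - 0))) / l).
Proof.
move=> l0 cg B0 hB.
have ci : continuous (fun s => expR (- ((t - s) * l)) * g s).
  by have := @jcont_l _ _ l (jcont_mul jexp cg).
have ce : continuous (fun s => expR (- ((t - s) * l))) by exact: (@jcont_l _ _ l jexp).
have de (s : R) : is_derive s 1 (fun s => expR (- ((t - s) * l)) / l) (expR (- ((t - s) * l))).
  have d1 : is_derive s 1 (fun s => - ((t - s) * l)) l.
    apply: (@deri_ext _ (fun s => l * s - t * l)); first by move=> u; ring.
    apply: (is_derive_eq (deriB (deriZ l (deri_id s)) (deri_cst _ s))); ring.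
  have := deriZ l^-1 (deri_comp (is_derive_expR _) d1).
  under [X in is_derive _ _ X]eq_fun do rewrite mulrC.
  by rewrite mulrCA mulVf ?mulr1// gt_eqF.
have -> : B * ((1 - expR (- l * (t - 0))) / l) = \int[mu]_(s in `[0, t]) (B * expR (- ((t - s) * l))).
  rewrite RintegralZl//; last by apply: cont_itv_integrable; exact: continuous_subspaceT.
  congr (_ * _); rewrite /Rintegral (@continuous_FTC2 R _ (fun s => expR (- ((t - s) * l)) / l) 0 t t0).
  - by rewrite /= subrr mul0r oppr0 expR0 -mulrBl mulNr [l * _]mulrC.
  - exact: continuous_subspaceT.
  - split.
    + by move=> s _; have [] := de s.
    + by apply: cvg_at_right_filter; exact: deri_cont (de 0).
    + by apply: cvg_at_left_filter; exact: deri_cont (de t).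
  - by move=> s _; exact: deri_derive1 (de s).
have i1 : mu.-integrable `[0, t] (fun s => (expR (- ((t - s) * l)) * g s)%:E).
  by apply: cont_itv_integrable; exact: continuous_subspaceT.
rewrite /decay; apply: (le_trans (le_normr_Rintegral _ i1)) => //.
apply: le_Rintegral => //.
- exact: intg_norm.
- by apply: contw_intg; apply: contwZ; exact: continuous_subspaceT.
- move=> s /=; rewrite in_itv/= => /andP[s0 st]; rewrite normrM gtr0_norm ?expR_gt0// mulrC.
  by rewrite ler_wpM2r ?expR_ge0// hB.
Qed.

Let decay_integrable g : continuous g ->
  mu.-integrable Rpos (fun l => (l `^ (al - 1) * decay g l)%:E).
Proof.
move=> cg.
have [B B0 hB] : exists2 B : R, 0 <= B & forall s, 0 <= s -> s <= t -> `|g s| <= B.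
  have jg : jcont (fun=> g) by move=> p; apply: continuous_comp; [exact: cvg_snd|exact: cg].
  by have [B B0 hB] := @jcont_bounded _ _ 0 0 0 t jg; exists B => // s s0 st; apply: (hB 0).
apply: (@intg_le _ _ _ _ (fun l => B * (1 + t) * euler_weight al l)); first exact: mRpos.
- apply: measurable_funM; first exact: measurable_powRl.
  by apply: cont_measurable => //; exact: decay_cont.
- move=> l; rewrite /= in_itv/= andbT => l0; rewrite normrM ger0_norm ?powR_ge0//.
  apply: (@le_trans _ _ (l `^ (al - 1) * (B * ((1 - expR (- l * (t - 0))) / l)))).
    by apply: ler_wpM2l; [exact: powR_ge0|exact: decay_le].
  rewrite mulrCA -mulrA; apply: ler_wpM2l => //.
  by have := exp_decay_le al l0 (ltW t0); rewrite subr0.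
- by apply: intgZ => //; exact: euler_weight_integrable.
Qed.

(** The singular kernel is the Laplace transform of l^(al-1), whose other iterated
    integral is dominated by the Euler weight. *)
Lemma singular_integrable : mu.-integrable T0 (fun s => ((t - s) `^ (- al))%:E).
Proof.
have G0 := Gamma_gt0 al0 al1.
suff : mu.-integrable T0 (fun s => ((t - s) `^ (- al) * Gamma al)%:E).
  move=> /(intgZr mT0 (Gamma al)^-1); apply: (intg_eq mT0) => s _.
  by rewrite mulfK// gt_eqF.
have m1 : measurable_fun T0 (fun s => (t - s) `^ (- al) * Gamma al).
  apply: measurable_funM => //.
  apply: (measurableT_comp (@measurable_realfun.measurable_powR R (- al))).
  by apply: cont_measurable => // s; apply: contB; [exact: cvg_cst|exact: cvg_id].
apply/integrableP; split; first exact/measurable_EFinP.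
have c1 : continuous (fun _ : R => 1 : R) by move=> s; exact: cvg_cst.
have : (\int[mu]_(l in Rpos) (l `^ (al - 1) * decay (fun=> 1) l)%:E < +oo)%E.
  by rewrite (intg_EFin mRpos (decay_integrable c1)) ltry.
have -> : (\int[mu]_(l in Rpos) (l `^ (al - 1) * decay (fun=> 1) l)%:E =
    \int[mu]_(l in Rpos) \int[mu]_(s in T0) (K (l, s) * 1)%:E)%E.
  apply: eq_integral => l _; rewrite -decay_oo// intg_EFin//.
  by have := @cont_integrable_oo _ 0 t (@cKg _ l c1).
rewrite (@tonelli_rect _ Rpos T0 (fun z => K z * 1))//; last 2 first.
- exact: (mK c1).
- by move=> z _; rewrite mulr1 mulr_ge0 ?powR_ge0 ?expR_ge0.
apply: le_lt_trans; rewrite le_eqVlt; apply/orP; left; apply/eqP.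
apply: eq_integral => s; rewrite inE/= in_itv/= => /andP[s0 st].
rewrite ger0_norm; last by rewrite mulr_ge0 ?powR_ge0 ?(ltW G0).
rewrite -laplace_powR ?subr_gt0//; apply: eq_integral => l _.
by rewrite /K/= mulr1.
Qed.

Lemma singular_cont_integrable g : continuous g ->
  mu.-integrable T0 (fun s => ((t - s) `^ (- al) * g s)%:E).
Proof.
move=> cg.
have [B B0 hB] : exists2 B : R, 0 <= B & forall s, 0 <= s -> s <= t -> `|g s| <= B.
  have jg : jcont (fun=> g) by move=> p; apply: continuous_comp; [exact: cvg_snd|exact: cg].
  by have [B B0 hB] := @jcont_bounded _ _ 0 0 0 t jg; exists B => // s s0 st; apply: (hB 0).
apply: (@intg_le _ _ _ _ (fun s => (t - s) `^ (- al) * B)); first exact: mT0.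
- apply: measurable_funM; first exact: intg_measurable singular_integrable.
  exact: cont_measurable.
- move=> s; rewrite /= in_itv/= => /andP[s0 st].
  by rewrite normrM ger0_norm ?powR_ge0// ler_wpM2l ?powR_ge0// hB// ltW.
- exact: (intgZr mT0 _ singular_integrable).
Qed.

(** The integral over l of the memory kernels is, by Fubini, the singular kernel
    of the Caputo derivative. *)
Lemma memory_kernel g : continuous g ->
  mu.-integrable Rpos (fun l => (l `^ (al - 1) * decay g l)%:E) /\
  \int[mu]_(l in Rpos) (l `^ (al - 1) * decay g l) =
  Gamma al * \int[mu]_(s in T0) ((t - s) `^ (- al) * g s).
Proof.
move=> cg; split; first exact: decay_integrable.
have iK s : T0 s -> mu.-integrable Rpos (fun l => (K (l, s))%:E).
  rewrite /= in_itv/= => /andP[s0 st]; apply/integrableP; split.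
    by apply/measurable_EFinP; have := measurable_gamma_integrand al (t - s).
  apply: (@le_lt_trans _ _ ((t - s) `^ (- al) * Gamma al)%:E); last exact: ltry.
  rewrite -laplace_powR ?subr_gt0// le_eqVlt; apply/orP; left; apply/eqP.
  by apply: eq_integral => l _; rewrite gee0_abs// lee_fin mulr_ge0 ?powR_ge0 ?expR_ge0.
have [|||_] := @fubini_rect _ Rpos T0 (fun z => K z * g z.2) mRpos mT0 (mK cg).
- by move=> l _; have := @cont_integrable_oo _ 0 t (@cKg _ l cg).
- by move=> s Ts /=; apply: intgZr => //; exact: iK.
- have cn : continuous (fun s => `|g s|).
    by move=> s; apply: continuous_comp; [exact: cg|exact: norm_continuous].
  have := ltry (\int[mu]_(l in Rpos) (l `^ (al - 1) * decay (fun s => `|g s|) l)).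
  rewrite -(intg_EFin mRpos (decay_integrable cn)); apply: le_lt_trans.
  rewrite le_eqVlt; apply/orP; left; apply/eqP; apply: eq_integral => l _; rewrite -decay_oo//; congr EFin; apply: Rint_eq => s _.
  by rewrite normrM ger0_norm// mulr_ge0 ?powR_ge0 ?expR_ge0.
move=> E; transitivity (\int[mu]_(l in Rpos) \int[mu]_(s in T0) (K (l, s) * g s)).
  by apply: Rint_eq => l _; rewrite decay_oo.
rewrite E -RintegralZl//; last exact: singular_cont_integrable.
apply: Rint_eq => s /[dup] Ts; rewrite /= in_itv/= => /andP[s0 st].
rewrite RintegralZr//; last exact: iK.
rewrite mulrA; congr (_ * _); rewrite mulrC /Rintegral.
have ts : 0 < t - s by rewrite subr_gt0.
have e : (\int[mu]_(l in Rpos) (K (l, s))%:E = ((t - s) `^ (- al) * Gamma al)%:E)%E.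
  exact: laplace_powR al0 al1 ts.
by rewrite e.
Qed.

(** Fubini: the kernel is integrable in time and the other factor is bounded. *)
Lemma singular_fubini F g a b : a < b -> jcont F -> continuous g ->
  \int[mu]_(x in `[a, b]) ((\int[mu]_(s in T0) ((t - s) `^ (- al) * F x s)) * g x) =
  \int[mu]_(s in T0) ((t - s) `^ (- al) * \int[mu]_(x in `[a, b]) (F x s * g x)).
Proof.
move=> ab cF cg; have jFg := jcont_mul cF cg.
pose f (z : mR * mR) := (t - z.1) `^ (- al) * (F z.2 z.1 * g z.2).
have mab : measurable (`[a, b]%classic : set R) by exact: measurable_itv.
have iw := singular_integrable.
have jFg' : jcont (fun s x => F x s * g x).
  move=> p; apply: (@continuous_comp _ _ _ (fun p : R * R => (p.2, p.1)) (fun q : R * R => F q.1 q.2 * g q.1)).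
    apply: (@continuous2_cvg _ _ _ _ _ _ snd fst (fun x y => (x, y))); last 2 first.
      exact: cvg_snd.
      exact: cvg_fst.
    rewrite [X in X @ _](_ : _ = id); first exact: cvg_id.
    by apply/funext => -[].
  exact: jFg.
have mf : measurable_fun (T0 `*` `[a, b]%classic) f.
  apply: measurable_funTS; apply: measurable_funM; last exact: jcont_measurable jFg'.
  apply: (measurableT_comp (@measurable_realfun.measurable_powR R (- al))).
  apply: measurable_funB; first exact: measurable_cst.
  exact: measurable_fst.
have jn : jcont (fun x s => `|F x s * g x|).
  move=> p; apply: (@continuous_comp _ _ _ (fun p : R * R => F p.1 p.2 * g p.1) (fun y => `|y|)).
    exact: jFg.
  exact: norm_continuous.
have [||| _ E] := @fubini_rect _ T0 `[a, b]%classic f mT0 mab mf.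
- move=> s _; rewrite /f/=; apply: intgZ => //.
  by apply: cont_itv_integrable; apply: continuous_subspaceT; exact: (@jcont_l _ _ s jFg).
- by move=> x _; exact: singular_cont_integrable (@jcont_r _ _ x jFg).
- have cn := @jcont_int _ _ a b jn.
  have iN := singular_cont_integrable cn.
  have := ltry (\int[mu]_(s in T0) ((t - s) `^ (- al) * \int[mu]_(x in `[a, b]) `|F x s * g x|)).
  rewrite -(intg_EFin mT0 iN); apply: le_lt_trans.
  rewrite le_eqVlt; apply/orP; left; apply/eqP; apply: eq_integral => s _; congr EFin.
  rewrite -RintegralZl//; last first.
    by apply: cont_itv_integrable; apply: continuous_subspaceT; exact: (@jcont_l _ _ s jn).
  by apply: Rint_eq => x _; rewrite /f/= normrM ger0_norm ?powR_ge0.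
transitivity (\int[mu]_(x in `[a, b]) \int[mu]_(s in T0) f (s, x)).
  apply: Rint_eq => x _; rewrite -RintegralZr//.
    by apply: Rint_eq => s _; rewrite /f/= mulrA.
  exact: singular_cont_integrable (@jcont_r _ _ x cF).
rewrite -E; apply: Rint_eq => s _; rewrite -RintegralZl//.
by apply: cont_itv_integrable; apply: continuous_subspaceT; exact: (@jcont_l _ _ s jFg).
Qed.

End Caputo.

Section ExactMemory.
Context {R : realType}.
Local Notation mu := (@lebesgue_measure R).
Local Notation Rpos := (`]0%R, +oo[%classic : set R).
Implicit Types (f p dp : R -> R).

Lemma int_from0 f (t : R) : continuous f ->
  \int[mu]_(s in `[0, t]) f s = prim f (Num.max 0 t) - prim f 0.
Proof.
move=> cf; have [t0|t0] := leP t 0.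
  rewrite subrr; move: t0; rewrite le_eqVlt => /orP[/eqP ->|t0].
    by rewrite set_itv1 Rintegral_set1.
  by rewrite set_itv_ge ?Rintegral_set0// bnd_simp -ltNge.
have i1 a b : mu.-integrable `[a, b] (EFin \o f).
  by apply: cont_itv_integrable; exact: continuous_subspaceT.
rewrite /prim (@Rintegral_itvB R f (BLeft (-1)) (BRight t) 0 (i1 _ _)) ?bnd_simp ?(ltW t0)//.
rewrite Rintegral_itv_obnd_cbnd//.
by apply: integrableS (i1 0 t) => //; exact: subset_itv_oc_cc.
Qed.

Definition exact_memory al c dp (t l : R) : R :=
  c * (l `^ (al - 1) *
    \int[mu]_(s in `[0, t]) (expR (- ((t - s) * l)) * dp s)).

Lemma exact_memory_pair al c p dp : 0 < al -> al < 1 ->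
  continuous p -> (forall t : R, t <= 0 -> p t = 0) ->
  (forall t : R, 0 < t -> is_derive t 1 p (dp t)) -> continuous dp ->
  memory_pair al c p dp (exact_memory al c dp).
Proof.
move=> al0 al1 cp p0 hp cdp.
pose f l s := expR (l * s) * dp s.
have cf l : continuous (f l).
  by move=> s; have := contM (deri_cont (deri_expRZ l s)) (cdp s).
have fE t l : exact_memory al c dp t l = c * l `^ (al - 1) *
    (expR (- l * t) * (prim (f l) (Num.max 0 t) - prim (f l) 0)).
  rewrite -(int_from0 _ (cf l)) /exact_memory mulrA; congr (_ * _).
  rewrite -RintegralZl//.
    by apply: Rint_eq => s _; rewrite /f mulrA -expRD; congr (expR _ * _); ring.
  by apply: cont_itv_integrable; exact: continuous_subspaceT.
have cmax (l : R) : continuous (fun t : R => prim (f l) (Num.max 0 t)).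
  move=> t; apply: continuous_comp; first exact: max_cont.
  apply: deri_cont (prim_deri (cf l) _).
  by apply: (@lt_le_trans _ _ 0); [lra|rewrite le_max lexx].
split.
- exact: cp.
- exact: p0.
- exact: hp.
- move=> d T d0.
  have jg : jcont (fun _ : R => dp) by move=> q; apply: continuous_comp; [exact: cvg_snd|exact: cdp].
  have [B B0 hB] := @jcont_bounded _ _ 0 0 d T jg.
  by exists B => t dt tT; apply: (hB 0).
- move=> l l0 t.
  rewrite (_ : exact_memory al c dp ^~ l = fun t => c * l `^ (al - 1) *
    (expR (- l * t) * (prim (f l) (Num.max 0 t) - prim (f l) 0))); last by apply/funext => u; exact: fE.
  have c1 : {for t, continuous (fun u : R => prim (f l) 0)} by exact: cvg_cst.
  have c2 := contM (deri_cont (deri_expRZ (- l) t)) (contB (cmax l t) c1).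
  by have := @contZ _ (c * l `^ (al - 1)) _ _ c2.
- by move=> t l t0 l0; rewrite fE max_l// subrr !mulr0.
- move=> t l t0 l0.
  have h : is_derive t 1 (fun t => c * l `^ (al - 1) *
     (expR (- l * t) * (prim (f l) t - prim (f l) 0)))
     (- l * exact_memory al c dp t l + c * l `^ (al - 1) * dp t).
    have t1 : -1 < t by lra.
    apply: (is_derive_eq (deriZ _ (deriM (deri_expRZ (- l) t) (deriB (prim_deri (cf l) t1) (deri_cst _ t))))).
    have ee : expR (- l * t) * (f l t - 0) = dp t.
      by rewrite subr0 /f mulrA -expRD mulNr addNr expR0 mul1r.
    rewrite ee fE max_r; last exact: ltW.
    by ring.
  apply: deri_near h; near=> s; rewrite fE max_r//; apply: ltW; near: s; exact: lt_nbhsr.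
- move=> t t0; have [h _] := memory_kernel al0 al1 t0 cdp.
  by apply: (intgZ _ _ h) => //; exact: measurable_itv.
Unshelve. all: by end_near. Qed.

(** The representation of the Caputo derivative by the memory variables; the
    constants match by the reflection formula. *)
Lemma exact_memory_total al dp t (c := sin (pi * al) / pi) : 0 < al -> al < 1 -> 0 < t -> continuous dp ->
  \int[mu]_(l in Rpos) exact_memory al c dp t l =
  (Gamma (1 - al))^-1 * \int[mu]_(s in `]0, t[) ((t - s) `^ (- al) * dp s).
Proof.
move=> al0 al1 t0 cdp; have [h E] := memory_kernel al0 al1 t0 cdp.
rewrite /exact_memory RintegralZl// E.
have a1 : 0 < 1 - al by lra.
have G1 : Gamma (1 - al) != 0 by rewrite gt_eqF// Gamma_gt0//; lra.
rewrite mulrA; congr (_ * _); apply: (mulIf G1).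
by rewrite /c Gamma_reflection// mulVf.
Qed.
End ExactMemory.

(** * Paths of polynomials *)

Section PolynomialPaths.
Context {R : realType}.
Local Notation mu := (@lebesgue_measure R).
Local Notation Rpos := (`]0%R, +oo[%classic : set R).
Variables (k : nat) (L : nat -> {poly R}).
Hypothesis HL : orthonormal_upto k.+1 L.
Variables a b : R.
Hypothesis ab : a < b.

Lemma coef_lin_sum n (c : 'I_n -> R) (f : 'I_n -> R -> R) m :
  (forall i, continuous (f i)) ->
  coef L a b (fun x => \sum_(i < n) c i * f i x) m = \sum_(i < n) c i * coef L a b (f i) m.
Proof.
move=> cf; rewrite /coef.
have i1 i : mu.-integrable `[a, b] (fun x => (c i * (f i x * (bas L a b m).[x]))%:E).
  by apply: contw_intg; apply: contwZ; apply: contw_fpoly; exact: continuous_subspaceT.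
rewrite (@Rint_eq _ _ _ (fun x => \sum_(i < n) c i * (f i x * (bas L a b m).[x]))); last first.
  by move=> x _; rewrite mulr_suml; apply: eq_bigr => i _; rewrite mulrA.
rewrite Rint_sum// mulr_sumr; apply: eq_bigr => i _; rewrite RintegralZl//.
  by rewrite mulrCA.
by apply: contw_intg; apply: contw_fpoly; exact: continuous_subspaceT.
Qed.

Lemma coef_poly_expand (q : {poly R}) m : (size q <= k.+1)%N ->
  coef L a b (horner q) m = \sum_(i < k.+1) q`_i * coef L a b (fun x => x ^+ i) m.
Proof.
move=> sq; rewrite -coef_lin_sum; last by move=> i; exact: exprn_continuous.
by congr (coef _ _ _ _ _); apply/funext => x; exact: horner_coef_wide.
Qed.

(** Freezing a function at its value at 0 for negative times turns one-sided
    continuity at 0 into continuity. *)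
Lemma within_max0 (f : R -> R) : {within `[0, +oo[, continuous f} ->
  continuous (fun t : R => f (Num.max 0 t)).
Proof.
move=> cf t; have /subspace_continuousP cf' := cf.
have h : (Num.max 0 u @[u --> t]) --> within `[0, +oo[ (nbhs (Num.max 0 t)).
  move=> U /= hU; have h1 : \forall u \near t, `[0, +oo[%classic (Num.max 0 u) -> U (Num.max 0 u).
    exact: (@max_cont R 0 t _ hU).
  apply: filterS h1 => u; apply.
  by rewrite /= in_itv/= le_max lexx.
have h0 : `[0, +oo[%classic (Num.max 0 t) by rewrite /= in_itv/= le_max lexx.
apply: (@cvg_comp _ _ _ (fun u : R => Num.max 0 u) f (nbhs t) (within `[0, +oo[ (nbhs (Num.max 0 t)))).
  exact: h.
exact: cf'.
Qed.

Variable u : R -> {poly R}.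
Hypothesis us : forall t : R, 0 <= t -> (size (u t) <= k.+1)%N.
Hypothesis ur : forall i,
  [/\ {within `[0, +oo[, continuous (fun t => (u t)`_i)},
      forall t : R, 0 < t -> derivable (fun s => (u s)`_i) t 1 &
      forall t : R, 0 < t -> {for t, continuous (derive1 (fun s => (u s)`_i))}].

Definition path_deriv t : {poly R} := \poly_(i < k.+1) derive1 (fun s => (u s)`_i) t.

Lemma size_path_deriv t : (size (path_deriv t) <= k.+1)%N.
Proof. exact: size_poly. Qed.

Let max0 (t : R) : 0 <= Num.max 0 t. Proof. by rewrite le_max lexx. Qed.

Lemma path_coef_cont m : continuous (fun t : R => coef L a b (horner (u (Num.max 0 t))) m).
Proof.
rewrite (_ : (fun t => _) = fun t => \sum_(i < k.+1) (u (Num.max 0 t))`_i * coef L a b (fun x => x ^+ i) m); last first.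
  by apply/funext => t; exact: coef_poly_expand (us (max0 t)).
move=> t; apply: cont_sum => i _; have [ci _ _] := ur i.
have := @contM _ _ (fun=> coef L a b (fun x => x ^+ i) m) t (@within_max0 _ ci t) (cvg_cst _).
exact.
Qed.

Lemma near_max0 (f : R -> R) (t d : R) : 0 < t -> is_derive t 1 f d ->
  is_derive t 1 (fun s => f (Num.max 0 s)) d.
Proof.
move=> t0; apply: deri_near; near=> s; rewrite max_r//; apply: ltW; near: s; exact: lt_nbhsr.
Unshelve. all: by end_near. Qed.

Lemma path_sum_deri (w : nat -> R) (t : R) : 0 < t ->
  is_derive t 1 (fun t => \sum_(i < k.+1) (u t)`_i * w i)
    (\sum_(i < k.+1) (path_deriv t)`_i * w i).
Proof.
move=> t0; apply: deri_sum => i _; rewrite coef_poly ltn_ord mulrC.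
under [X in is_derive _ _ X]eq_fun do rewrite mulrC.
by apply: deriZ; apply: derivable_deri; have [_ d _] := ur i; exact: d.
Qed.

Lemma path_coef_deri m (t : R) : 0 < t ->
  is_derive t 1 (fun t => coef L a b (horner (u (Num.max 0 t))) m)
    (coef L a b (horner (path_deriv t)) m).
Proof.
move=> t0; rewrite (coef_poly_expand _ (size_path_deriv t)).
rewrite (_ : (fun t => _) = fun t => \sum_(i < k.+1) (u (Num.max 0 t))`_i * coef L a b (fun x => x ^+ i) m); last first.
  by apply/funext => s; exact: coef_poly_expand (us (max0 s)).
exact: near_max0 t0 (path_sum_deri (fun i => coef L a b (fun x => x ^+ i) m) t0).
Qed.

Lemma path_eval_deri x (t : R) : 0 < t -> derive1 (fun s => (u s).[x]) t = (path_deriv t).[x].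
Proof.
move=> t0; rewrite (horner_coef_wide _ (size_path_deriv t)); apply: deri_derive1.
apply: deri_near (path_sum_deri (fun i => x ^+ i) t0).
near=> s; rewrite (@horner_coef_wide _ k.+1)// us//; apply: ltW; near: s; exact: lt_nbhsr.
Unshelve. all: by end_near. Qed.

Lemma path_dcoef_bound m (d T : R) : 0 < d ->
  exists B : R, forall t, d <= t -> t <= T -> `|coef L a b (horner (path_deriv t)) m| <= B.
Proof.
move=> d0; have [dT|Td] := leP d T; last first.
  by exists 0 => t dt tT; have := lt_le_trans Td dt; rewrite ltNge tT.
have cc : {within `[d, T], continuous (fun t => `|coef L a b (horner (path_deriv t)) m|)}.
  apply: continuous_in_subspaceT => t; rewrite inE/= in_itv/= => /andP[dt _].
  have t0 : 0 < t by exact: lt_le_trans dt.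
  apply: (@continuous_comp _ _ _ (fun t => coef L a b (horner (path_deriv t)) m) (fun y : R => `|y|));
    last exact: norm_continuous.
  rewrite (_ : (fun t => coef _ _ _ _ _) = fun t => \sum_(i < k.+1) (path_deriv t)`_i * coef L a b (fun x => x ^+ i) m); last first.
    by apply/funext => s; exact: coef_poly_expand (size_path_deriv s).
  apply: cont_sum => i _; have [_ _ ci] := ur i.
  set w := coef _ _ _ _ _; have c1 : {for t, continuous (fun _ : R => w)} by exact: cvg_cst.
  have e : (fun t => (path_deriv t)`_i * w) = (fun t => derive1 (fun s => (u s)`_i) t * w).
    by apply/funext => s; rewrite coef_poly ltn_ord.
  by have := contM (ci t t0) c1; rewrite -e.
have [v _ Hv] := EVT_max dT cc.
by exists `|coef L a b (horner (path_deriv v)) m| => t dt tT; apply: Hv; rewrite in_itv/= dt.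
Qed.

End PolynomialPaths.

Section Interpolation.
Context {R : realType}.
Local Notation mu := (@lebesgue_measure R).
Local Notation Rpos := (`]0%R, +oo[%classic : set R).
Variables (k : nat) (L : nat -> {poly R}) (a b : R).
Hypothesis ab : a < b.

(** Lagrange interpolation at n + 1 equidistant points of [a, b]. *)
Lemma poly_interpolation n : exists (x : nat -> R) (l : 'I_n.+1 -> {poly R}),
  (forall i : 'I_n.+1, x i \in `[a, b]) /\
  forall q : {poly R}, (size q <= n.+1)%N -> q = \sum_(i < n.+1) q.[x i] *: l i.
Proof.
pose x (i : nat) : R := a + (b - a) * (i%:R / n.+1%:R).
have ba : 0 < b - a by rewrite subr_gt0.
have xinj : injective x.
  move=> i j /addrI /(mulfI (lt0r_neq0 ba)) /(mulIf (invr_neq0 (lt0r_neq0 (ltr0Sn R n)))) /eqP.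
  by rewrite eqr_nat => /eqP.
exists x, (fun i => (tnth (lagrange n.+1 x) i : {poly R})); split.
  move=> i; rewrite in_itv/= /x; apply/andP; split.
    by rewrite lerDl mulr_ge0 ?(ltW ba)// divr_ge0.
  by rewrite -lerBrDl ler_piMr ?(ltW ba)// ler_pdivrMr// mul1r ler_nat ltnW.
move=> q sq; rewrite {1}(lagrange_gen (ltn0Sn n) xinj sq); apply: eq_bigr => i _.
by rewrite mul_polyC.
Qed.

Lemma coef_integrable (q : R -> {poly R}) m : (forall l, 0 < l -> (size (q l) <= k.+1)%N) ->
  (forall x, x \in `[a, b] -> mu.-integrable Rpos (fun l => ((q l).[x])%:E)) ->
  mu.-integrable Rpos (fun l => (coef L a b (horner (q l)) m)%:E).
Proof.
move=> sq iq; have [x [e [xab xe]]] := poly_interpolation k.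
have mP : measurable Rpos by exact: measurable_itv.
apply: (@intg_eq _ _ mP (fun l => \sum_(i < k.+1) (q l).[x i] * coef L a b (horner (e i)) m)).
  move=> l; rewrite /= in_itv/= andbT => l0; rewrite -coef_lin_sum; last by move=> i; exact: horner_cont.
  congr (coef _ _ _ _ _); apply/funext => y; rewrite {2}(xe _ (sq l l0)) horner_sum.
  by apply: eq_bigr => i _; rewrite hornerZ.
apply: (@intg_sum _ _ mP) => i _; apply: (@intgZr _ _ mP); exact: iq.
Qed.

(** Interpolation turns both sides into finite combinations of integrals over the
    parameter at fixed points of the cell; so integrability at each point is
    enough, and no measurability in both variables is needed. *)
Lemma coef_param_integral (q : R -> {poly R}) m (c : R) (F := fun x => \int[mu]_(l in Rpos) (c * (q l).[x] * (bas L a b m).[x])) :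
  (forall l, 0 < l -> (size (q l) <= k.+1)%N) ->
  (forall x, x \in `[a, b] -> mu.-integrable Rpos (fun l => ((q l).[x])%:E)) ->
  (b - a)^-1 * \int[mu]_(x in `[a, b]) F x =
  c * \int[mu]_(l in Rpos) coef L a b (horner (q l)) m.
Proof.
move=> sq iq; have [x [e [xab xe]]] := poly_interpolation k.
have mP : measurable Rpos by exact: measurable_itv.
pose I i := \int[mu]_(l in Rpos) (q l).[x i].
have -> : \int[mu]_(l in Rpos) coef L a b (horner (q l)) m = \sum_(i < k.+1) I i * coef L a b (horner (e i)) m.
  transitivity (\int[mu]_(l in Rpos) \sum_(i < k.+1) (q l).[x i] * coef L a b (horner (e i)) m).
    apply: Rint_eq => l; rewrite /= in_itv/= andbT => l0; rewrite -coef_lin_sum; last by move=> i; exact: horner_cont.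
    congr (coef _ _ _ _ _); apply/funext => y; rewrite {1}(xe _ (sq l l0)) horner_sum.
    by apply: eq_bigr => i _; rewrite hornerZ.
  rewrite Rint_sum//.
    by apply: eq_bigr => i _; rewrite RintegralZr//; exact: iq.
  by move=> i _; apply: (@intgZr _ _ mP); exact: iq.
rewrite -coef_lin_sum; last by move=> i; exact: horner_cont.
rewrite [RHS]mulrCA /coef -[in RHS]RintegralZl//; last first.
  by apply: contw_intg; apply: contw_fpoly; apply: continuous_subspaceT => y; apply: cont_sum => i _;
    apply: contZ; exact: horner_cont.
congr (_ * _); apply: Rint_eq => y yab.
have -> : \sum_(i < k.+1) I i * (e i).[y] = \int[mu]_(l in Rpos) (q l).[y].
  transitivity (\int[mu]_(l in Rpos) \sum_(i < k.+1) (q l).[x i] * (e i).[y]).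
    rewrite Rint_sum//; last by move=> i _; apply: (@intgZr _ _ mP); exact: iq.
    by apply: eq_bigr => i _; rewrite RintegralZr//; exact: iq.
  apply: Rint_eq => l; rewrite /= in_itv/= andbT => l0.
  by rewrite [in RHS](xe _ (sq l l0)) horner_sum; apply: eq_bigr => i _; rewrite hornerZ.
rewrite mulrA -RintegralZl//; last exact: iq.
rewrite -RintegralZr//; first by apply: intgZ => //; exact: iq.
Qed.
End Interpolation.

(** * The upwind forms *)

Section LinearForms.
Context {R : realType} (T : finType).

(** This class is closed under linear combinations and contains the coordinates,
    which proves [field_form] for the upwind forms. *)
Definition linear_form (b : (T -> R) -> (T -> R) -> R) : Prop :=
  (forall y x y' x', b (fun k => y k - y' k) (fun k => x k - x' k) = b y x - b y' x') /\
  (forall (Y X : T -> R -> R) y x (t : R),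
    (forall k, is_derive t 1 (Y k) (y k)) -> (forall k, is_derive t 1 (X k) (x k)) ->
    is_derive t 1 (fun u => b (Y ^~ u) (X ^~ u)) (b y x)).

Lemma linear_form_y i : linear_form (fun y _ => y i).
Proof. by split => // Y X y x t hY _; exact: hY. Qed.

Lemma linear_form_x i : linear_form (fun _ x => x i).
Proof. by split => // Y X y x t _ hX; exact: hX. Qed.

Lemma linear_formD b b' : linear_form b -> linear_form b' -> linear_form (fun y x => b y x + b' y x).
Proof.
move=> [s d] [s' d']; split; first by move=> *; rewrite s s'; ring.
by move=> Y X y x t hY hX; have h1 := d _ _ _ _ _ hY hX; have h2 := d' _ _ _ _ _ hY hX; apply: deriD.
Qed.

Lemma linear_formZ c b : linear_form b -> linear_form (fun y x => c * b y x).
Proof.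
move=> [s d]; split; first by move=> *; rewrite s mulrBr.
by move=> Y X y x t hY hX; have h1 := d _ _ _ _ _ hY hX; apply: deriZ.
Qed.

Lemma linear_formZr c b : linear_form b -> linear_form (fun y x => b y x * c).
Proof.
move=> /(linear_formZ c); congr linear_form.
by apply/funext => y; apply/funext => x; rewrite mulrC.
Qed.

Lemma linear_formB b b' : linear_form b -> linear_form b' -> linear_form (fun y x => b y x - b' y x).
Proof.
move=> fb /(linear_formZ (-1)) fb'; have := linear_formD fb fb'; congr linear_form.
by apply/funext => y; apply/funext => x; rewrite mulN1r.
Qed.

Lemma linear_form_sum n (b : 'I_n -> (T -> R) -> (T -> R) -> R) :
  (forall i, linear_form (b i)) -> linear_form (fun y x => \sum_(i < n) b i y x).
Proof.
move=> fb; split.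
  by move=> y x y' x'; rewrite -sumrB; apply: eq_bigr => i _; have [s _] := fb i; exact: s.
by move=> Y X y x t hY hX; apply: deri_sum => i _; have [_ d] := fb i; exact: d.
Qed.

Lemma field_formP B : (forall i, linear_form (fun y x => B y x i)) -> field_form B.
Proof. by move=> fB; split => [y x y' x' i|Y X y x t i hY hX]; have [s d] := fB i; [exact: s|exact: d]. Qed.

End LinearForms.

Section UpwindForms.
Context {R : realType}.
Variables (k M : nat) (L : nat -> {poly R}).
Variables (Z h : R).
Hypotheses (Z0 : 0 < Z) (h0 : 0 < h).
Local Notation T := ('I_M * 'I_k.+1)%type.
Implicit Types (x y : T -> R) (i : T).

(** Traces at the right end of the cell j, from the next cell and from the cell
    itself, in coordinates. *)
Definition cplus y (j : 'I_M) := \sum_(n < k.+1) y (ordS j, n) * (L n).[0].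
Definition cminus y (j : 'I_M) := \sum_(n < k.+1) y (j, n) * (L n).[1].
Definition cfluxE y x j :=
  2^-1 * (cplus y j + cminus y j) + 2^-1 * Z * (cplus x j - cminus x j).
Definition cfluxH y x j :=
  2^-1 * (cplus x j + cminus x j) + 2^-1 * Z^-1 * (cplus y j - cminus y j).
Definition cvol y i := \sum_(n < k.+1) y (i.1, n) * pint (L n * (L i.2)^`()).
Definition formE y x i :=
  h^-1 * (cvol y i - cfluxE y x i.1 * (L i.2).[1] + cfluxE y x (ord_pred i.1) * (L i.2).[0]).
Definition formH y x i :=
  h^-1 * (cvol x i - cfluxH y x i.1 * (L i.2).[1] + cfluxH y x (ord_pred i.1) * (L i.2).[0]).

Let lf_y n (f : 'I_n -> T) (c : 'I_n -> R) : linear_form (fun y (_ : T -> R) => \sum_(m < n) y (f m) * c m).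
Proof. by apply: linear_form_sum => m; apply: linear_formZr; exact: linear_form_y. Qed.

Let lf_x n (f : 'I_n -> T) (c : 'I_n -> R) : linear_form (fun (_ : T -> R) x => \sum_(m < n) x (f m) * c m).
Proof. by apply: linear_form_sum => m; apply: linear_formZr; exact: linear_form_x. Qed.

Let lf_fluxE j : linear_form (fun y x => cfluxE y x j).
Proof.
apply: linear_formD; apply: linear_formZ; [apply: linear_formD|apply: linear_formB].
- exact: (lf_y (fun n => (ordS j, n)) (fun n => (L n).[0])).
- exact: (lf_y (fun n => (j, n)) (fun n => (L n).[1])).
- exact: (lf_x (fun n => (ordS j, n)) (fun n => (L n).[0])).
- exact: (lf_x (fun n => (j, n)) (fun n => (L n).[1])).
Qed.

Let lf_fluxH j : linear_form (fun y x => cfluxH y x j).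
Proof.
apply: linear_formD; apply: linear_formZ; [apply: linear_formD|apply: linear_formB].
- exact: (lf_x (fun n => (ordS j, n)) (fun n => (L n).[0])).
- exact: (lf_x (fun n => (j, n)) (fun n => (L n).[1])).
- exact: (lf_y (fun n => (ordS j, n)) (fun n => (L n).[0])).
- exact: (lf_y (fun n => (j, n)) (fun n => (L n).[1])).
Qed.

Lemma formE_field : field_form formE.
Proof.
apply: field_formP => i; apply: linear_formZ; apply: linear_formD; last first.
  by apply: linear_formZr; exact: lf_fluxE.
apply: linear_formB; last by apply: linear_formZr; exact: lf_fluxE.
exact: (lf_y (fun n => (i.1, n)) (fun n => pint (L n * (L i.2)^`()))).
Qed.

Lemma formH_field : field_form formH.
Proof.
apply: field_formP => i; apply: linear_formZ; apply: linear_formD; last first.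
  by apply: linear_formZr; exact: lf_fluxH.
apply: linear_formB; last by apply: linear_formZr; exact: lf_fluxH.
exact: (lf_x (fun n => (i.1, n)) (fun n => pint (L n * (L i.2)^`()))).
Qed.

Let cpoly y j : {poly R} := \sum_(n < k.+1) y (j, n) *: L n.

Let cpoly_at y j c : (cpoly y j).[c] = \sum_(n < k.+1) y (j, n) * (L n).[c].
Proof. by rewrite /cpoly horner_sum; apply: eq_bigr => n _; rewrite hornerZ. Qed.

Let pintZZ (c d : R) (p q : {poly R}) : pint (c *: p * (d *: q)) = c * d * pint (p * q).
Proof. by rewrite -scalerAl pintZ -scalerAr pintZ mulrA. Qed.

Let vol_sum y x j :
  \sum_(m < k.+1) cvol y (j, m) * x (j, m) = pint (cpoly y j * (cpoly x j)^`()).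
Proof.
rewrite {2}/cpoly raddf_sum/= mulr_sumr pint_sum; apply: eq_bigr => m _.
rewrite /cpoly derivZ [in RHS]mulr_suml pint_sum /cvol mulr_suml; apply: eq_bigr => n _.
by rewrite pintZZ /=; ring.
Qed.

Let pint_parts (p q : {poly R}) :
  pint (p * q^`()) + pint (q * p^`()) = p.[1] * q.[1] - p.[0] * q.[0].
Proof.
rewrite -pintD; have -> : p * q^`() + q * p^`() = (p * q)^`() by rewrite derivM; ring.
rewrite /pint; have -> : primp (p * q)^`() = p * q - ((p * q)`_0)%:P.
  apply/polyP => -[|i]; rewrite coef_primp coefB coefC/= ?subrr// subr0 coef_deriv.
  by rewrite -[X in X / _]mulr_natr mulfK// pnatr_eq0.
by rewrite hornerD hornerN hornerC -horner_coef0 !hornerM.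
Qed.

(** The volume terms sum up to boundary terms, which cancel against the central
    part of the fluxes after a cyclic shift of the cells.  The upwind part leaves
    Z [H]^2 / 2 + [E]^2 / (2 Z) at each node. *)
Lemma upwind_dissipation y x :
  0 <= \sum_(i : T) (formE y x i * x i + formH y x i * y i).
Proof.
pose Xl j := (cpoly x j).[0]; pose Xr j := (cpoly x j).[1].
pose Yl j := (cpoly y j).[0]; pose Yr j := (cpoly y j).[1].
pose G j := cfluxE y x (ord_pred j) * Xl j + cfluxH y x (ord_pred j) * Yl j - Xl j * Yl j.
have cellE j : \sum_(m < k.+1) (formE y x (j, m) * x (j, m) + formH y x (j, m) * y (j, m)) =
    h^-1 * (Xr j * Yr j - cfluxE y x j * Xr j - cfluxH y x j * Yr j + G j).
  have sx c : \sum_(m < k.+1) (L m).[c] * x (j, m) = (cpoly x j).[c].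
    by rewrite cpoly_at; apply: eq_bigr => m _; rewrite mulrC.
  have sy c : \sum_(m < k.+1) (L m).[c] * y (j, m) = (cpoly y j).[c].
    by rewrite cpoly_at; apply: eq_bigr => m _; rewrite mulrC.
  have hE : \sum_(m < k.+1) formE y x (j, m) * x (j, m) =
      h^-1 * (pint (cpoly y j * (cpoly x j)^`()) - cfluxE y x j * Xr j + cfluxE y x (ord_pred j) * Xl j).
    rewrite -vol_sum /Xr /Xl -!sx !mulr_sumr -sumrB -big_split mulr_sumr/=.
    by apply: eq_bigr => m _; rewrite /formE/=; ring.
  have hH : \sum_(m < k.+1) formH y x (j, m) * y (j, m) =
      h^-1 * (pint (cpoly x j * (cpoly y j)^`()) - cfluxH y x j * Yr j + cfluxH y x (ord_pred j) * Yl j).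
    rewrite -vol_sum /Yr /Yl -!sy !mulr_sumr -sumrB -big_split mulr_sumr/=.
    by apply: eq_bigr => m _; rewrite /formH/=; ring.
  rewrite big_split/= hE hH -mulrDr; congr (_ * _).
  have := pint_parts (cpoly y j) (cpoly x j); rewrite -/(Xl j) -/(Xr j) -/(Yl j) -/(Yr j) /G.
  move: (pint _) (pint _) => u v huv; rewrite (_ : v = Yr j * Xr j - Yl j * Xl j - u); last by rewrite -huv; ring.
  ring.
rewrite (eq_bigr (fun i : T => formE y x (i.1, i.2) * x (i.1, i.2) + formH y x (i.1, i.2) * y (i.1, i.2)));
  last by move=> [].
rewrite -(pair_bigA _ (fun j m => formE y x (j, m) * x (j, m) + formH y x (j, m) * y (j, m)))/=.
rewrite (eq_bigr _ (fun j _ => cellE j)) -mulr_sumr mulr_ge0 ?invr_ge0 ?(ltW h0)//.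
rewrite big_split/= [X in _ + X](reindex_inj (@ordS_inj M))/= -big_split/=.
apply: sumr_ge0 => j _; rewrite /G ordSK.
have -> : Xr j = cminus x j by rewrite /Xr cpoly_at.
have -> : Yr j = cminus y j by rewrite /Yr cpoly_at.
have -> : Xl (ordS j) = cplus x j by rewrite /Xl cpoly_at.
have -> : Yl (ordS j) = cplus y j by rewrite /Yl cpoly_at.
rewrite /cfluxE /cfluxH; move: (cminus x j) (cplus x j) (cminus y j) (cplus y j) => a b c d.
rewrite [leRHS](_ : _ = 2^-1 * (Z * (b - a) ^+ 2 + Z^-1 * (d - c) ^+ 2)); last by field; rewrite gt_eqF.
by rewrite mulr_ge0// addr_ge0// mulr_ge0 ?sqr_ge0 ?invr_ge0 ?(ltW Z0).
Qed.

End UpwindForms.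

(** * The mesh and the L2 norm *)

Section Mesh.
Context {R : realType}.
Variables (xl xr : R) (M : nat).
Hypotheses (xlr : xl < xr) (M0 : (0 < M)%N).
Local Notation h := (mesh_size xl xr M).
Local Notation nd := (node xl xr M).

Lemma mesh_size_gt0 : 0 < h.
Proof. by rewrite /mesh_size divr_gt0 ?subr_gt0// ltr0n. Qed.

Lemma mesh_sizeM : M%:R * h = xr - xl.
Proof. by rewrite /mesh_size mulrCA divff ?mulr1// pnatr_eq0 -lt0n. Qed.

Lemma node0 : nd 0 = xl. Proof. by rewrite /node mul0r addr0. Qed.

Lemma nodeM : nd M = xr. Proof. by rewrite /node mesh_sizeM addrC subrK. Qed.

Lemma node_step j : nd j.+1 - nd j = h.
Proof. by rewrite /node -[j.+1]addn1 natrD; ring. Qed.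

Lemma node_le i j : (i <= j)%N -> nd i <= nd j.
Proof. by move=> ij; rewrite /node lerD2l ler_wpM2r ?(ltW mesh_size_gt0)// ler_nat. Qed.

Lemma node_lt j : nd j < nd j.+1.
Proof. by rewrite -subr_gt0 node_step mesh_size_gt0. Qed.

Lemma node_ge_l j : xl <= nd j.
Proof. by have := node_le (leq0n j); rewrite node0. Qed.

Lemma node_le_r j : (j <= M)%N -> nd j <= xr.
Proof. by move=> jM; have := node_le jM; rewrite nodeM. Qed.

Lemma cell_of x : xl <= x -> x < xr -> exists j : 'I_M, x \in `[nd j, nd j.+1[.
Proof.
move=> lx xr'; suff : forall n, x < nd n -> exists2 j, (j < n)%N & x \in `[nd j, nd j.+1[.
  by move=> /(_ M); rewrite nodeM => /(_ xr')[j jM xj]; exists (Ordinal jM).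
elim=> [|n IH]; first by rewrite node0 ltNge lx.
move=> xn; have [/IH[j jn xj]|nx] := ltP x (nd n); first by exists j => //; exact: ltnW.
by exists n => //; rewrite in_itv/= nx.
Qed.

Lemma cell_uniq x (i j : 'I_M) : x \in `[nd i, nd i.+1[ -> x \in `[nd j, nd j.+1[ -> i = j.
Proof.
have H (a b : 'I_M) : x \in `[nd a, nd a.+1[ -> x \in `[nd b, nd b.+1[ -> (a <= b)%N.
  rewrite !in_itv/= => /andP[ax _] /andP[_ xb]; rewrite leqNgt; apply/negP => ba.
  by have := lt_le_trans xb (node_le ba); rewrite ltNge ax.
by move=> xi xj; apply/val_inj/eqP; rewrite eqn_leq !H.
Qed.

Lemma pw_evalE (v : @piecewise R M) x (j : 'I_M) : x \in `[nd j, nd j.+1[ ->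
  pw_eval xl xr v x = (v j).[x].
Proof.
move=> xj; rewrite /pw_eval (bigD1 j)//= xj big1 ?addr0// => i ij.
by case: ifPn => // xi; rewrite (cell_uniq xi xj) eqxx in ij.
Qed.
End Mesh.

Section L2Error.
Context {R : realType}.
Local Notation mu := (@lebesgue_measure R).

Lemma L2norm_sqr (a b : R) (g : R -> R) :
  (L2norm a b g ^+ 2 = \int[mu]_(x in `[a, b]) (g x ^+ 2)%:E)%E.
Proof.
have sq (X : \bar R) : (0 <= X)%E -> (X ^+ 2 = X `^ 2)%E.
  case: X => [r|//|//].
    by rewrite lee_fin => r0; rewrite poweR_EFin -EFin_expe powR_mulrn.
  by move=> _; rewrite poweRyr// expe2 mulyy.
rewrite sq; last exact: Lnorm_ge0.
rewrite /L2norm powR_Lnorm// [RHS]integral_mkcond; apply: eq_integral => x _.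
rewrite !patchE; case: ifPn => _; last by rewrite abse0 poweR0r// pnatr_eq0.
by rewrite [abse _]/= poweR_EFin powR_mulrn// real_normK ?num_real.
Qed.

Variables (xl xr : R) (M : nat).
Hypotheses (xlr : xl < xr) (M0 : (0 < M)%N).
Local Notation h := (mesh_size xl xr M).
Local Notation nd := (node xl xr M).
Variables (k : nat) (L : nat -> {poly R}).
Hypothesis HL : orthonormal_upto k.+1 L.
Local Notation T := ('I_M * 'I_k.+1)%type.

(** The error is bounded pointwise by D plus a polynomial with coordinates c, and
    the square norm of the latter is given by [bas_parseval]. *)
Lemma L2_error_le (u G : R -> R) (v : @piecewise R M) (c : T -> R) (D : R) : 0 <= D ->
  continuous G -> (forall x, x \in `[xl, xr] -> u x = G x) ->
  (forall (j : 'I_M) x, x \in `[nd j, nd j.+1] ->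
    `|G x - (v j).[x] - \sum_(m < k.+1) c (j, m) * (bas L (nd j) (nd j.+1) m).[x]| <= D) ->
  (L2norm xl xr (fun x => u x - pw_eval xl xr v x)%R ^+ 2 <=
   (2 * D ^+ 2 * (xr - xl) + 2 * (h * \sum_(i : T) c i ^+ 2))%:E)%E.
Proof.
move=> D0 cG uG hD; rewrite L2norm_sqr.
pose S (j : 'I_M) x := \sum_(m < k.+1) c (j, inord m) * (bas L (nd j) (nd j.+1) m).[x].
have SE j x : \sum_(m < k.+1) c (j, m) * (bas L (nd j) (nd j.+1) m).[x] = S j x.
  by apply: eq_bigr => m _; rewrite inord_val.
pose w j x := 2 * D ^+ 2 + 2 * S j x ^+ 2.
pose g x := G x - pw_eval xl xr v x.
have cS j : continuous (S j).
  by move=> x; apply: cont_sum => m _; apply: contZ; exact: horner_cont.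
have cS2 j : continuous (fun x => S j x ^+ 2) by move=> x; exact: (contM (cS j x) (cS j x)).
have cw j : continuous (w j).
  move=> x; have c2 := contM (cS j x) (cS j x).
  have c1 : {for x, continuous (fun _ : R => 2 * D ^+ 2)} by exact: cvg_cst.
  exact: (contD c1 (@contZ _ 2 _ _ c2)).
have mpw : measurable_fun setT (pw_eval xl xr v).
  apply: measurable_sum => j; apply: measurable_fun_ifT => //.
  - by apply: (measurable_fun_bool true); rewrite setTI [X in measurable X](_ : _ = `[nd j, nd j.+1[%classic).
  - by apply: continuous_measurable_fun; exact: horner_cont.
have mg : measurable_fun setT (fun x => g x ^+ 2).
  by apply: measurable_funX; apply: measurable_funB => //; exact: continuous_measurable_fun.
have -> : (\int[mu]_(x in `[xl, xr]) ((u x - pw_eval xl xr v x)%R ^+ 2)%:E =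
    \int[mu]_(x in `[xl, xr]) (g x ^+ 2)%:E)%E.
  by apply: eq_integral => x; rewrite inE/= => xI; rewrite uG.
rewrite -integral_itv_bndo_bndc; last by apply/measurable_EFinP; exact: measurable_funTS.
have key x : x \in `[xl, xr[ -> 
    ((g x ^+ 2)%:E <= \sum_(j < M) ((EFin \o w j) \_ `[nd j, nd j.+1[) x)%E.
  rewrite in_itv/= => /andP[lx xr']; have [j xj] := cell_of M0 lx xr'.
  rewrite (bigD1 j)//= patchE mem_set// big1 ?adde0; last first.
    move=> i ij; rewrite patchE memNset// => xi.
    by rewrite (cell_uniq xlr M0 xi xj) eqxx in ij.
  rewrite /g (pw_evalE xlr M0 _ xj) /w /= lee_fin.
  have xc : x \in `[nd j, nd j.+1] by exact: subset_itv_co_cc.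
  have := hD j x xc; rewrite SE; set p := G x - _; set q := S j x.
  move=> hpq; have : (p - q) ^+ 2 <= D ^+ 2 by rewrite -real_normK ?num_real// lerXn2r ?nnegrE.
  by move=> h1; have := sqr_ge0 (p - q - q); nra.
have mI j : measurable (`[nd j, nd j.+1[%classic : set R) by exact: measurable_itv.
have w0 (j : 'I_M) x : 0 <= w j x by rewrite addr_ge0// mulr_ge0// sqr_ge0.
have p0 (j : 'I_M) x : (0 <= ((EFin \o w j) \_ `[nd j, nd j.+1[) x)%E.
  by rewrite patchE; case: ifPn => // _; rewrite lee_fin.
have mp (j : 'I_M) : measurable_fun `[xl, xr[ ((EFin \o w j) \_ `[nd j, nd j.+1[).
  apply: measurable_funTS; apply/(measurable_restrictT _ _).1; first exact: mI.
  by apply: measurable_funTS; apply/measurable_EFinP; exact: continuous_measurable_fun.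
apply: (@le_trans _ _ (\int[mu]_(x in `[xl, xr[) (\sum_(j < M) ((EFin \o w j) \_ `[nd j, nd j.+1[) x))%E).
  apply: ge0_le_integral => //.
  - by move=> x _; rewrite lee_fin sqr_ge0.
  - by apply/measurable_EFinP; exact: measurable_funTS.
  - by apply: emeasurable_sum => j; exact: mp.
rewrite ge0_integral_sum//.
rewrite (eq_bigr (fun j : 'I_M => (h * (2 * D ^+ 2) + 2 * (h * \sum_(m < k.+1) c (j, m) ^+ 2))%:E)); last first.
  move=> j _; rewrite -integral_mkcondr.
  have -> : `[xl, xr[%classic `&` `[nd j, nd j.+1[%classic = `[nd j, nd j.+1[%classic.
    apply/seteqP; split => x /=; first by case.
    move=> xj; split => //; move: xj; rewrite /= !in_itv/= => /andP[h1 h2].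
    rewrite (le_trans (node_ge_l xlr M0 j) h1)/=.
    exact: lt_le_trans h2 (node_le_r xlr M0 (ltn_ord j)).
  rewrite integral_itv_bndo_bndc; last first.
    by apply: measurable_funTS; apply/measurable_EFinP; exact: continuous_measurable_fun.
  have ndl := node_lt xlr M0 j.
  have ic (f : R -> R) : continuous f -> mu.-integrable `[nd j, nd j.+1] (EFin \o f).
    by move=> cf; apply: cont_itv_integrable; exact: continuous_subspaceT.
  rewrite intg_EFin//; last exact: ic.
  congr EFin; rewrite /w RintegralD//; last 2 first.
  - by apply: ic => x; exact: cvg_cst.
  - by apply: ic => x; have c2 := contM (cS j x) (cS j x); have := @contZ _ 2 _ _ c2.
  rewrite Rintegral_cst// RintegralZl//; last exact: ic (cS2 j).
  rewrite (bas_parseval HL ndl (fun m => c (j, inord m))) node_step.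
  rewrite [LHS](_ : _ = h * (2 * D ^+ 2) + 2 * (h * \sum_(m < k.+1) c (j, inord m) ^+ 2)).
    by congr (_ + _ * (_ * _)); apply: eq_bigr => m _; rewrite inord_val.
  congr (_ + _); rewrite mulrC; congr (_ * _).
  by rewrite /= lebesgue_measure_itv/= lte_fin ndl -EFinD/= node_step.
rewrite sumEFin lee_fin big_split/= sumr_const card_ord.
have -> : h * (2 * D ^+ 2) *+ M = 2 * D ^+ 2 * (xr - xl).
  by rewrite -mulr_natl -(mesh_sizeM xl xr M0); ring.
rewrite -!mulr_sumr lerD2l le_eqVlt; apply/orP; left; apply/eqP; congr (_ * (_ * _)).
by rewrite pair_bigA/=; apply: eq_bigr => -[].
Qed.
End L2Error.

(** * Coordinates on one cell *)

Section CellCoordinates.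
Context {R : realType}.
Local Notation mu := (@lebesgue_measure R).
Variables (k : nat) (L : nat -> {poly R}).
Hypothesis HL : orthonormal_upto k.+1 L.
Variables a b : R.
Hypothesis ab : a < b.
Local Notation coef := (coef L a b).
Local Notation bas := (bas L a b).
Implicit Types f : R -> R.

Lemma end_resZ c (d : R) f : {within `[a, b], continuous f} ->
  end_res k L a b c (fun x => d * f x) = d * end_res k L a b c f.
Proof.
move=> cf; rewrite /end_res mulrA; congr (_ / _); rewrite /l2res mulrBr; congr (_ - _).
by rewrite mulr_sumr; apply: eq_bigr => m _; rewrite mulrA (coefZ_fun _ _ _ cf).
Qed.

Lemma coef_comb (p q : {poly R}) (s : R) m :
  coef (horner (s *: p + s *: q)) m = s * (coef (horner p) m + coef (horner q) m).
Proof.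
have cp (r : {poly R}) : {within `[a, b], continuous (horner r)} by exact: contw_poly.
rewrite (@coef_ext _ _ _ _ _ (fun x => s * p.[x] + s * q.[x])); last first.
  by move=> x _; rewrite hornerD !hornerZ.
by rewrite coefD_fun ?coefZ_fun ?mulrDr//; exact: contwZ.
Qed.

Lemma radau_value c f : (bas k).[c] != 0 ->
  \sum_(n < k.+1) (coef f n + (n == k :> nat)%:R * end_res k L a b c f) * (bas n).[c] = f c.
Proof.
move=> Lc; rewrite big_ord_recr/= eqxx mul1r mulrDl /end_res divfK// /l2res big_ord_recr/=.
rewrite (eq_bigr (fun i : 'I_k => coef f i * (bas i).[c])); last first.
  by move=> i _; rewrite (ltn_eqF (ltn_ord i)) mul0r addr0.
by set S := \sum_(_ < _) _; ring.
Qed.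

Lemma size_deriv_bas m : (m <= k)%N -> (size (L m)^`() <= k)%N.
Proof.
move=> mk; have sL := HL.1 m mk; apply: leq_trans mk.
by rewrite -ltnS -sL; apply: lt_size_deriv; rewrite -size_poly_eq0 sL.
Qed.

(** Why the shift of the top mode does not enter the volume terms. *)
Lemma top_volume m : (m <= k)%N -> pint (L k * (L m)^`()) = 0.
Proof. by move=> mk; exact: (orthonormal_low HL (leqnn k) (size_deriv_bas mk)). Qed.

Lemma coef_deriv_expand f m : {within `[a, b], continuous f} -> (m <= k)%N ->
  \int[mu]_(x in `[a, b]) (f x * (bas m)^`().[x]) =
  \sum_(n < k.+1) coef f n * pint (L n * (L m)^`()).
Proof.
move=> cf mk; have ba : b - a != 0 by rewrite subr_eq0 gt_eqF.
have sb : (size (bas m)^`() <= k.+1)%N.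
  by apply: leq_trans (size_poly _ _) _; rewrite (size_bas HL ab mk) /= ltnW.
rewrite (@Rint_eq _ _ _ (fun x => \sum_(n < k.+1)
   coef (horner (bas m)^`()) n * (f x * (bas n).[x]))); last first.
  move=> x _; rewrite {1}(poly_bas HL ab sb) horner_sum mulr_sumr; apply: eq_bigr => n _.
  by rewrite hornerZ mulrCA.
rewrite Rint_sum//; last first.
  by move=> n _; apply: contw_intg; apply: contwZ; exact: contw_fpoly.
apply: eq_bigr => n _; rewrite RintegralZl//; last by apply: contw_intg; exact: contw_fpoly.
rewrite (int_coef L ab) mulrA mulrC; congr (_ * _).
rewrite mulrC -(bas_deriv_int L ab) -(int_coef L ab).
by apply: Rint_eq => x _; rewrite mulrC.
Qed.

Lemma poly_trace (q : {poly R}) c : (size q <= k.+1)%N ->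
  \sum_(n < k.+1) coef (horner q) n * (bas n).[c] = q.[c].
Proof.
by move=> sq; rewrite {2}(poly_bas HL ab sq) horner_sum; apply: eq_bigr => n _; rewrite hornerZ.
Qed.

End CellCoordinates.

(** * Coordinates of the exact solution *)

Section ExactCoordinates.
Context {R : realType}.
Local Notation mu := (@lebesgue_measure R).
Variables (xl xr : R) (k M : nat) (L : nat -> {poly R}) (Z : R).
Hypotheses (xlr : xl < xr) (M0 : (0 < M)%N) (Z0 : 0 < Z).
Hypothesis HL : orthonormal_upto k.+1 L.
Local Notation h := (mesh_size xl xr M).
Local Notation nd := (node xl xr M).
Local Notation T := ('I_M * 'I_k.+1)%type.
Local Notation field := (nat -> nat -> R -> R -> R).
Implicit Types (i : T) (j : 'I_M) (t : R) (f g : R -> R).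

Definition cell_coef j f m := coef L (nd j) (nd j.+1) f m.
Definition cell_end_res c j f := end_res k L (nd j) (nd j.+1) c f.

(** The equations hold in the open domain only, and the data F1, F2, F3 are
    arbitrary at its ends. *)
Lemma coef_ext_oo (a b : R) f g m : {in `]a, b[, f =1 g} -> continuous g ->
  coef L a b f m = coef L a b g m.
Proof.
move=> fg cg; rewrite /coef; congr (_ * _).
have cgb : continuous (fun x => g x * (bas L a b m).[x]).
  by move=> x; exact: (contM (cg x) (@horner_cont _ (bas L a b m) x)).
have mg : measurable_fun (`]a, b[ : set R) (fun x => g x * (bas L a b m).[x]).
  exact: cont_measurable.
have e : {in (`]a, b[%classic : set R), (fun x => g x * (bas L a b m).[x]) =1 (fun x => f x * (bas L a b m).[x])}.
  by move=> x; rewrite inE/= => xab; rewrite fg.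
rewrite !Rint_itv_oo//; last exact: eq_measurable_fun e mg.
by apply: Rint_eq => x xab; rewrite fg.
Qed.

Let ndl j : nd j < nd j.+1. Proof. exact: node_lt. Qed.
Let ndh j : nd j.+1 - nd j = h. Proof. exact: node_step. Qed.
Let h0 : 0 < h. Proof. exact: mesh_size_gt0. Qed.

Let bl j : (bas L (nd j) (nd j.+1) k).[nd j] != 0.
Proof. by rewrite bas_left; have [] := top_end_neq0 HL. Qed.

Let br j : (bas L (nd j) (nd j.+1) k).[nd j.+1] != 0.
Proof. by rewrite bas_right//; have [] := top_end_neq0 HL. Qed.

Lemma node_periodic (g : R -> R) j : g xl = g xr -> g (nd (ordS j)) = g (nd j.+1).
Proof.
move=> gp /=; have := ltn_ord j; rewrite leq_eqVlt => /orP[/eqP e|jM]; last by rewrite modn_small.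
by rewrite e modnn nodeM// node0.
Qed.

Lemma node_pred_periodic (g : R -> R) j : g xl = g xr -> g (nd (ord_pred j).+1) = g (nd j).
Proof. by move=> gp; rewrite -node_periodic// ord_predK. Qed.

Variables GE GH : field.
Hypotheses (SE : smooth_field xl xr k.+1 GE) (SH : smooth_field xl xr k.+1 GH).
Hypotheses (perE : forall t, 0 <= t -> GE 0%N 0%N xl t = GE 0%N 0%N xr t).
Hypotheses (perH : forall t, 0 <= t -> GH 0%N 0%N xl t = GH 0%N 0%N xr t).

(** The characteristic variables. *)
Definition Wp : field := fun n q x t => GE n q x t + Z * GH n q x t.
Definition Wm : field := fun n q x t => GE n q x t + - Z * GH n q x t.

Lemma smooth_Wp : smooth_field xl xr k.+1 Wp. Proof. exact: field_lin. Qed.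
Lemma smooth_Wm : smooth_field xl xr k.+1 Wm. Proof. exact: field_lin. Qed.

Definition top_mode i : R := (i.2 == k :> nat)%:R.
(** The index q is the order of the time derivative, 0 or 1. *)
Definition end_plus q i t := cell_end_res (nd i.1) i.1 (Wp 0%N q ^~ t).
Definition end_minus q i t := cell_end_res (nd i.1.+1) i.1 (Wm 0%N q ^~ t).
Definition radau_p q i t := cell_coef i.1 (Wp 0%N q ^~ t) i.2 + top_mode i * end_plus q i t.
Definition radau_m q i t := cell_coef i.1 (Wm 0%N q ^~ t) i.2 + top_mode i * end_minus q i t.
(** Written with the coefficients 1 and -1 so that [cplus_lin] and [cminus_lin]
    apply to both projections. *)
Definition projE q i t := 2^-1 * (radau_p q i t + 1 * radau_m q i t).
Definition projH q i t := 2^-1 / Z * (radau_p q i t + -1 * radau_m q i t).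
(** The difference between the projections of E and H and the L2 projections: it
    only lives in the top mode. *)
Definition top_shiftE q i t := top_mode i * (2^-1 * (end_plus q i t + end_minus q i t)).
Definition top_shiftH q i t := top_mode i * (2^-1 / Z * (end_plus q i t - end_minus q i t)).

Section at_time.
Variables (q : nat) (t : R).
Hypothesis q1 : (q <= 1)%N.

Let cwE j : {within `[nd j, nd j.+1], continuous (GE 0%N q ^~ t)}.
Proof. by apply: jcontw; apply: (sf_cont SE). Qed.

Let cwH j : {within `[nd j, nd j.+1], continuous (GH 0%N q ^~ t)}.
Proof. by apply: jcontw; apply: (sf_cont SH). Qed.

Let cWp i : cell_coef i.1 (Wp 0%N q ^~ t) i.2 = cell_coef i.1 (GE 0%N q ^~ t) i.2 + Z * cell_coef i.1 (GH 0%N q ^~ t) i.2.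
Proof. by rewrite /cell_coef /Wp coefD_fun ?coefZ_fun//; exact: contwZ. Qed.

Let cWm i : cell_coef i.1 (Wm 0%N q ^~ t) i.2 = cell_coef i.1 (GE 0%N q ^~ t) i.2 + - Z * cell_coef i.1 (GH 0%N q ^~ t) i.2.
Proof. by rewrite /cell_coef /Wm coefD_fun ?coefZ_fun//; exact: contwZ. Qed.

Lemma projE_dec i : projE q i t = cell_coef i.1 (GE 0%N q ^~ t) i.2 + top_shiftE q i t.
Proof. by rewrite /projE /radau_p /radau_m /top_shiftE cWp cWm; field. Qed.

Lemma projH_dec i : projH q i t = cell_coef i.1 (GH 0%N q ^~ t) i.2 + top_shiftH q i t.
Proof. by rewrite /projH /radau_p /radau_m /top_shiftH cWp cWm; field; rewrite gt_eqF. Qed.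

End at_time.

Lemma cplus_lin (s s' : R) (y x : T -> R) j :
  cplus L (fun i => s * (y i + s' * x i)) j = s * (cplus L y j + s' * cplus L x j).
Proof.
rewrite /cplus !mulr_sumr -big_split mulr_sumr; apply: eq_bigr => n _ /=; ring.
Qed.

Lemma cminus_lin (s s' : R) (y x : T -> R) j :
  cminus L (fun i => s * (y i + s' * x i)) j = s * (cminus L y j + s' * cminus L x j).
Proof.
rewrite /cminus !mulr_sumr -big_split mulr_sumr; apply: eq_bigr => n _ /=; ring.
Qed.

Lemma cplus_radau_p j t : 0 <= t -> cplus L (radau_p 0 ^~ t) j = Wp 0%N 0%N (nd j.+1) t.
Proof.
move=> t0; have pW : Wp 0%N 0%N xl t = Wp 0%N 0%N xr t by rewrite /Wp perE// perH.
transitivity (Wp 0%N 0%N (nd (ordS j)) t); last exact: (node_periodic (g := Wp 0%N 0%N ^~ t)).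
rewrite -[RHS](radau_value (Wp 0%N 0%N ^~ t) (bl (ordS j))).
by apply: eq_bigr => n _; rewrite bas_left.
Qed.

Lemma cminus_radau_m j t : cminus L (radau_m 0 ^~ t) j = Wm 0%N 0%N (nd j.+1) t.
Proof.
rewrite -[RHS](radau_value (Wm 0%N 0%N ^~ t) (br j)).
by apply: eq_bigr => n _; rewrite bas_right.
Qed.

(** The plus trace of E + Z H and the minus trace of E - Z H are exact, and the
    upwind flux is a combination of these two values. *)
Lemma exact_fluxE j t : 0 <= t -> cfluxE L Z (projE 0 ^~ t) (projH 0 ^~ t) j = GE 0%N 0%N (nd j.+1) t.
Proof.
move=> t0; rewrite /cfluxE /projE /projH !cplus_lin !cminus_lin cplus_radau_p// cminus_radau_m /Wp /Wm.
by field; rewrite gt_eqF.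
Qed.

Lemma exact_fluxH j t : 0 <= t -> cfluxH L Z (projE 0 ^~ t) (projH 0 ^~ t) j = GH 0%N 0%N (nd j.+1) t.
Proof.
move=> t0; rewrite /cfluxH /projE /projH !cplus_lin !cminus_lin cplus_radau_p// cminus_radau_m /Wp /Wm.
by field; rewrite gt_eqF.
Qed.

Let vol_top (f : R -> R) (s : T -> R) i : {within `[nd i.1, nd i.1.+1], continuous f} ->
  cvol L (fun i => cell_coef i.1 f i.2 + top_mode i * s i) i =
  \int[mu]_(x in `[nd i.1, nd i.1.+1]) (f x * (bas L (nd i.1) (nd i.1.+1) i.2)^`().[x]).
Proof.
move=> cw; have ik : (i.2 <= k)%N by rewrite -ltnS.
rewrite (coef_deriv_expand HL (ndl _) cw ik) /cvol !big_ord_recr/= (top_volume HL ik) !mulr0 !addr0.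
by apply: eq_bigr => n _; rewrite /top_mode/= (ltn_eqF (ltn_ord n)) mul0r addr0.
Qed.

Let form_parts (G : field) i t : smooth_field xl xr k.+1 G -> 
  h^-1 * (\int[mu]_(x in `[nd i.1, nd i.1.+1]) (G 0%N 0%N x t * (bas L (nd i.1) (nd i.1.+1) i.2)^`().[x])
   - G 0%N 0%N (nd i.1.+1) t * (L i.2).[1] + G 0%N 0%N (nd i.1) t * (L i.2).[0]) =
  - cell_coef i.1 (G 1%N 0%N ^~ t) i.2.
Proof.
move=> SG; rewrite /cell_coef /coef ndh (cell_ibp t _ SG (node_ge_l xlr M0 _) (ndl _) (node_le_r xlr M0 (ltn_ord _))).
by rewrite bas_left bas_right//; ring.
Qed.

(** Fluxes and volume terms of the projection are those of the exact solution;
    an integration by parts on the cell gives the derivative. *)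
Lemma formE_exact i t : 0 <= t ->
  formE L Z h (projE 0 ^~ t) (projH 0 ^~ t) i = - cell_coef i.1 (GE 1%N 0%N ^~ t) i.2.
Proof.
move=> t0; rewrite -form_parts// /formE !exact_fluxE// (node_pred_periodic (g := GE 0%N 0%N ^~ t)) ?perE//.
congr (_ * (_ - _ + _)); rewrite -(vol_top (fun i => 2^-1 * (end_plus 0 i t + end_minus 0 i t))).
  by apply: eq_bigr => n _; rewrite projE_dec.
by apply: jcontw; apply: (sf_cont SE).
Qed.

Lemma formH_exact i t : 0 <= t ->
  formH L Z h (projE 0 ^~ t) (projH 0 ^~ t) i = - cell_coef i.1 (GH 1%N 0%N ^~ t) i.2.
Proof.
move=> t0; rewrite -form_parts// /formH !exact_fluxH// (node_pred_periodic (g := GH 0%N 0%N ^~ t)) ?perH//.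
congr (_ * (_ - _ + _)); rewrite -(vol_top (fun i => 2^-1 / Z * (end_plus 0 i t - end_minus 0 i t))).
  by apply: eq_bigr => n _; rewrite projH_dec.
by apply: jcontw; apply: (sf_cont SH).
Qed.

Lemma cell_coef_deri G i t : smooth_field xl xr k.+1 G -> 0 < t ->
  is_derive t 1 (fun t => cell_coef i.1 (G 0%N 0%N ^~ t) i.2) (cell_coef i.1 (G 0%N 1%N ^~ t) i.2).
Proof.
move=> SG t0; apply: coef_deri => //; [exact: (sf_cont SG)|exact: (sf_cont SG)|].
move=> x s; rewrite in_itv/= => /andP[x1 x2] s0; apply: (sf_dt SG) => //.
rewrite in_itv/= (le_trans (node_ge_l xlr M0 _) x1)/=.
exact: le_trans x2 (node_le_r xlr M0 (ltn_ord _)).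
Qed.

Lemma cell_end_res_deri G c i t : smooth_field xl xr k.+1 G -> c = nd i.1 \/ c = nd i.1.+1 -> 0 < t ->
  is_derive t 1 (fun t => cell_end_res c i.1 (G 0%N 0%N ^~ t)) (cell_end_res c i.1 (G 0%N 1%N ^~ t)).
Proof.
move=> SG hc t0; apply: end_res_deri => //; [exact: (sf_cont SG)|exact: (sf_cont SG)| |].
  move=> x s; rewrite in_itv/= => /andP[x1 x2] s0; apply: (sf_dt SG) => //.
  rewrite in_itv/= (le_trans (node_ge_l xlr M0 _) x1)/=.
  exact: le_trans x2 (node_le_r xlr M0 (ltn_ord _)).
by case: hc => ->; rewrite in_itv/= lexx ltW.
Qed.

Lemma cell_coef_cont G i : smooth_field xl xr k.+1 G -> continuous (fun t => cell_coef i.1 (G 0%N 0%N ^~ t) i.2).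
Proof. by move=> SG; apply: coef_jcont; exact: (sf_cont SG). Qed.

Lemma cell_end_res_cont G c i : smooth_field xl xr k.+1 G -> continuous (fun t => cell_end_res c i.1 (G 0%N 0%N ^~ t)).
Proof.
move=> SG t; have jG : jcont (G 0%N 0%N) by exact: (sf_cont SG).
have c1 : {for t, continuous (fun t => l2res k L (nd i.1) (nd i.1.+1) (G 0%N 0%N ^~ t) c)}.
  apply: contB; first exact: (@jcont_r _ _ c jG).
  apply: cont_sum => m _.
  have c0 := @coef_jcont _ L _ (nd i.1) (nd i.1.+1) m jG t.
  have c2 : {for t, continuous (fun _ : R => (bas L (nd i.1) (nd i.1.+1) m).[c])} by exact: cvg_cst.
  exact: (contM c0 c2).
have c2 : {for t, continuous (fun _ : R => ((bas L (nd i.1) (nd i.1.+1) k).[c])^-1)} by exact: cvg_cst.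
exact: (contM c1 c2).
Qed.

Lemma radau_p_deri i t : 0 < t -> is_derive t 1 (radau_p 0 i) (radau_p 1 i t).
Proof.
move=> t0; apply: deriD; first exact: cell_coef_deri smooth_Wp t0.
by apply: deriZ; apply: cell_end_res_deri smooth_Wp _ t0; left.
Qed.

Lemma radau_m_deri i t : 0 < t -> is_derive t 1 (radau_m 0 i) (radau_m 1 i t).
Proof.
move=> t0; apply: deriD; first exact: cell_coef_deri smooth_Wm t0.
by apply: deriZ; apply: cell_end_res_deri smooth_Wm _ t0; right.
Qed.

Lemma radau_p_cont i : continuous (radau_p 0 i).
Proof.
by move=> t; have := contD (@cell_coef_cont _ i smooth_Wp t) (@contZ _ (top_mode i) _ _ (@cell_end_res_cont _ (nd i.1) i smooth_Wp t)).
Qed.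

Lemma radau_m_cont i : continuous (radau_m 0 i).
Proof.
by move=> t; have := contD (@cell_coef_cont _ i smooth_Wm t) (@contZ _ (top_mode i) _ _ (@cell_end_res_cont _ (nd i.1.+1) i smooth_Wm t)).
Qed.

Lemma projE_deri i t : 0 < t -> is_derive t 1 (projE 0 i) (projE 1 i t).
Proof.
by move=> t0; apply: deriZ; apply: deriD; [exact: radau_p_deri|apply: deriZ; exact: radau_m_deri].
Qed.

Lemma projH_deri i t : 0 < t -> is_derive t 1 (projH 0 i) (projH 1 i t).
Proof.
by move=> t0; apply: deriZ; apply: deriD; [exact: radau_p_deri|apply: deriZ; exact: radau_m_deri].
Qed.

Lemma projE_cont i : continuous (projE 0 i).
Proof.
by move=> t; have := @contZ _ 2^-1 _ _ (contD (@radau_p_cont i t) (@contZ _ 1 _ _ (@radau_m_cont i t))).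
Qed.

Lemma projH_cont i : continuous (projH 0 i).
Proof.
by move=> t; have := @contZ _ (2^-1 / Z) _ _ (contD (@radau_p_cont i t) (@contZ _ (-1) _ _ (@radau_m_cont i t))).
Qed.

Lemma top_shiftE_deri i t : 0 < t -> is_derive t 1 (top_shiftE 0 i) (top_shiftE 1 i t).
Proof.
move=> t0; apply: deriZ; apply: deriZ; apply: deriD.
  by apply: cell_end_res_deri smooth_Wp _ t0; left.
by apply: cell_end_res_deri smooth_Wm _ t0; right.
Qed.

Lemma top_shiftE_cont i : continuous (top_shiftE 0 i).
Proof.
by move=> t; have := @contZ _ (top_mode i) _ _ (@contZ _ 2^-1 _ _ (contD (@cell_end_res_cont _ (nd i.1) i smooth_Wp t)
  (@cell_end_res_cont _ (nd i.1.+1) i smooth_Wm t))).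
Qed.

Lemma top_mode_le i (s : R) : `|top_mode i * s| <= `|s|.
Proof. by rewrite /top_mode; case: (_ == _); rewrite ?mul1r// mul0r normr0. Qed.

Lemma proj_coords_neg i t : t <= 0 -> (projE 0 i t = projE 0 i 0) * (projH 0 i t = projH 0 i 0).
Proof.
move=> t0; have e1 : Wp 0%N 0%N ^~ t = Wp 0%N 0%N ^~ 0.
  by apply/funext => x; rewrite (sf_neg smooth_Wp).
have e2 : Wm 0%N 0%N ^~ t = Wm 0%N 0%N ^~ 0.
  by apply/funext => x; rewrite (sf_neg smooth_Wm).
by rewrite /projE /projH /radau_p /radau_m /end_plus /end_minus e1 e2.
Qed.

End ExactCoordinates.

(** * Coordinates of the discrete solution *)

Section MemoryOfSolutions.
Context {R : realType}.
Local Notation mu := (@lebesgue_measure R).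
Local Notation mR := (measurableTypeR R).
Local Notation Rpos := (`]0%R, +oo[%classic : set R).

Lemma singular_cont (al t : R) (F : R -> R -> R) : 0 < al -> al < 1 -> 0 < t -> jcont F ->
  continuous (fun x => \int[mu]_(s in `]0, t[) ((t - s) `^ (- al) * F x s)).
Proof.
move=> al0 al1 t0 cF x.
have [B B0 hB] := @jcont_bounded _ F (x - 1) (x + 1) 0 t cF.
have iw := singular_integrable al0 al1 t0.
have mT0 : measurable (`]0, t[%classic : set R) by exact: measurable_itv.
have xI : x \in (`]x - 1, x + 1[%classic : set R).
  by rewrite inE/= in_itv/=; apply/andP; split; lra.
apply: (@continuity_under_integral R _ mR mu (fun x s => (t - s) `^ (- al) * F x s) `]0, t[ _ (x - 1) (x + 1) _ _
  (fun s => (t - s) `^ (- al) * B)).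
- exact: mT0.
- by move=> u _; exact: singular_cont_integrable (@jcont_r _ _ u cF).
- apply/aeW => s _ u _.
  by have := @contZ _ ((t - s) `^ (- al)) _ _ (@jcont_l _ _ s cF u).
- exact: (intgZr mT0 _ iw).
- move=> u /=; rewrite in_itv/= => /andP[u1 u2]; apply/aeW => s; rewrite /= in_itv/= => /andP[s0 st].
  by rewrite normrM ger0_norm ?powR_ge0// ler_wpM2l ?powR_ge0// hB// ltW.
- exact: xI.
Qed.

Lemma memory_pair_sub al c p dp psi p' dp' psi' :
  memory_pair (R := R) al c p dp psi -> memory_pair al c p' dp' psi' ->
  memory_pair al c (fun t => p t - p' t) (fun t => dp t - dp' t) (fun t l => psi t l - psi' t l).
Proof.
move=> [c1 z1 d1 b1 q1 w1 e1 i1] [c2 z2 d2 b2 q2 w2 e2 i2]; split.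
- by move=> t; have := contB (c1 t) (c2 t).
- by move=> t t0; rewrite z1// z2// subrr.
- by move=> t t0; have h1 := d1 t t0; have h2 := d2 t t0; apply: deriB.
- move=> d T d0; have [B hB] := b1 d T d0; have [B' hB'] := b2 d T d0.
  exists (B + B') => t dt tT; apply: (le_trans (ler_normB _ _)).
  by apply: lerD; [exact: hB|exact: hB'].
- by move=> l l0 t; have := contB (q1 l l0 t) (q2 l l0 t).
- by move=> t l t0 l0; rewrite w1// w2// subrr.
- move=> t l t0 l0; have h1 := e1 t l t0 l0; have h2 := e2 t l t0 l0.
  by apply: (is_derive_eq (deriB h1 h2)); ring.
- by move=> t t0; apply: intgB; [exact: measurable_itv|exact: i1|exact: i2].
Qed.

End MemoryOfSolutions.

(** Division of the tested equations by the length of the cell, and of the memory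
    equation also by its coefficient. *)
Lemma div_mesh2 (F : fieldType) (d x y v f g c : F) : d != 0 ->
  d * x + d * y + v - f + g = d * c -> x + y + d^-1 * (v - f + g) = c.
Proof. by move=> d0 e; apply: (mulfI d0); rewrite -e; field. Qed.

Lemma div_mesh3 (F : fieldType) (d s l w x y z : F) : d != 0 -> s != 0 ->
  d * (s * x) + l * (d * (s * y)) - w * (d * (s * z)) = 0 -> x = - l * y + w * z.
Proof.
move=> d0 s0 e; have ds0 : d * s != 0 by rewrite mulf_neq0.
apply: (mulfI ds0); rewrite -[LHS]subr0 -e; ring.
Qed.

Section DiscreteCoordinates.
Context {R : realType}.
Local Notation mu := (@lebesgue_measure R).
Local Notation Rpos := (`]0%R, +oo[%classic : set R).
Variables (mu0 eps0 epsinf epss tau0 alpha xl xr : R).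
Hypotheses (mu0_gt0 : 0 < mu0) (eps0_gt0 : 0 < eps0) (epsinf_gt0 : 0 < epsinf).
Hypotheses (tau0_gt0 : 0 < tau0) (eps_lt : epsinf < epss) (xlr : xl < xr).
Variables (k M : nat) (L : nat -> {poly R}).
Hypotheses (M0 : (0 < M)%N) (HL : orthonormal_upto k.+1 L).
Variables (F1 F2 F3 : R -> R -> R) (E0 H0 : R -> R).
Variables (Hh Eh Ph : R -> @piecewise R M) (psih : R -> R -> @piecewise R M).
Hypothesis DG : dg_solution mu0 eps0 epsinf epss tau0 alpha xl xr F1 F2 F3 E0 H0 k Hh Eh Ph psih.
Local Notation h := (mesh_size xl xr M).
Local Notation nd := (node xl xr M).
Local Notation T := ('I_M * 'I_k.+1)%type.
Local Notation Z := (Num.sqrt (mu0 / (eps0 * epsinf))).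
Local Notation b := (eps0 * (epss - epsinf)).
Local Notation a := (tau0 `^ alpha / b).
Local Notation c := (sin (pi * alpha) / pi).
Local Notation cf := (cell_coef xl xr L).
Implicit Types (i : T) (j : 'I_M) (t : R) (u : R -> @piecewise R M).

(** Constant on negative times, like the extension of the exact solution. *)
Definition dg_coord u i t := cf i.1 (horner (u (Num.max 0 t) i.1)) i.2.
Definition dg_coord_deriv u i t := cf i.1 (horner (path_deriv k (fun s => u s i.1) t)) i.2.
Definition dg_psi_coord i t l := dg_coord (psih ^~ l) i t.

Let ndl j : nd j < nd j.+1. Proof. exact: node_lt. Qed.
Let ndh j : nd j.+1 - nd j = h. Proof. exact: node_step. Qed.
Let h0 : 0 < h. Proof. exact: mesh_size_gt0. Qed.
Let hn0 : h != 0. Proof. by rewrite gt_eqF. Qed.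
Let ik i : (i.2 <= k)%N. Proof. by rewrite -ltnS. Qed.
Let b0 : 0 < b. Proof. by rewrite mulr_gt0// subr_gt0. Qed.
Let a0 : 0 < a. Proof. by rewrite divr_gt0// powR_gt0. Qed.

Let max0 t : 0 < t -> Num.max 0 t = t. Proof. by move=> t0; rewrite max_r// ltW. Qed.

Let test (i : T) : @piecewise R M := fun j => bas L (nd j) (nd j.+1) i.2.

Let Vtest i : Vh k (test i).
Proof. by move=> j; rewrite (size_bas HL (ndl j) (ik i)) ltnS. Qed.

Let test_int i f : \int[mu]_(x in cell xl xr i.1) (f x * (test i i.1).[x]) = h * cf i.1 f i.2.
Proof. by rewrite (int_coef L (ndl i.1)) ndh. Qed.

Let test_intZ i (s : R) (p : {poly R}) :
  \int[mu]_(x in cell xl xr i.1) (s * p.[x] * (test i i.1).[x]) = h * (s * cf i.1 (horner p) i.2).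
Proof. by rewrite test_int /cf coefZ_fun//; exact: contw_poly. Qed.

Let trace_minus_test i j : trace_minus xl xr (test i) j = (L i.2).[1].
Proof. exact: bas_right. Qed.

Let trace_plus_test i j : trace_plus xl xr (test i) j = (L i.2).[0].
Proof. by rewrite /trace_plus /test bas_left. Qed.

Section coordinates_at_time.
Variable t : R.
Hypothesis t0 : 0 < t.

Let plusE u j : Vh k (u t) -> trace_plus xl xr (u t) j = cplus L (dg_coord u ^~ t) j.
Proof.
move=> su; rewrite /trace_plus -(poly_trace HL (ndl (ordS j)) _ (su _)).
by apply: eq_bigr => n _; rewrite bas_left /dg_coord max0.
Qed.

Let minusE u j : Vh k (u t) -> trace_minus xl xr (u t) j = cminus L (dg_coord u ^~ t) j.
Proof.
move=> su; rewrite /trace_minus -(poly_trace HL (ndl j) _ (su _)).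
by apply: eq_bigr => n _; rewrite bas_right// /dg_coord max0.
Qed.

Let sqrt_inv : Num.sqrt (eps0 * epsinf / mu0) = Z^-1.
Proof. by rewrite -sqrtrV ?invf_div// divr_ge0 ?mulr_ge0 ?ltW. Qed.

Let VE := dg_VhE DG (ltW t0).
Let VH := dg_VhH DG (ltW t0).

Let fluxE j : flux_E mu0 eps0 epsinf xl xr (Eh t) (Hh t) j = cfluxE L Z (dg_coord Eh ^~ t) (dg_coord Hh ^~ t) j.
Proof. by rewrite /flux_E /avg /jump !plusE// !minusE. Qed.

Let fluxH j : flux_H mu0 eps0 epsinf xl xr (Eh t) (Hh t) j = cfluxH L Z (dg_coord Eh ^~ t) (dg_coord Hh ^~ t) j.
Proof. by rewrite /flux_H /avg /jump !plusE// !minusE// sqrt_inv. Qed.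

Let volE u i : \int[mu]_(x in cell xl xr i.1) ((u t i.1).[x] * (test i i.1)^`().[x]) = cvol L (dg_coord u ^~ t) i.
Proof.
rewrite (coef_deriv_expand HL (ndl _) _ (ik i)); last exact: contw_poly.
by apply: eq_bigr => n _; rewrite /dg_coord max0.
Qed.

Let us u : (forall s, 0 <= s -> Vh k (u s)) -> forall i s, 0 <= s -> (size (u s i.1) <= k.+1)%N.
Proof. by move=> Vu i s s0; exact: Vu. Qed.

Let dtE u i x : (forall s, 0 <= s -> Vh k (u s)) -> time_regular u ->
  pw_dt u t i.1 x = (path_deriv k (fun s => u s i.1) t).[x].
Proof. by move=> Vu ru; exact: (path_eval_deri (us Vu i) (ru i.1) x t0). Qed.

Let test_dt u i (s : R) : (forall s, 0 <= s -> Vh k (u s)) -> time_regular u ->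
  \int[mu]_(x in cell xl xr i.1) (s * pw_dt u t i.1 x * (test i i.1).[x]) = h * (s * dg_coord_deriv u i t).
Proof.
move=> Vu ru; rewrite -test_intZ; apply: Rint_eq => x _; congr (_ * _ * _); exact: dtE.
Qed.

Lemma faraday_coords i :
  mu0 * dg_coord_deriv Hh i t + formE L Z h (dg_coord Eh ^~ t) (dg_coord Hh ^~ t) i = cf i.1 (F1 ^~ t) i.2.
Proof.
have := dg_faraday DG i.1 t0 (Vtest i).
rewrite test_dt; [|exact: (dg_VhH DG)|exact: (dg_regH DG)].
rewrite (volE Eh) !fluxE trace_minus_test trace_plus_test test_int /formE => e.
by apply: (mulfI hn0); rewrite -e mulrDr [h * (h^-1 * _)]mulrA divff// mul1r !addrA.
Qed.

Lemma ampere_coords i :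
  eps0 * epsinf * dg_coord_deriv Eh i t + dg_coord_deriv Ph i t + formH L Z h (dg_coord Eh ^~ t) (dg_coord Hh ^~ t) i = cf i.1 (F2 ^~ t) i.2.
Proof.
have := dg_ampere DG i.1 t0 (Vtest i).
rewrite test_dt; [|exact: (dg_VhE DG)|exact: (dg_regE DG)].
have -> : \int[mu]_(x in cell xl xr i.1) (pw_dt Ph t i.1 x * (test i i.1).[x]) = h * dg_coord_deriv Ph i t.
  rewrite -[dg_coord_deriv _ _ _]mul1r -test_dt; [|exact: (dg_VhP DG)|exact: (dg_regP DG)].
  by apply: Rint_eq => x _; rewrite mul1r.
rewrite (volE Hh) !fluxH trace_minus_test trace_plus_test test_int /formH => e.
exact: (div_mesh2 hn0 e).
Qed.

Let psi_size i l : 0 < l -> (size (psih t l i.1) <= k.+1)%N.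
Proof. by move=> l0; exact: (dg_Vhpsi DG (ltW t0) l0). Qed.

Let psi_int i x : x \in `[nd i.1, nd i.1.+1] ->
  mu.-integrable Rpos (fun l => ((psih t l i.1).[x])%:E).
Proof. by move=> xI; exact: (dg_intpsi DG t0 (j := i.1)). Qed.

Lemma colecole_coords i :
  a * (\int[mu]_(l in Rpos) dg_psi_coord i t l) + dg_coord Ph i t / b - dg_coord Eh i t = cf i.1 (fun x => F3 x t / b) i.2.
Proof.
have e := dg_colecole DG i.1 t0 (Vtest i).
apply: (mulfI hn0); rewrite -test_int -e mulrBr mulrDr; congr (_ + _ - _).
- have := coef_param_integral L (ndl i.1) i.2 a (psi_size i) (@psi_int i).
  rewrite ndh => e1; rewrite /dg_psi_coord /dg_coord max0// -e1 mulrA divff// mul1r.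
  by [].
- rewrite /dg_coord max0// [_ / b]mulrC -test_intZ.
  by apply: Rint_eq => x _; rewrite [_ / b]mulrC.
- by rewrite /dg_coord max0// -test_int.
Qed.

Lemma psi_coords i l : 0 < l ->
  dg_coord_deriv (psih ^~ l) i t = - l * dg_psi_coord i t l + c * l `^ (alpha - 1) * dg_coord_deriv Ph i t.
Proof.
move=> l0; have := dg_psi DG i.1 t0 l0 (Vtest i).
rewrite test_dt; [|by move=> s s0; exact: (dg_Vhpsi DG)|exact: (dg_regpsi DG)].
rewrite test_dt; [|exact: (dg_VhP DG)|exact: (dg_regP DG)].
rewrite test_intZ /dg_psi_coord /dg_coord max0// => e.
have an0 : a != 0 by rewrite gt_eqF.
exact: (div_mesh3 hn0 an0 e).
Qed.

End coordinates_at_time.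

Lemma dg_coord_cont u i : (forall s, 0 <= s -> Vh k (u s)) -> time_regular u -> continuous (dg_coord u i).
Proof. by move=> Vu ru; exact: (path_coef_cont (u := fun s => u s i.1) (fun s s0 => Vu s s0 i.1) (ru i.1)). Qed.

Lemma dg_coord_deri u i t : (forall s, 0 <= s -> Vh k (u s)) -> time_regular u -> 0 < t ->
  is_derive t 1 (dg_coord u i) (dg_coord_deriv u i t).
Proof. by move=> Vu ru t0; exact: (@path_coef_deri _ k L (nd i.1) (nd i.1.+1) (fun s => u s i.1) (fun s s0 => Vu s s0 i.1) (ru i.1)). Qed.

Lemma dg_coord_neg u i t : t <= 0 -> dg_coord u i t = dg_coord u i 0.
Proof. by move=> t0; rewrite /dg_coord maxxx max_l. Qed.

(** [dg_psi], tested with the basis functions, is the memory equation for each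
    coordinate; the polarization starts from 0 because its initial value is the
    L2 projection of 0. *)
Lemma discrete_memory i : memory_pair alpha c (dg_coord Ph i) (dg_coord_deriv Ph i) (dg_psi_coord i).
Proof.
have VP := dg_VhP DG; have rP := dg_regP DG.
have Vpsi l (l0 : 0 < l) s (s0 : 0 <= s) : Vh k (psih s l) by exact: (dg_Vhpsi DG).
split.
- exact: dg_coord_cont VP rP.
- move=> t t0; rewrite dg_coord_neg// /dg_coord maxxx /cf.
  have [_ iP] := dg_initP DG.
  rewrite (l2proj_coef HL (ndl i.1) (f := fun=> 0) _ (iP i.1) (ik i)); last first.
    by apply: continuous_subspaceT => x; exact: cvg_cst.
  by rewrite /coef (@Rint_eq _ _ _ (fun=> 0)) ?Rintegral_cst ?mul0r ?mulr0// => x _; rewrite mul0r.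
- by move=> t; exact: dg_coord_deri VP rP.
- by move=> d T d0; exact: (@path_dcoef_bound _ k L (nd i.1) (nd i.1.+1) (fun s => Ph s i.1) (rP i.1)).
- by move=> l l0; exact: (dg_coord_cont (Vpsi l l0) (dg_regpsi DG l0)).
- move=> t l t0 l0; rewrite /dg_psi_coord dg_coord_neg// /dg_coord maxxx (dg_initpsi DG i.1 l0) /cf /coef.
  by rewrite (@Rint_eq _ _ _ (fun=> 0)) ?Rintegral_cst ?mul0r ?mulr0// => x _; rewrite horner0 mul0r.
- by move=> t l t0 l0; rewrite -psi_coords//; have := @dg_coord_deri (psih ^~ l) i t (Vpsi l l0) (dg_regpsi DG l0) t0.
- move=> t t0; rewrite /dg_psi_coord /dg_coord max0//.
  have hs l : 0 < l -> (size (psih t l i.1) <= k.+1)%N by move=> l0; exact: (Vpsi l l0 t (ltW t0) i.1).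
  have hi x : x \in `[nd i.1, nd i.1.+1] -> mu.-integrable Rpos (fun l => ((psih t l i.1).[x])%:E).
    by move=> xI; exact: (dg_intpsi DG t0 (j := i.1)).
  exact (@coef_integrable _ k L _ _ (ndl i.1) (fun l => psih t l i.1) i.2 hs hi).
Qed.

End DiscreteCoordinates.

(** * The equations of the exact solution *)

Section ExactSolution.
Context {R : realType}.
Local Notation mu := (@lebesgue_measure R).
Local Notation Rpos := (`]0%R, +oo[%classic : set R).
Variables (mu0 eps0 epsinf epss tau0 alpha xl xr : R).
Hypotheses (mu0_gt0 : 0 < mu0) (eps0_gt0 : 0 < eps0) (epsinf_gt0 : 0 < epsinf).
Hypotheses (tau0_gt0 : 0 < tau0) (eps_lt : epsinf < epss) (xlr : xl < xr).
Hypotheses (alpha_gt0 : 0 < alpha) (alpha_lt1 : alpha < 1).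
Variables (k : nat) (F1 F2 F3 : R -> R -> R) (E0 H0 : R -> R) (H E P : R -> R -> R).
Hypothesis HEP : exact_solution mu0 eps0 epsinf epss tau0 alpha xl xr F1 F2 F3 E0 H0 k H E P.
Variables GH GE GP : nat -> nat -> R -> R -> R.
Hypotheses (SH : smooth_field xl xr k.+1 GH) (SE : smooth_field xl xr k.+1 GE)
  (SP : smooth_field xl xr k.+1 GP).
Hypothesis HG : forall x t, x \in `[xl, xr] -> 0 <= t -> H x t = GH 0%N 0%N x t.
Hypothesis EG : forall x t, x \in `[xl, xr] -> 0 <= t -> E x t = GE 0%N 0%N x t.
Hypothesis PG : forall x t, x \in `[xl, xr] -> 0 <= t -> P x t = GP 0%N 0%N x t.
Variables (M : nat) (L : nat -> {poly R}).
Hypotheses (M0 : (0 < M)%N) (HL : orthonormal_upto k.+1 L).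
Local Notation h := (mesh_size xl xr M).
Local Notation nd := (node xl xr M).
Local Notation T := ('I_M * 'I_k.+1)%type.
Local Notation Z := (Num.sqrt (mu0 / (eps0 * epsinf))).
Local Notation b := (eps0 * (epss - epsinf)).
Local Notation a := (tau0 `^ alpha / b).
Local Notation c := (sin (pi * alpha) / pi).
Local Notation cf := (cell_coef xl xr L).
Local Notation ye := (projE xl xr L Z GE GH).
Local Notation xe := (projH xl xr L Z GE GH).
Local Notation sE := (top_shiftE xl xr L Z GE GH).
Local Notation sH := (top_shiftH xl xr L Z GE GH).
Implicit Types (i : T) (j : 'I_M) (t x : R).

Let ndl j : nd j < nd j.+1. Proof. exact: node_lt. Qed.

Let node_in j x : x \in `[nd j, nd j.+1] -> x \in `[xl, xr].
Proof.
rewrite !in_itv/= => /andP[x1 x2]; rewrite (le_trans (node_ge_l xlr M0 _) x1)/=.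
exact: le_trans x2 (node_le_r xlr M0 (ltn_ord _)).
Qed.

Let node_oo j x : x \in `]nd j, nd j.+1[ -> x \in `]xl, xr[.
Proof.
rewrite !in_itv/= => /andP[x1 x2]; rewrite (le_lt_trans (node_ge_l xlr M0 _) x1)/=.
exact: lt_le_trans x2 (node_le_r xlr M0 (ltn_ord _)).
Qed.

Let field_dt u (G : nat -> nat -> R -> R -> R) x t : smooth_field xl xr k.+1 G ->
  (forall x t, x \in `[xl, xr] -> 0 <= t -> u x t = G 0%N 0%N x t) ->
  x \in `[xl, xr] -> 0 < t -> dt u x t = G 0%N 1%N x t.
Proof.
move=> SG uG xI t0; apply: deri_derive1; apply: deri_near (sf_dt SG xI t0).
near=> s; rewrite uG//; apply: ltW; near: s; exact: lt_nbhsr.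
Unshelve. all: by end_near. Qed.

Let field_dx u (G : nat -> nat -> R -> R -> R) x t : smooth_field xl xr k.+1 G ->
  (forall x t, x \in `[xl, xr] -> 0 <= t -> u x t = G 0%N 0%N x t) ->
  x \in `]xl, xr[ -> 0 <= t -> dx u x t = G 1%N 0%N x t.
Proof.
move=> SG uG xI t0; apply: deri_derive1.
have h1 := sf_dx SG t (ltn0Sn k) (leq0n 1) xI.
apply: deri_near h1; near=> y; rewrite uG//; apply: subset_itv_oo_cc.
by near: y; exact: near_in_itvoo.
Unshelve. all: by end_near. Qed.

Let cG (G : nat -> nat -> R -> R -> R) n q t : smooth_field xl xr k.+1 G -> (n <= k.+1)%N -> (q <= 1)%N ->
  continuous (G n q ^~ t).
Proof. by move=> SG nk q1; apply: jcont_l; exact: (sf_cont SG). Qed.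

Let cw (f : R -> R) j : continuous f -> {within `[nd j, nd j.+1], continuous f}.
Proof. by move=> cf; exact: continuous_subspaceT. Qed.

Let perE t : 0 <= t -> GE 0%N 0%N xl t = GE 0%N 0%N xr t.
Proof.
by move=> t0; rewrite -!EG// ?in_itv/= ?lexx ?(ltW xlr)//; exact: (exact_bcE HEP).
Qed.

Let perH t : 0 <= t -> GH 0%N 0%N xl t = GH 0%N 0%N xr t.
Proof.
by move=> t0; rewrite -!HG// ?in_itv/= ?lexx ?(ltW xlr)//; exact: (exact_bcH HEP).
Qed.

Let e0 : 0 < eps0 * epsinf. Proof. exact: mulr_gt0. Qed.
Let Z0 : 0 < Z. Proof. by rewrite sqrtr_gt0 divr_gt0. Qed.
Let b0 : 0 < b. Proof. by rewrite mulr_gt0// subr_gt0. Qed.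

Let cf_lin (s : R) f g j m : continuous f -> continuous g ->
  cf j (fun x => s * f x - g x) m = s * cf j f m - cf j g m.
Proof.
move=> cf cg; rewrite /cell_coef coefB_fun ?coefZ_fun//; try exact: cw.
by apply: contwZ; exact: cw.
Qed.

Section at_time.
Variable t : R.
Hypothesis t0 : 0 < t.
Let t0' : 0 <= t := ltW t0.

Lemma exact_faraday_coords i :
  mu0 * cf i.1 (GH 0%N 1%N ^~ t) i.2 + formE L Z h (ye 0 ^~ t) (xe 0 ^~ t) i = cf i.1 (F1 ^~ t) i.2.
Proof.
have c1 : continuous (GH 0%N 1%N ^~ t) by exact: cG.
have c2 : continuous (GE 1%N 0%N ^~ t) by exact: cG.
rewrite formE_exact// -cf_lin//; symmetry; apply: coef_ext_oo; last first.
  by move=> x; have := contB (@contZ _ mu0 _ _ (c1 x)) (c2 x).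
move=> x xI; have xI' := node_oo xI.
have xJ : x \in `[xl, xr] by exact: subset_itv_oo_cc.
have := exact_faraday HEP xI' t0.
rewrite (field_dt SH HG xJ t0) (field_dx SE EG xI' t0') => ->.
by rewrite addrAC subrr add0r.
Qed.

Lemma exact_ampere_coords i :
  eps0 * epsinf * cf i.1 (GE 0%N 1%N ^~ t) i.2 + cf i.1 (GP 0%N 1%N ^~ t) i.2
  + formH L Z h (ye 0 ^~ t) (xe 0 ^~ t) i = cf i.1 (F2 ^~ t) i.2.
Proof.
have c1 : continuous (GE 0%N 1%N ^~ t) by exact: cG.
have c2 : continuous (GH 1%N 0%N ^~ t) by exact: cG.
have c3 : continuous (GP 0%N 1%N ^~ t) by exact: cG.
have c4 : continuous (fun x => 1 * GH 1%N 0%N x t - GP 0%N 1%N x t).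
  by move=> x; have := contB (@contZ _ 1 _ _ (c2 x)) (c3 x).
have e : cf i.1 (F2 ^~ t) i.2 =
    eps0 * epsinf * cf i.1 (GE 0%N 1%N ^~ t) i.2 - (1 * cf i.1 (GH 1%N 0%N ^~ t) i.2 - cf i.1 (GP 0%N 1%N ^~ t) i.2).
  rewrite -!cf_lin//; apply: coef_ext_oo; last first.
    by move=> x; have := contB (@contZ _ (eps0 * epsinf) _ _ (c1 x)) (c4 x).
  move=> x xI; have xI' := node_oo xI.
  have xJ : x \in `[xl, xr] by exact: subset_itv_oo_cc.
  have := exact_ampere HEP xI' t0.
  rewrite (field_dt SE EG xJ t0) (field_dt SP PG xJ t0) (field_dx SH HG xI' t0') => ->.
  by ring.
by rewrite formH_exact// e; ring.
Qed.

(** The integral in [caputo] is a continuous function of x by [singular_cont], and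
    its coordinates are those of the time derivative of P by [singular_fubini]. *)
Lemma exact_colecole_coords i :
  a * (\int[mu]_(l in Rpos) exact_memory alpha c (fun s => cf i.1 (GP 0%N 1%N ^~ s) i.2) t l)
  + cf i.1 (GP 0%N 0%N ^~ t) i.2 / b - cf i.1 (GE 0%N 0%N ^~ t) i.2 = cf i.1 (fun x => F3 x t / b) i.2.
Proof.
pose S x := \int[mu]_(s in `]0, t[) ((t - s) `^ (- alpha) * GP 0%N 1%N x s).
have jP : jcont (GP 0%N 1%N) by exact: (sf_cont SP).
have cS : continuous S by exact: singular_cont.
have c1 : continuous (GP 0%N 0%N ^~ t) by exact: cG.
have c2 : continuous (GE 0%N 0%N ^~ t) by exact: cG.
have c3 : continuous (fun x => b^-1 * GP 0%N 0%N x t - GE 0%N 0%N x t).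
  by move=> x; have := contB (@contZ _ b^-1 _ _ (c1 x)) (c2 x).
have c4 : continuous (fun x => - 1 * (b^-1 * GP 0%N 0%N x t - GE 0%N 0%N x t)).
  by move=> x; have := @contZ _ (- 1) _ _ (c3 x).
set g := (Gamma (1 - alpha))^-1.
have -> : cf i.1 (fun x => F3 x t / b) i.2 =
    a * g * cf i.1 S i.2 - (- 1) * (b^-1 * cf i.1 (GP 0%N 0%N ^~ t) i.2 - cf i.1 (GE 0%N 0%N ^~ t) i.2).
  have e4 : cf i.1 (fun x => - 1 * (b^-1 * GP 0%N 0%N x t - GE 0%N 0%N x t)) i.2 =
      - 1 * (b^-1 * cf i.1 (GP 0%N 0%N ^~ t) i.2 - cf i.1 (GE 0%N 0%N ^~ t) i.2).
    rewrite -(cf_lin _ _ _ c1 c2) /cell_coef (coefZ_fun L (-1) i.2 (@cw _ i.1 c3)).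
    by [].
  rewrite -e4 -cf_lin//; apply: coef_ext_oo; last first.
    by move=> x; have := contB (@contZ _ (a * g) _ _ (cS x)) (c4 x).
  move=> x xI; have xI' := node_oo xI.
  have xJ : x \in `[xl, xr] by exact: subset_itv_oo_cc.
  have := exact_colecole HEP xI' t0.
  have -> : caputo alpha (P x) t = g * S x.
    rewrite /caputo -/g; congr (_ * _); apply: Rint_eq => s; rewrite /= in_itv/= => /andP[s0 st].
    by congr (_ * _); exact: (field_dt SP PG xJ s0).
  rewrite PG// EG// => e; have -> : F3 x t = tau0 `^ alpha * (g * S x) + GP 0%N 0%N x t - b * GE 0%N 0%N x t.
    by rewrite e addrAC subrr add0r.
  by field; rewrite ?subr_eq0 !gt_eqF.
have cdp : continuous (fun s => cf i.1 (GP 0%N 1%N ^~ s) i.2) by exact: coef_jcont.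
rewrite exact_memory_total// -/g.
suff -> : \int[mu]_(s in `]0, t[) ((t - s) `^ (- alpha) * cf i.1 (GP 0%N 1%N ^~ s) i.2) = cf i.1 S i.2.
  by move: (cf _ S _) => s1; ring.
have cb := @horner_cont _ (bas L (nd i.1) (nd i.1.+1) i.2).
rewrite [RHS]/cell_coef /coef /S (singular_fubini alpha_gt0 alpha_lt1 t0 (ndl i.1) jP cb).
rewrite -RintegralZl//; last exact: singular_cont_integrable (jcont_int (jcont_mul jP cb)).
by apply: Rint_eq => s _; rewrite mulrCA.
Qed.

End at_time.

Lemma exact_memory_coords i : memory_pair alpha c (fun t => cf i.1 (GP 0%N 0%N ^~ t) i.2)
  (fun t => cf i.1 (GP 0%N 1%N ^~ t) i.2) (exact_memory alpha c (fun t => cf i.1 (GP 0%N 1%N ^~ t) i.2)).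
Proof.
apply: exact_memory_pair => //.
- by apply: coef_jcont; exact: (sf_cont SP).
- move=> t t0; rewrite /cell_coef /coef (@Rint_eq _ _ _ (fun=> 0)) ?Rintegral_cst ?mul0r ?mulr0// => x xI.
  rewrite (sf_neg SP)// -PG//; last exact: node_in xI.
  by rewrite (exact_initP HEP) ?mul0r//; exact: node_in xI.
- by move=> t; exact: cell_coef_deri.
- by apply: coef_jcont; exact: (sf_cont SP).
Qed.

Let radau_plus (q : @piecewise R M) (phi f : R -> R) (s : R) i : continuous f ->
  (forall x, x \in `[xl, xr] -> phi x = s * f x) -> is_proj_plus xl xr k phi q ->
  cf i.1 (horner (q i.1)) i.2 = s * (cf i.1 f i.2 + top_mode i * cell_end_res xl xr k L (nd i.1) i.1 f).
Proof.
move=> cf pf [Vq oq eq].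
have Lk : (bas L (nd i.1) (nd i.1.+1) k).[nd i.1] != 0.
  by rewrite bas_left; have [] := top_end_neq0 HL.
have csf : {within `[nd i.1, nd i.1.+1], continuous (fun x => s * f x)} by apply: contwZ; exact: cw.
have nI : nd i.1 \in `[nd i.1, nd i.1.+1] by rewrite in_itv/= lexx ltW.
have ik : (i.2 <= k)%N by rewrite -ltnS.
rewrite {1}/cell_coef (radau_coef HL (ndl i.1) Lk csf (Vq i.1) _ _ ik); last 2 first.
- move=> v sv; rewrite -(oq i.1 v sv); apply: Rint_eq => x xI.
  by rewrite pf//; exact: node_in xI.
- by rewrite eq pf//; exact: node_in nI.
rewrite coefZ_fun ?end_resZ//; try exact: cw.
by rewrite /top_mode /cell_end_res /cell_coef; ring.
Qed.

Let radau_minus (q : @piecewise R M) (phi f : R -> R) (s : R) i : continuous f ->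
  (forall x, x \in `[xl, xr] -> phi x = s * f x) -> is_proj_minus xl xr k phi q ->
  cf i.1 (horner (q i.1)) i.2 = s * (cf i.1 f i.2 + top_mode i * cell_end_res xl xr k L (nd i.1.+1) i.1 f).
Proof.
move=> cf pf [Vq oq eq].
have Lk : (bas L (nd i.1) (nd i.1.+1) k).[nd i.1.+1] != 0.
  by rewrite bas_right//; have [] := top_end_neq0 HL.
have csf : {within `[nd i.1, nd i.1.+1], continuous (fun x => s * f x)} by apply: contwZ; exact: cw.
have nI : nd i.1.+1 \in `[nd i.1, nd i.1.+1] by rewrite in_itv/= lexx ltW.
have ik : (i.2 <= k)%N by rewrite -ltnS.
rewrite {1}/cell_coef (radau_coef HL (ndl i.1) Lk csf (Vq i.1) _ _ ik); last 2 first.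
- move=> v sv; rewrite -(oq i.1 v sv); apply: Rint_eq => x xI.
  by rewrite pf//; exact: node_in xI.
- by rewrite eq pf//; exact: node_in nI.
rewrite coefZ_fun ?end_resZ//; try exact: cw.
by rewrite /top_mode /cell_end_res /cell_coef; ring.
Qed.

Let E0G x : x \in `[xl, xr] -> E0 x = GE 0%N 0%N x 0.
Proof. by move=> xI; rewrite -EG// (exact_initE HEP). Qed.

Let H0G x : x \in `[xl, xr] -> H0 x = GH 0%N 0%N x 0.
Proof. by move=> xI; rewrite -HG// (exact_initH HEP). Qed.

Let sqrt_inv : Num.sqrt (eps0 * epsinf / mu0) = Z^-1.
Proof. by rewrite -sqrtrV ?invf_div// divr_ge0 ?mulr_ge0 ?ltW. Qed.

Let SWp : smooth_field xl xr k.+1 (Wp Z GE GH). Proof. exact: smooth_Wp. Qed.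
Let SWm : smooth_field xl xr k.+1 (Wm Z GE GH). Proof. exact: smooth_Wm. Qed.

(** Uniqueness of the Gauss-Radau projections of the characteristic variables. *)
Lemma init_E (q : @piecewise R M) i : is_proj_E mu0 eps0 epsinf xl xr k E0 H0 q ->
  cf i.1 (horner (q i.1)) i.2 = ye 0 i 0.
Proof.
move=> [qp [qm [hp hm hq]]]; rewrite hq /cell_coef coef_comb -/(cf _ _ _) -/(cf _ _ _).
have cp : continuous (Wp Z GE GH 0%N 0%N ^~ 0) by exact: cG.
have cm : continuous (Wm Z GE GH 0%N 0%N ^~ 0) by exact: cG.
rewrite -/(cf i.1 (horner (qp i.1)) i.2) -/(cf i.1 (horner (qm i.1)) i.2).
rewrite (radau_plus (s := 1) i cp _ hp); last by move=> x xI; rewrite E0G// H0G// mul1r.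
rewrite (radau_minus (s := 1) i cm _ hm); last by move=> x xI; rewrite E0G// H0G// mul1r /Wm mulNr.
by rewrite !mul1r /projE mul1r.
Qed.

Lemma init_H (q : @piecewise R M) i : is_proj_H mu0 eps0 epsinf xl xr k E0 H0 q ->
  cf i.1 (horner (q i.1)) i.2 = xe 0 i 0.
Proof.
move=> [qp [qm [hp hm hq]]]; rewrite hq /cell_coef coef_comb.
have cp : continuous (Wp Z GE GH 0%N 0%N ^~ 0) by exact: cG.
have cm : continuous (Wm Z GE GH 0%N 0%N ^~ 0) by exact: cG.
have Zn : Z != 0 by rewrite gt_eqF.
rewrite -/(cf i.1 (horner (qp i.1)) i.2) -/(cf i.1 (horner (qm i.1)) i.2).
rewrite (radau_plus (s := Z^-1) i cp _ hp); last first.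
  by move=> x xI; rewrite E0G// H0G// sqrt_inv /Wp mulrDr mulrA mulVf// mul1r addrC.
rewrite (radau_minus (s := - Z^-1) i cm _ hm); last first.
  by move=> x xI; rewrite E0G// H0G// sqrt_inv /Wm mulrDr mulrA mulrNN mulVf// mul1r mulNr addrC.
by rewrite /projH /radau_p /radau_m /end_plus /end_minus; ring.
Qed.

End ExactSolution.

(** * The error system *)

Lemma eq1_sub (F : comRingType) (m x y s f g r : F) :
  m * x + f = r -> m * y + g = r -> m * (x + s - y) + (f - g) = m * s.
Proof.
move=> e1 e2; transitivity ((m * x + f) - (m * y + g) + m * s); first by ring.
by rewrite e1 e2 subrr add0r.
Qed.

Lemma eq2_sub (F : comRingType) (m x y s p q f g r : F) :
  m * x + p + f = r -> m * y + q + g = r -> m * (x + s - y) + (p - q) + (f - g) = m * s.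
Proof.
move=> e1 e2; transitivity ((m * x + p + f) - (m * y + q + g) + m * s); first by ring.
by rewrite e1 e2 subrr add0r.
Qed.

Lemma eq3_sub (F : fieldType) (a b i j p q y z s r : F) :
  a * i + p / b - y = r -> a * j + q / b - z = r -> a * (i - j) + (p - q) / b - (y + s - z) = - s.
Proof.
move=> e1 e2; transitivity ((a * i + p / b - y) - (a * j + q / b - z) - s); first by ring.
by rewrite e1 e2 subrr sub0r.
Qed.

Section Convergence.
Context {R : realType}.
Local Notation mu := (@lebesgue_measure R).
Local Notation Rpos := (`]0%R, +oo[%classic : set R).
Variables (mu0 eps0 epsinf epss tau0 alpha xl xr : R).
Hypotheses (mu0_gt0 : 0 < mu0) (eps0_gt0 : 0 < eps0) (epsinf_gt0 : 0 < epsinf).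
Hypotheses (tau0_gt0 : 0 < tau0) (eps_lt : epsinf < epss) (xlr : xl < xr).
Hypotheses (alpha_gt0 : 0 < alpha) (alpha_lt1 : alpha < 1).
Variables (k : nat) (F1 F2 F3 : R -> R -> R) (E0 H0 : R -> R) (H E P : R -> R -> R).
Hypothesis HEP : exact_solution mu0 eps0 epsinf epss tau0 alpha xl xr F1 F2 F3 E0 H0 k H E P.
Variables GH GE GP : nat -> nat -> R -> R -> R.
Hypotheses (SH : smooth_field xl xr k.+1 GH) (SE : smooth_field xl xr k.+1 GE)
  (SP : smooth_field xl xr k.+1 GP).
Hypothesis HG : forall x t, x \in `[xl, xr] -> 0 <= t -> H x t = GH 0%N 0%N x t.
Hypothesis EG : forall x t, x \in `[xl, xr] -> 0 <= t -> E x t = GE 0%N 0%N x t.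
Hypothesis PG : forall x t, x \in `[xl, xr] -> 0 <= t -> P x t = GP 0%N 0%N x t.
Variables (M : nat) (L : nat -> {poly R}).
Hypotheses (M0 : (0 < M)%N) (HL : orthonormal_upto k.+1 L).
Variables (Hh Eh Ph : R -> @piecewise R M) (psih : R -> R -> @piecewise R M).
Hypothesis DG : dg_solution mu0 eps0 epsinf epss tau0 alpha xl xr F1 F2 F3 E0 H0 k Hh Eh Ph psih.
Local Notation h := (mesh_size xl xr M).
Local Notation nd := (node xl xr M).
Local Notation T := ('I_M * 'I_k.+1)%type.
Local Notation Z := (Num.sqrt (mu0 / (eps0 * epsinf))).
Local Notation e := (eps0 * epsinf).
Local Notation b := (eps0 * (epss - epsinf)).
Local Notation a := (tau0 `^ alpha / b).
Local Notation c := (sin (pi * alpha) / pi).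
Local Notation cf := (cell_coef xl xr L).
Local Notation dc := (dg_coord xl xr L).
Local Notation ddc := (dg_coord_deriv xl xr L).
Local Notation ye := (projE xl xr L Z GE GH).
Local Notation xe := (projH xl xr L Z GE GH).
Local Notation sE := (top_shiftE xl xr L Z GE GH).
Local Notation sH := (top_shiftH xl xr L Z GE GH).
Implicit Types (i : T) (j : 'I_M) (t x : R).

Let ndl j : nd j < nd j.+1. Proof. exact: node_lt. Qed.
Let e0 : 0 < e. Proof. exact: mulr_gt0. Qed.
Let Z0 : 0 < Z. Proof. by rewrite sqrtr_gt0 divr_gt0. Qed.
Let b0 : 0 < b. Proof. by rewrite mulr_gt0// subr_gt0. Qed.
Let h0 : 0 < h. Proof. exact: mesh_size_gt0. Qed.

Definition errH i t := xe 0 i t - dc Hh i t.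
Definition errE i t := ye 0 i t - dc Eh i t.
Definition errP i t := cf i.1 (GP 0%N 0%N ^~ t) i.2 - dc Ph i t.
Definition derrH i t := xe 1 i t - ddc Hh i t.
Definition derrE i t := ye 1 i t - ddc Eh i t.
Definition derrP i t := cf i.1 (GP 0%N 1%N ^~ t) i.2 - ddc Ph i t.
Definition errpsi i t l :=
  exact_memory alpha c (fun t => cf i.1 (GP 0%N 1%N ^~ t) i.2) t l - dg_psi_coord xl xr L psih i t l.

Let VE := dg_VhE DG.
Let VH := dg_VhH DG.

Lemma errH_neg i t : t <= 0 -> errH i t = 0.
Proof.
move=> t0; rewrite /errH dg_coord_neg// (proj_coords_neg L Z SE SH i t0).
rewrite /dg_coord maxxx (init_H mu0_gt0 eps0_gt0 epsinf_gt0 xlr HEP SH SE HG EG M0 HL i (dg_initH DG)).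
by rewrite subrr.
Qed.

Lemma errE_neg i t : t <= 0 -> errE i t = 0.
Proof.
move=> t0; rewrite /errE dg_coord_neg// (proj_coords_neg L Z SE SH i t0).
rewrite /dg_coord maxxx (init_E xlr HEP SH SE HG EG M0 HL i (dg_initE DG)).
by rewrite subrr.
Qed.

Let memP i : memory_pair alpha c (errP i) (derrP i) (errpsi i).
Proof.
apply: memory_pair_sub.
  exact: (exact_memory_coords xlr alpha_gt0 alpha_lt1 HEP SP PG L M0 i).
exact: (discrete_memory eps0_gt0 tau0_gt0 eps_lt xlr M0 HL DG i).
Qed.

(** The exact and the discrete solution satisfy the same tested equations, except
    that the projections of E and H differ from the L2 projections by the top
    shifts: these are the residuals. *)
Lemma error_equations : error_system mu0 e b a c alpha errH errE errP derrH derrE derrP errpsi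
  (formE L Z h) (formH L Z h) (fun i t => mu0 * sH 1 i t) (fun i t => e * sE 1 i t) (fun i t => - sE 0 i t).
Proof.
have c0 : 0 < c.
  rewrite divr_gt0 ?pi_gt0//; apply: sin_gt0_pi.
  by rewrite mulr_gt0 ?pi_gt0//= gtr_pMr ?pi_gt0.
have FE := formE_field k M L Z h.
have FH := formH_field k M L Z h.
split.
- exact: mu0_gt0.
- exact: e0.
- exact: b0.
- by rewrite divr_gt0// powR_gt0.
- exact: c0.
- exact: alpha_gt0.
- exact: alpha_lt1.
- exact: FE.
- exact: FH.
- by move=> y x; exact: upwind_dissipation.
- move=> i t; have cx : continuous (xe 0 i) by exact (@projH_cont R xl xr k M L Z GE GH SE SH i).
  have cd : continuous (dc Hh i) by exact: dg_coord_cont VH (dg_regH DG).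
  by have := contB (cx t) (cd t).
- move=> i t; have cx : continuous (ye 0 i) by exact (@projE_cont R xl xr k M L Z GE GH SE SH i).
  have cd : continuous (dc Eh i) by exact: dg_coord_cont VE (dg_regE DG).
  by have := contB (cx t) (cd t).
- by move=> i t; exact: errH_neg.
- by move=> i t; exact: errE_neg.
- move=> i t t0; have h1 := projH_deri L Z xlr M0 SE SH i t0.
  have h2 := dg_coord_deri xl xr L i VH (dg_regH DG) t0.
  exact: deriB h1 h2.
- move=> i t t0; have h1 := projE_deri L Z xlr M0 SE SH i t0.
  have h2 := dg_coord_deri xl xr L i VE (dg_regE DG) t0.
  exact: deriB h1 h2.
- by move=> i; exact: memP.
- move=> i t t0.
  have -> : formE L Z h (errE ^~ t) (errH ^~ t) i =
      formE L Z h (ye 0 ^~ t) (xe 0 ^~ t) i - formE L Z h (dc Eh ^~ t) (dc Hh ^~ t) i.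
    exact: (form_sub FE).
  have e1 := exact_faraday_coords mu0_gt0 eps0_gt0 epsinf_gt0 xlr HEP SH SE HG EG M0 HL t0 i.
  have e2 := faraday_coords xlr M0 HL DG t0 i.
  have e3 := projH_dec L Z0 SE SH t (leqnn 1) i.
  rewrite /derrH e3; exact: (eq1_sub _ e1 e2).
- move=> i t t0.
  have -> : formH L Z h (errE ^~ t) (errH ^~ t) i =
      formH L Z h (ye 0 ^~ t) (xe 0 ^~ t) i - formH L Z h (dc Eh ^~ t) (dc Hh ^~ t) i.
    exact: (form_sub FH).
  have e1 := exact_ampere_coords mu0_gt0 eps0_gt0 epsinf_gt0 xlr HEP SH SE SP HG EG PG M0 HL t0 i.
  have e2 := ampere_coords mu0_gt0 eps0_gt0 epsinf_gt0 xlr M0 HL DG t0 i.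
  have e3 := projE_dec L Z SE SH t (leqnn 1) i.
  rewrite /derrE /derrP e3; exact: (eq2_sub _ e1 e2).
- move=> i t t0.
  have -> : \int[mu]_(l in Rpos) errpsi i t l =
      (\int[mu]_(l in Rpos) exact_memory alpha c (fun t => cf i.1 (GP 0%N 1%N ^~ t) i.2) t l)
      - \int[mu]_(l in Rpos) dg_psi_coord xl xr L psih i t l.
    rewrite /errpsi RintegralB//.
      exact: (mem_int (exact_memory_coords xlr alpha_gt0 alpha_lt1 HEP SP PG L M0 i)).
    exact: (mem_int (discrete_memory eps0_gt0 tau0_gt0 eps_lt xlr M0 HL DG i)).
  have e1 := exact_colecole_coords eps0_gt0 eps_lt xlr alpha_gt0 alpha_lt1 HEP SE SP EG PG L M0 t0 i.
  have e2 := colecole_coords xlr M0 HL DG t0 i.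
  have e3 := projE_dec L Z SE SH t (leq0n 1) i.
  rewrite /errP /errE e3; exact: (eq3_sub _ e1 e2).
Qed.

Variable Lam : R.
Hypothesis Lam_ge : forall m x, (m <= k)%N -> 0 <= x -> x <= 1 -> `|(L m).[x]| <= Lam.
Variables (Tm Cp Cm CE CH CP : R).
Hypotheses (Tm0 : 0 <= Tm) (Cp0 : 0 <= Cp) (Cm0 : 0 <= Cm) (CE0 : 0 <= CE) (CH0 : 0 <= CH) (CP0 : 0 <= CP).
Hypotheses (bp : cell_bound k L xl xr (Wp Z GE GH) Tm Cp) (bm : cell_bound k L xl xr (Wm Z GE GH) Tm Cm).
Hypotheses (bE : cell_bound k L xl xr GE Tm CE) (bH : cell_bound k L xl xr GH Tm CH)
  (bP : cell_bound k L xl xr GP Tm CP).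
Local Notation hk := (h ^+ k.+1).
Let hk0 : 0 <= hk. Proof. by rewrite exprn_ge0// ltW. Qed.
Let C0 : 0 <= Cp + Cm. Proof. exact: addr_ge0. Qed.

Let Zinv0 : 0 <= 2^-1 / Z. Proof. by rewrite divr_ge0 ?ltW. Qed.

Let ndr j : nd j.+1 <= xr. Proof. exact: node_le_r. Qed.

Let resp_le q i t : (q <= 1)%N -> 0 <= t -> t <= Tm -> `|end_plus xl xr L Z GE GH q i t| <= Cp * hk.
Proof.
move=> q1 t0 tT; rewrite -(node_step xl xr M i.1).
exact: (bp (node_ge_l xlr M0 _) (ndl i.1) (ndr i.1) q1 t0 tT (or_introl erefl)).2.
Qed.

Let resm_le q i t : (q <= 1)%N -> 0 <= t -> t <= Tm -> `|end_minus xl xr L Z GE GH q i t| <= Cm * hk.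
Proof.
move=> q1 t0 tT; rewrite -(node_step xl xr M i.1).
exact: (bm (node_ge_l xlr M0 _) (ndl i.1) (ndr i.1) q1 t0 tT (or_intror erefl)).2.
Qed.

Lemma sE_le q i t : (q <= 1)%N -> 0 <= t -> t <= Tm -> `|sE q i t| <= (Cp + Cm) * hk.
Proof.
move=> q1 t0 tT; apply: (le_trans (top_mode_le _ _)); rewrite normrM ger0_norm//.
have h1 := resp_le i q1 t0 tT; have h2 := resm_le i q1 t0 tT.
have h3 := ler_normD (end_plus xl xr L Z GE GH q i t) (end_minus xl xr L Z GE GH q i t).
have h4 : 0 <= `|end_plus xl xr L Z GE GH q i t| by [].
have h5 : 0 <= `|end_minus xl xr L Z GE GH q i t| by [].
lra.
Qed.

Lemma sH_le q i t : (q <= 1)%N -> 0 <= t -> t <= Tm -> `|sH q i t| <= 2^-1 / Z * ((Cp + Cm) * hk).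
Proof.
move=> q1 t0 tT; apply: (le_trans (top_mode_le _ _)); rewrite normrM ger0_norm//.
apply: ler_wpM2l => //; apply: (le_trans (ler_normB _ _)); rewrite mulrDl.
by apply: lerD; [exact: resp_le|exact: resm_le].
Qed.

(** Large enough for the three residuals at once. *)
Definition residual_const : R := (mu0 * (2^-1 / Z) + e + 1) * (Cp + Cm).

(** The residual of the third equation is Lipschitz in time because the top shift
    of the time derivative is again of size h^(k+1). *)
Lemma error_sum_le : \sum_i (errH i Tm ^+ 2 + errE i Tm ^+ 2 + errP i Tm ^+ 2) <=
  #|{: T}|%:R * (3 * (1 + Tm) ^+ 2 / energy_coef mu0 e b ^+ 2 * (residual_const * hk) ^+ 2).
Proof.
have rc0 : 0 <= residual_const.
  by rewrite mulr_ge0// !addr_ge0// ?(ltW e0)// mulr_ge0// ltW.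
have rho0 : 0 <= residual_const * hk by rewrite mulr_ge0.
move: Tm0; rewrite le_eqVlt => /orP[/eqP T0|T0].
  rewrite -T0 big1; first by rewrite mulr_ge0// mulr_ge0 ?sqr_ge0// divr_ge0 ?sqr_ge0// mulr_ge0 ?sqr_ge0.
  by move=> i _; rewrite errH_neg// errE_neg// (mem_p0 (memP i))// !expr0n /= !addr0.
have m1 : 0 <= mu0 * (2^-1 / Z) by rewrite mulr_ge0// ltW.
have X0 : 0 <= (Cp + Cm) * hk by rewrite mulr_ge0.
have rE : residual_const * hk = mu0 * (2^-1 / Z) * ((Cp + Cm) * hk) + e * ((Cp + Cm) * hk) + (Cp + Cm) * hk.
  by rewrite /residual_const; ring.
have y1 : 0 <= mu0 * (2^-1 / Z) * ((Cp + Cm) * hk) by rewrite mulr_ge0.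
have y2 : 0 <= e * ((Cp + Cm) * hk) by rewrite mulr_ge0// ltW.
apply: (energy_estimate error_equations T0 rho0).
- move=> i t t0 tT; rewrite normrM gtr0_norm// rE.
  have := ler_wpM2l (ltW mu0_gt0) (sH_le i (leqnn 1) (ltW t0) tT); rewrite mulrA; lra.
- move=> i t t0 tT; rewrite normrM gtr0_norm// rE.
  have := ler_wpM2l (ltW e0) (sE_le i (leqnn 1) (ltW t0) tT); lra.
- move=> i t t0 tT; rewrite normrN rE.
  have := sE_le i (leq0n 1) (ltW t0) tT; lra.
- move=> i t t' t'0 tt' tT; rewrite -opprD normrN.
  have ds s : s \in `]t', t[ -> is_derive s 1 (sE 0 i) (sE 1 i s).
    rewrite in_itv/= => /andP[s1 s2].
    by apply: (top_shiftE_deri L Z xlr M0 SE SH i); exact: lt_trans s1.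
  apply: (@lipschitz_increment R (sE 0 i) (sE 1 i) _ t' t tt' _ ds _).
  + by apply: continuous_subspaceT; exact (@top_shiftE_cont R xl xr k M L Z GE GH SE SH i).
  + move=> s; rewrite in_itv/= => /andP[s1 s2]; rewrite rE.
    have s0 := lt_trans t'0 s1; have sT := le_trans (ltW s2) tT.
    have := sE_le i (leqnn 1) (ltW s0) sT; lra.
Qed.

Let resid_le (G : nat -> nat -> R -> R -> R) (C : R) j x : cell_bound k L xl xr G Tm C ->
  x \in `[nd j, nd j.+1] -> `|l2res k L (nd j) (nd j.+1) (G 0%N 0%N ^~ Tm) x| <= C * hk.
Proof.
move=> bG xI; rewrite -(node_step xl xr M j).
exact: ((bG _ _ _ _ _ (node_ge_l xlr M0 _) (ndl j) (ndr j) (leq0n 1) Tm0 (lexx _) (or_introl erefl)).1 x xI).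
Qed.

Let proj_resid (u : R -> @piecewise R M) (G : nat -> nat -> R -> R -> R) (w s : T -> R) (C D : R) j x :
  (forall t, 0 <= t -> Vh k (u t)) ->
  cell_bound k L xl xr G Tm C -> x \in `[nd j, nd j.+1] ->
  (forall i, w i = cf i.1 (G 0%N 0%N ^~ Tm) i.2 + top_mode i * s i) ->
  (forall i, `|top_mode i * s i| <= D) -> 0 <= D ->
  `|G 0%N 0%N x Tm - (u Tm j).[x] - \sum_(m < k.+1) (w (j, m) - dc u (j, m) Tm) * (bas L (nd j) (nd j.+1) m).[x]|
  <= C * hk + D * Lam.
Proof.
move=> Vu bG xI wE sD D0.
have -> : (u Tm j).[x] = \sum_(m < k.+1) dc u (j, m) Tm * (bas L (nd j) (nd j.+1) m).[x].
  by rewrite -(poly_trace HL (ndl j) x (Vu _ Tm0 j)); apply: eq_bigr => m _; rewrite /dg_coord max_r.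
rewrite -addrA -opprD -big_split/=.
rewrite (eq_bigr (fun m : 'I_k.+1 => cf j (G 0%N 0%N ^~ Tm) m * (bas L (nd j) (nd j.+1) m).[x]
   + (top_mode (j, m) * s (j, m)) * (bas L (nd j) (nd j.+1) m).[x])); last first.
  by move=> m _; rewrite wE/=; ring.
rewrite big_split/= opprD addrA; apply: (le_trans (ler_normB _ _)); apply: lerD; first exact: resid_le.
rewrite (bigD1 ord_max)//= big1 ?addr0; last first.
  move=> m; rewrite -(inj_eq val_inj)/= => /negbTE mk.
  by rewrite /top_mode/= mk !mul0r.
rewrite normrM; apply: ler_pM => //; exact: (bas_le (k := k)).
Qed.

Definition errorE_const : R := CE + (Cp + Cm) * Lam.
Definition errorH_const : R := CH + 2^-1 / Z * (Cp + Cm) * Lam.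

(** On each cell, the error is the L2 residual of the exact solution, minus the top
    shift, plus the error in coordinates. *)
Lemma error_total : 
  ((L2norm xl xr (fun x => E x Tm - pw_eval xl xr (Eh Tm) x)%R) ^+ 2
   + (L2norm xl xr (fun x => H x Tm - pw_eval xl xr (Hh Tm) x)%R) ^+ 2
   + (L2norm xl xr (fun x => P x Tm - pw_eval xl xr (Ph Tm) x)%R) ^+ 2
  <= (2 * (errorE_const ^+ 2 + errorH_const ^+ 2 + CP ^+ 2) * (xr - xl) * hk ^+ 2
      + 2 * (h * \sum_i (errH i Tm ^+ 2 + errE i Tm ^+ 2 + errP i Tm ^+ 2)))%:E)%E.
Proof.
have Lam0 : 0 <= Lam by apply: le_trans (Lam_ge (leq0n k) (lexx 0) ler01).
have cG (G : nat -> nat -> R -> R -> R) : smooth_field xl xr k.+1 G -> continuous (G 0%N 0%N ^~ Tm).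
  by move=> SG; apply: jcont_l; exact: (sf_cont SG).
have X0 : 0 <= (Cp + Cm) * hk by rewrite mulr_ge0.
have X1 : 0 <= 2^-1 / Z * ((Cp + Cm) * hk) by rewrite mulr_ge0.
have hE := @L2_error_le R xl xr M xlr M0 k L HL (fun x => E x Tm) (GE 0%N 0%N ^~ Tm) (Eh Tm)
  (errE ^~ Tm) (CE * hk + (Cp + Cm) * hk * Lam) _ (cG _ SE) (fun x xI => EG xI Tm0) _.
have hH := @L2_error_le R xl xr M xlr M0 k L HL (fun x => H x Tm) (GH 0%N 0%N ^~ Tm) (Hh Tm)
  (errH ^~ Tm) (CH * hk + 2^-1 / Z * ((Cp + Cm) * hk) * Lam) _ (cG _ SH) (fun x xI => HG xI Tm0) _.
have hP := @L2_error_le R xl xr M xlr M0 k L HL (fun x => P x Tm) (GP 0%N 0%N ^~ Tm) (Ph Tm)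
  (errP ^~ Tm) (CP * hk + 0 * Lam) _ (cG _ SP) (fun x xI => PG xI Tm0) _.
apply: (le_trans (leeD (leeD (hE _ _) (hH _ _)) (hP _ _))).
- by rewrite addr_ge0// mulr_ge0.
- move=> j x xI; apply: (@proj_resid Eh GE (ye 0 ^~ Tm) (fun i => 2^-1 * (end_plus xl xr L Z GE GH 0 i Tm + end_minus xl xr L Z GE GH 0 i Tm))) => //.
  + by move=> i; rewrite (projE_dec L Z SE SH Tm (leq0n 1) i).
  + by move=> i; exact: sE_le.
- by rewrite addr_ge0// mulr_ge0.
- move=> j x xI; apply: (@proj_resid Hh GH (xe 0 ^~ Tm) (fun i => 2^-1 / Z * (end_plus xl xr L Z GE GH 0 i Tm - end_minus xl xr L Z GE GH 0 i Tm))) => //.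
  + by move=> i; rewrite (projH_dec L Z0 SE SH Tm (leq0n 1) i).
  + by move=> i; exact: sH_le.
- by rewrite addr_ge0// mulr_ge0.
- move=> j x xI; apply: (@proj_resid Ph GP (fun i => cf i.1 (GP 0%N 0%N ^~ Tm) i.2) (fun=> 0)) => //.
  + by move=> s; exact: (dg_VhP DG).
  + by move=> i; rewrite mulr0 addr0.
  + by move=> i; rewrite mulr0 normr0.
rewrite -!EFinD lee_fin !big_split/= /errorE_const /errorH_const.
move: (\sum_i errH i Tm ^+ 2) (\sum_i errE i Tm ^+ 2) (\sum_i errP i Tm ^+ 2) => s1 s2 s3.
rewrite le_eqVlt; apply/orP; left; apply/eqP; ring.
Qed.

End Convergence.

(** * Convergence *)

Lemma basis_bounded (R : realType) (L : nat -> {poly R}) n :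
  exists Lam : R, forall m x, (m <= n)%N -> 0 <= x -> x <= 1 -> `|(L m).[x]| <= Lam.
Proof.
elim: n => [|n [Lam IH]].
  by have [B _ hB] := poly_bounded (L 0%N); exists B => m x; rewrite leqn0 => /eqP ->; exact: hB.
have [B B0 hB] := poly_bounded (L n.+1); exists (Num.max Lam B) => m x.
rewrite leq_eqVlt => /orP[/eqP -> x0 x1|mn x0 x1]; rewrite le_max; first by rewrite hB ?orbT.
by rewrite IH.
Qed.

Theorem theorem3p2 (R : realType)
    (mu0 eps0 epsinf epss tau0 alpha : R)
    (mu0_gt0 : 0 < mu0) (eps0_gt0 : 0 < eps0) (epsinf_gt0 : 0 < epsinf)
    (epss_gt0 : 0 < epss) (tau0_gt0 : 0 < tau0) (eps_lt : epsinf < epss)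
    (alpha_gt0 : 0 < alpha) (alpha_lt1 : alpha < 1)
    (xl xr : R) (xlr : xl < xr)
    (k : nat) (k_ge1 : (1 <= k)%N)
    (F1 F2 F3 : R -> R -> R) (E0 H0 : R -> R) (H E P : R -> R -> R)
    (HEP : exact_solution mu0 eps0 epsinf epss tau0 alpha xl xr
             F1 F2 F3 E0 H0 k H E P) :
  forall t : R, 0 <= t ->
  exists2 C : R, 0 < C &
  forall (M : nat), (0 < M)%N ->
  forall (Hh Eh Ph : R -> @piecewise R M) (psih : R -> R -> @piecewise R M),
    dg_solution mu0 eps0 epsinf epss tau0 alpha xl xr F1 F2 F3 E0 H0 k
      Hh Eh Ph psih ->
    ((L2norm xl xr (fun x => E x t - pw_eval xl xr (Eh t) x)%R) ^+ 2
     + (L2norm xl xr (fun x => H x t - pw_eval xl xr (Hh t) x)%R) ^+ 2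
     + (L2norm xl xr (fun x => P x t - pw_eval xl xr (Ph t) x)%R) ^+ 2
     <= (C * mesh_size xl xr M ^+ (2 * k + 2))%:E)%E.

Proof.
move=> t t0.
have [GH SH HG] := smooth_field_exists xlr (exact_smoothH HEP).
have [GE SE EG] := smooth_field_exists xlr (exact_smoothE HEP).
have [GP SP PG] := smooth_field_exists xlr (exact_smoothP HEP).
have [L HL] := @orthonormal_exists R k.+1.
have [Lam Lam_ge] := basis_bounded L k.
pose Z := Num.sqrt (mu0 / (eps0 * epsinf)).
have SWp : smooth_field xl xr k.+1 (Wp Z GE GH) by exact: smooth_Wp.
have SWm : smooth_field xl xr k.+1 (Wm Z GE GH) by exact: smooth_Wm.
have [Cp Cp0 bp] := field_bound HL Lam_ge t xlr SWp.
have [Cm Cm0 bm] := field_bound HL Lam_ge t xlr SWm.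
have [CE CE0 bE] := field_bound HL Lam_ge t xlr SE.
have [CH CH0 bH] := field_bound HL Lam_ge t xlr SH.
have [CP CP0 bP] := field_bound HL Lam_ge t xlr SP.
pose A := 2 * (errorE_const Lam Cp Cm CE ^+ 2 + errorH_const mu0 eps0 epsinf Lam Cp Cm CH ^+ 2 + CP ^+ 2) * (xr - xl).
pose K := 3 * (1 + t) ^+ 2 / energy_coef mu0 (eps0 * epsinf) (eps0 * (epss - epsinf)) ^+ 2
  * residual_const mu0 eps0 epsinf Cp Cm ^+ 2.
pose C := A + 2 * ((xr - xl) * k.+1%:R * K).
have x0 : 0 <= xr - xl by rewrite subr_ge0 ltW.
have A0 : 0 <= A by rewrite mulr_ge0// mulr_ge0// !addr_ge0// sqr_ge0.
have K0 : 0 <= K by rewrite mulr_ge0 ?sqr_ge0// divr_ge0 ?sqr_ge0// mulr_ge0 ?sqr_ge0.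
have C0 : 0 <= C by rewrite addr_ge0// mulr_ge0// mulr_ge0// mulr_ge0.
exists (C + 1); first by rewrite ltr_wpDl.
move=> M M0 Hh Eh Ph psih DG.
apply: (le_trans (error_total mu0_gt0 eps0_gt0 epsinf_gt0 xlr SH SE SP HG EG PG M0 HL DG
   Lam_ge t0 Cp0 Cm0 CE0 CH0 CP0 bp bm bE bH bP)).
have hS := error_sum_le mu0_gt0 eps0_gt0 epsinf_gt0 tau0_gt0 eps_lt xlr alpha_gt0 alpha_lt1 HEP
   SH SE SP HG EG PG M0 HL DG t0 Cp0 Cm0 bp bm.
rewrite lee_fin; set S := \sum_i _ in hS *.
set h := mesh_size xl xr M; have h0 : 0 < h by exact: mesh_size_gt0.
have hM : M%:R * h = xr - xl by exact: mesh_sizeM.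
have -> : h ^+ (2 * k + 2) = (h ^+ k.+1) ^+ 2.
  by rewrite -exprM [(k.+1 * 2)%N]mulnC mulnS addnC.
rewrite -/h in hS *.
have hS2 : S <= #|{: 'I_M * 'I_k.+1}|%:R * (K * (h ^+ k.+1) ^+ 2).
  by apply: le_trans hS _; rewrite le_eqVlt; apply/orP; left; apply/eqP; rewrite /K; ring.
have cT : #|{: 'I_M * 'I_k.+1}|%:R = M%:R * k.+1%:R :> R by rewrite card_prod !card_ord natrM.
rewrite cT in hS2.
have := ler_wpM2l (ltW h0) hS2.
have -> : h * (M%:R * k.+1%:R * (K * (h ^+ k.+1) ^+ 2)) = (xr - xl) * k.+1%:R * K * (h ^+ k.+1) ^+ 2.
  by rewrite -hM; ring.
move=> h1; have q0 : 0 <= (h ^+ k.+1) ^+ 2 by exact: sqr_ge0.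
rewrite -/A /C; move: q0 h1; move: ((h ^+ k.+1) ^+ 2) ((xr - xl) * k.+1%:R * K) (h * S) => q w s q0 h1.
rewrite !mulrDl mul1r; lra.
Qed.
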